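(* Let $a,b$ be integers with $1\le a<b$, and let $X(a,b)\subset\mathbb{P}^{b+2}$ be the scroll surface defined in the context, with dual hypersurface $X(a,b)^*\subset(\mathbb{P}^{b+2})^*$. Then the closure of the general fibre of the polar map $\phi_{X(a,b)^*}$ of $X(a,b)^*$ is a projective (linear) subspace of dimension $b-a$ of the source projective space of dimension $b+2$.
   Context: Everything is over an algebraically closed field $k$ of characteristic $0$. For a projective variety $X\subset\mathbb{P}^r$, the dual variety $X^*\subset(\mathbb{P}^r)^*$ is the closure of the set of hyperplanes tangent to $X$ at some smooth point. For a hypersurface $V(f)\subset\mathbb{P}^r$ with $f$ a form, the polar map is the rational map $\phi_{V(f)}=\phi_f=(\partial f/\partial x_0:\dots:\partial f/\partial x_r)$ from $\mathbb{P}^r$ to the dual projective space; ''general fibre'' means the fibre over a general point of the (closure of the) image. For integers $0<a\le b$, $S(a,b)\subset\mathbb{P}^{a+b+1}$ is the smooth rational normal scroll surface of degree $a+b$, i.e. the image of $\mathbb{P}(\mathcal{O}_{\mathbb{P}^1}(a)\oplus\mathcal{O}_{\mathbb{P}^1}(b))$ under the complete linear system $|\mathcal{O}(1)|$. It contains a section $E$ with $E^2=a-b$ (unique if $a<b$), a rational normal curve of degree $a$ spanning a linear space $\langle E\rangle$ of dimension $a$. The surface $X(a,b)\subset\mathbb{P}^{b+2}$ is the image of $S(a,b)$ under projection from a general linear subspace of dimension $a-2$ contained in $\langle E\rangle$ (for $a=1$ the centre is empty and $X(1,b)=S(1,b)$). *)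

(* Defs.v *)
From HB Require Import structures.
From mathcomp Require Import all_boot all_order all_algebra.
From mathcomp Require Export mpoly.

Set Implicit Arguments.
Unset Strict Implicit.
Unset Printing Implicit Defensive.

Import GRing.Theory.
Local Open Scope ring_scope.

(* A point of P^(n-1) is given by homogeneous coordinates, i.e. by a nonzero
   row vector x : 'rV_n up to scaling.  A subset of P^(n-1) is given by the
   predicate "x <> 0 and [x] lies in the subset" on row vectors; every subset
   built below is made of nonzero vectors and is stable by nonzero scaling.
   The coordinates of a hyperplane sum_i h_i x_i = 0 give a point h of the dual
   space, so both a space and its dual have type [pset k n]. *)
Definition pset (k : fieldType) (n : nat) := 'rV[k]_n -> Prop.

Section ProjectiveGeometry.

Variable k : fieldType.
Implicit Types (n d e : nat).

Definition psub n (V W : pset k n) : Prop := forall x, V x -> W x.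

Definition vanishes_on n (f : {mpoly k[n]}) (V : pset k n) : Prop :=
  forall x, V x -> f.@[x 0] = 0.

Definition zclosure n (V : pset k n) : pset k n := fun x =>
  x != 0 /\
  forall e (f : {mpoly k[n]}), f \is e.-homog -> vanishes_on f V ->
    f.@[x 0] = 0.

Definition zclosed n (V : pset k n) : Prop :=
  forall x, V x <-> zclosure V x.

Definition zirreducible n (V : pset k n) : Prop :=
  (exists x, V x) /\
  forall V1 V2 : pset k n, zclosed V1 -> zclosed V2 ->
    (forall x, V x -> V1 x \/ V2 x) -> psub V V1 \/ psub V V2.

(* Krull dimension: d is the maximal length of a chain of irreducible closed
   subsets of V. *)
Definition has_chain n (V : pset k n) d : Prop :=
  exists Z : nat -> pset k n,
    (forall i, (i <= d)%N ->
       [/\ zclosed (Z i), zirreducible (Z i) & psub (Z i) V]) /\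
    (forall i, (i < d)%N -> psub (Z i) (Z i.+1) /\ ~ psub (Z i.+1) (Z i)).

Definition has_dim n (V : pset k n) d : Prop :=
  has_chain V d /\ ~ has_chain V d.+1.

Definition linear_subspace n d (V : pset k n) : Prop :=
  exists A : 'M[k]_(d.+1, n),
    row_free A /\ forall x, V x <-> x != 0 /\ (x <= A)%MS.

Definition gradient n (f : {mpoly k[n]}) (x : 'rV[k]_n) : 'rV[k]_n :=
  \row_i (f^`M(i)).@[x 0].

(* The projective tangent space at x, embedded in the ambient space. *)
Definition tangent_space n (V : pset k n) (x : 'rV[k]_n) : pset k n := fun y =>
  y != 0 /\
  forall e (f : {mpoly k[n]}), f \is e.-homog -> vanishes_on f V ->
    gradient f x *m y^T = 0.

Definition smooth_point n (V : pset k n) (x : 'rV[k]_n) : Prop :=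
  V x /\ exists d, has_dim V d /\ linear_subspace d (tangent_space V x).

Definition dual_variety n (V : pset k n) : pset k n :=
  zclosure (fun h => h != 0 /\
    exists x, smooth_point V x /\
      forall y, tangent_space V x y -> h *m y^T = 0).

(* V is the hypersurface f = 0, and the form f generates the homogeneous ideal
   of V; such an f is unique up to a nonzero scalar. *)
Definition hypersurface_form n (V : pset k n) (f : {mpoly k[n]}) : Prop :=
  [/\ exists2 d, (0 < d)%N & f \is d.-homog, f != 0,
      forall x, V x <-> x != 0 /\ f.@[x 0] = 0
    & forall e (g : {mpoly k[n]}), g \is e.-homog -> vanishes_on g V ->
        exists h, g = h * f].

(* The polar map of f sends [x] to [gradient f x].  It is defined where the
   gradient is nonzero: as z <> 0, the condition (gradient f x == z)%MS (equality
   of the spanned subspaces) means that gradient f x is a nonzero multiple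
   of z. *)
Definition polar_fibre n (f : {mpoly k[n]}) (z : 'rV[k]_n) : pset k n := fun x =>
  [/\ x != 0, z != 0 & (gradient f x == z)%MS].

Definition polar_image n (f : {mpoly k[n]}) : pset k n := fun z =>
  exists x, polar_fibre f z x.

(* Q holds on a nonempty open subset of V. *)
Definition general_point n (V : pset k n) (Q : 'rV[k]_n -> Prop) : Prop :=
  exists C : pset k n,
    [/\ zclosed C, ~ psub V C & forall z, V z -> ~ C z -> Q z].

Definition in_span n (V : pset k n) (x : 'rV[k]_n) : Prop :=
  forall m (B : 'M[k]_(m, n)), (forall y, V y -> (y <= B)%MS) -> (x <= B)%MS.

(* Q holds for the general m-dimensional vector subspace of the linear span
   <V> of V.  The subspace is the row space of a full rank matrix L; the rows of
   L range over the affine space <V>^m, and F cuts out a nonempty open subset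
   of it. *)
Definition general_subspace_of_span n m (V : pset k n)
    (Q : 'M[k]_(m, n) -> Prop) : Prop :=
  exists F : {mpoly k[m * n]},
    (exists L : 'M[k]_(m, n),
       (forall i, in_span V (row i L)) /\ F.@[mxvec L 0] != 0) /\
    (forall L : 'M[k]_(m, n),
       (forall i, in_span V (row i L)) -> row_free L -> F.@[mxvec L 0] != 0 ->
       Q L).

(* The point of P^(a+b+1) image of the point of P(O(a) + O(b)) over (s : t) with
   fibre coordinates (u : v): the sections of O(1) are the forms
   u * A(s, t) + v * B(s, t), with A and B homogeneous of degrees a and b. *)
Definition scroll_point a b (s t u v : k) : 'rV[k]_(a.+1 + b.+1) :=
  row_mx (\row_(i < a.+1) (u * s ^+ (a - i) * t ^+ i))
         (\row_(j < b.+1) (v * s ^+ (b - j) * t ^+ j)).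

Definition scroll a b : pset k (a.+1 + b.+1) := fun x =>
  x != 0 /\
  exists s t u v : k, (s, t) != (0, 0) /\ x = scroll_point a b s t u v.

(* The section E, with E^2 = a - b and of degree a, is the locus v = 0. *)
Definition scroll_section a b : pset k (a.+1 + b.+1) := fun x =>
  x != 0 /\
  exists s t u : k, (s, t) != (0, 0) /\ x = scroll_point a b s t u 0.

(* The image of V by the linear projection x |-> x *m P, whose centre is the
   projectivization of the kernel of P. *)
Definition projected n m (P : 'M[k]_(n, m)) (V : pset k n) : pset k m := fun z =>
  z != 0 /\ exists x, V x /\ z = x *m P.

End ProjectiveGeometry.

Arguments scroll k a b : clear implicits.
Arguments scroll_section k a b : clear implicits.

(* Q holds for every X(a,b): for the general centre L, of projective dimension
   a - 2 in <E>, and for every choice of coordinates on the target of the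
   projection from L. *)
Definition for_scroll_surface_X (k : fieldType) (a b : nat)
    (Q : pset k b.+3 -> Prop) : Prop :=
  general_subspace_of_span (scroll_section k a b)
    (fun L : 'M[k]_(a.-1, a.+1 + b.+1) =>
       forall P : 'M[k]_(a.+1 + b.+1, b.+3),
         (kermx P == L)%MS -> Q (projected P (scroll k a b))).

Arguments for_scroll_surface_X k a b Q : clear implicits.

(* Main.v *)
(* The projection maps the section E onto a line, by two coprime forms alpha and
   beta of degree a.  In adapted coordinates a hyperplane is a pair (h, c) of a
   vector h in k^2 and a form C = sum_j c_j X^j of degree b; it is tangent to X(a,b) if and only
   if C and the pencil member A = h_0 alpha + h_1 beta, of degree a, have a common
   root.  So the dual variety is the hypersurface f(h, c) = Res(A, C) = 0.

   The resultant is invariant under C |-> C + A D for deg D <= b - a.  Hence the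
   c-part phi of the gradient of f at (h, c) kills A k[X]_(b - a), which recovers
   h from phi up to a scalar; and phi is a combination of the evaluations at the
   roots r of A with weights f / C(r), which together with the Euler relation in
   h recovers C modulo A.  The remaining freedom is D, and the h-part of the
   gradient is constant exactly when phi (beta D) = 0, a single linear condition.
   Thus the general fibre consists of the multiples of (h, C + A D) with D in a
   space of dimension b - a, and its closure is a projective space of that
   dimension. *)

Require Import Defs.
From HB Require Import structures.
From mathcomp Require Import all_boot all_order all_algebra.
From mathcomp Require Import mpoly.
From mathcomp Require Import separable ring zify.
From Stdlib Require Import Classical FunctionalExtensionality PropExtensionality.

Set Implicit Arguments.
Unset Strict Implicit.
Unset Printing Implicit Defensive.

Import GRing.Theory.
Local Open Scope ring_scope.

(** Two definitions shape the proof. Smoothness refers to Krull dimension, so the scroll must be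
    shown to have dimension exactly 2: a longer chain would give four forms algebraically
    independent on it, against a quadratic bound for its Hilbert function. And the resultant must
    generate the homogeneous ideal of the dual variety: a form vanishing there is pseudo-divided by
    it in the constant coefficient of C, in which it has [a] roots, generically distinct. Gradients
    are never expanded: a directional derivative of the resultant is that of its restriction to a
    line, where a product over roots or an invariance applies. Taking alpha monic of degree [a] and
    beta of smaller degree makes h_0 the leading coefficient of A, so that h_0 <> 0 keeps all roots
    finite. Genericity is always one polynomial condition: a form excludes the bad points of the
    polar image, and Cramer's rule makes alpha and beta polynomial in the centre. The count: D has b
    - a + 1 coefficients under one condition, and scaling restores one, so the fibre spans vectors
    of dimension b - a + 1. *)

Section MultivariatePolynomials.

Variable k : closedFieldType.
Implicit Types (n m d e : nat).

Lemma muni_inj n : injective (@muni n k).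
Proof.
move=> p q; rewrite -[in muni p]/(muni p) => h; apply/mpolyP => m.
have aux (f : {mpoly k[n.+1]}) :
  f@_m = ((muni f)`_(m ord_max))@_[multinom m (widen_ord (leqnSn n) i) | i < n].
  rewrite muniE {1}[f]mpolyE coef_sum !raddf_sum /=; apply: eq_bigr => m' _.
  rewrite coefZ coefXn [LHS]mcoeffZ mcoeffX.
  case: (m' =P m) => [->|nm]; first by rewrite !eqxx !mulr1 mcoeffZ mcoeffX eqxx mulr1.
  rewrite [LHS]mulr0; case: eqP => [e|_]; last by rewrite mulr0 mcoeff0.
  rewrite mulr1 mcoeffZ mcoeffX; case: eqP => [e'|_]; last by rewrite mulr0.
  case: nm; apply/mnmP => i; case: (unliftP ord_max i) => [j ->|->]; last by rewrite e.
  have := congr1 (fun z : 'X_{1..n} => z j) e'; rewrite !mnmE.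
  have -> : lift ord_max j = widen_ord (leqnSn n) j.
    by apply: val_inj; rewrite /= /bump leqNgt ltn_ord.
  by [].
by rewrite !aux h.
Qed.

Lemma meval_muni n (f : {mpoly k[n.+1]}) v :
  f.@[v] = (map_poly (meval (v \o widen_ord (leqnSn n))) (muni f)).[v ord_max].
Proof.
rewrite muniE {1}[f]mpolyE !raddf_sum horner_sum; apply: eq_bigr => m' _ /=.
rewrite map_polyZ map_polyXn hornerZ hornerXn !mevalZ !mevalX big_ord_recr /=.
rewrite mulrA mevalZ mevalX; congr (_ * _ * _); apply: eq_bigr => i _.
by rewrite mnmE.
Qed.

(** Induction on the variables: a point where the leading coefficient in the last variable survives
    leaves a nonzero polynomial in that variable, which has a nonroot. *)
Lemma mpoly_nonzero_point n (f : {mpoly k[n]}) :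
  f != 0 -> exists v : 'I_n -> k, f.@[v] != 0.
Proof.
elim: n f => [|n IH] f f0.
  exists (fun=> 0); apply: contra f0 => /eqP; rewrite [f]nvar0_mpolyC mevalC => ->.
  by rewrite mpolyC0.
have : lead_coef (muni f) != 0.
  by rewrite lead_coef_eq0 -(muni0 n k) (inj_eq (@muni_inj n)).
move=> /IH [v hv].
have : map_poly (meval v) (muni f) != 0.
  apply: contra hv => /eqP h.
  by rewrite lead_coefE -coef_map h coef0.
move=> /closed_nonrootP [t ht].
exists (fun i => if unlift ord_max i is Some j then v j else t).
rewrite meval_muni /= unlift_none; apply: contra ht => /eqP h; apply/rootP.
rewrite -[RHS]h; congr (_.[_]); apply: eq_map_poly => g.
apply: meval_eq => i /=.
have -> : widen_ord (leqnSn n) i = lift ord_max i.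
  by apply: val_inj; rewrite /= /bump leqNgt ltn_ord.
by rewrite liftK.
Qed.

Lemma mpoly_ext n (f g : {mpoly k[n]}) :
  (forall x : 'rV[k]_n, f.@[x 0] = g.@[x 0]) -> f = g.
Proof.
move=> h; apply/eqP; rewrite -subr_eq0; apply/negPn/negP => /mpoly_nonzero_point [v].
rewrite mevalB; have := h (\row_i v i).
rewrite (meval_eq (v2 := v)); last by move=> i; rewrite mxE.
rewrite (meval_eq (v2 := v) g); last by move=> i; rewrite mxE.
by move=> ->; rewrite subrr eqxx.
Qed.

Lemma poly_ext (p q : {poly k}) : (forall x, p.[x] = q.[x]) -> p = q.
Proof.
move=> h; apply/eqP; rewrite -subr_eq0; apply/negPn/negP => /closed_nonrootP [x].
by rewrite /root !hornerE h subrr eqxx.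
Qed.

Lemma poly_ext_generic (p q r : {poly k}) :
  r != 0 -> (forall x, r.[x] != 0 -> p.[x] = q.[x]) -> p = q.
Proof.
move=> r0 h; apply/eqP; rewrite -subr_eq0.
suff : r * (p - q) == 0 by rewrite mulf_eq0 (negPf r0).
apply/eqP/poly_ext => x; rewrite !hornerE.
by have [->|/h ->] := eqVneq r.[x] 0; rewrite ?mul0r // subrr mulr0.
Qed.

Lemma coprimep_of_roots (p q : {poly k}) :
  (forall x, p.[x] = 0 -> q.[x] = 0 -> False) -> coprimep p q.
Proof.
move=> h; apply/coprimepP => d dp dq; apply/negPn/negP => nd.
have /closed_rootP [x] : size d != 1%N by rewrite size_poly_eq1.
rewrite -dvdp_XsubCl => dx.
by apply: (h x); apply/rootP; rewrite -dvdp_XsubCl (dvdp_trans dx).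
Qed.

(** Identities need only be checked off the zero set of a nonzero polynomial: [g * f] vanishes
    everywhere, and polynomials form a domain. *)
Lemma mpoly_generic n (f g : {mpoly k[n]}) (x0 : 'rV[k]_n) :
  g.@[x0 0] != 0 -> (forall x : 'rV[k]_n, g.@[x 0] != 0 -> f.@[x 0] = 0) -> f = 0.
Proof.
move=> g0 h; apply/eqP; suff : g * f == 0.
  rewrite mulf_eq0 => /orP[/eqP e|//]; by rewrite e meval0 eqxx in g0.
apply/eqP/mpoly_ext => x; rewrite mevalM meval0.
by have [->|/h ->] := eqVneq g.@[x 0] 0; rewrite ?mul0r ?mulr0.
Qed.

(** * Restriction of polynomials to curves *)

Definition curve_eval n (c : 'I_n -> {poly k}) : {mpoly k[n]} -> {poly k} :=
  mmap polyC c.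

Lemma curve_evalE n (c : 'I_n -> {poly k}) f t :
  (curve_eval c f).[t] = f.@[fun i => (c i).[t]].
Proof.
rewrite /curve_eval /mmap horner_sum mevalE; apply: eq_bigr => m _.
rewrite hornerM hornerC /mmap1 horner_prod; congr (_ * _).
by apply: eq_bigr => i _; rewrite horner_exp.
Qed.

Lemma curve_eval_deriv n (c : 'I_n -> {poly k}) f :
  (curve_eval c f)^`() = \sum_i curve_eval c f^`M(i) * (c i)^`().
Proof.
have hM g h : (curve_eval c g)^`() = \sum_i curve_eval c g^`M(i) * (c i)^`() ->
    (curve_eval c h)^`() = \sum_i curve_eval c h^`M(i) * (c i)^`() ->
    (curve_eval c (g * h))^`() = \sum_i curve_eval c (g * h)^`M(i) * (c i)^`().
  move=> hg hh; rewrite /curve_eval rmorphM /= derivM -/(curve_eval c g) -/(curve_eval c h).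
  rewrite hg hh mulr_suml mulr_sumr -big_split; apply: eq_bigr => i _ /=.
  rewrite mderivM rmorphD !rmorphM /= -!/(curve_eval c _); ring.
have hX (m : 'X_{1..n}) : (curve_eval c 'X_[m])^`() = \sum_i curve_eval c 'X_[m]^`M(i) * (c i)^`().
  rewrite mpolyXE_id; elim/big_ind: _ => [| g h hg hh|i _].
  - rewrite /curve_eval rmorph1 derivC big1 // => i _.
    by rewrite -mpolyC1 mderivC rmorph0 mul0r.
  - exact: hM.
  - elim: (m i) => [|e IH].
      rewrite expr0 /curve_eval rmorph1 derivC big1 // => j _.
      by rewrite -mpolyC1 mderivC rmorph0 mul0r.
    rewrite exprS; apply: hM => //.
    rewrite (bigD1 i) //= big1 ?addr0.
      rewrite /curve_eval mmapX mmap1U mderivX mnm1E eqxx scale1r.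
      rewrite (_ : (U_(i) - U_(i))%MM = 0%MM) ?mpolyX0 ?rmorph1 ?mul1r //.
      by apply/mnmP => j; rewrite mnmBE subnn mnm0E.
    move=> j ji; rewrite mderivX mnm1E eq_sym (negPf ji) scale0r /curve_eval rmorph0.
    by rewrite mul0r.
elim/mpolyind: f => [|c0 m f _ _ IH].
  rewrite /curve_eval rmorph0 deriv0 big1 // => i _.
  by rewrite mderiv0 rmorph0 mul0r.
rewrite /curve_eval rmorphD derivD /= -/(curve_eval c f) IH.
rewrite mmapZ derivM derivC mul0r add0r -/(curve_eval c _) hX mulr_sumr -big_split.
apply: eq_bigr => i _ /=; rewrite mderivD mderivZ /curve_eval rmorphD /= mmapZ; ring.
Qed.

End MultivariatePolynomials.

(** * Homogeneous forms and gradients *)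

Section HomogeneousForms.

Variable k : closedFieldType.
Implicit Types (n m d e : nat).

Lemma homog_eval n d (f : {mpoly k[n]}) (c : k) (x : 'rV[k]_n) :
  f \is d.-homog -> f.@[(c *: x) 0] = c ^+ d * f.@[x 0].
Proof.
move/dhomogP => hf; rewrite !mevalE mulr_sumr; rewrite [LHS]big_seq [RHS]big_seq.
apply: eq_bigr => m /hf <-; rewrite mulrCA; congr (_ * _) => /=.
rewrite mdegE -prodrXr -big_split /=; apply: eq_bigr => i _.
by rewrite mxE exprMn.
Qed.

(** For fixed [x] the value at [c *: x] is a polynomial in [c] whose coefficients are the values of
    the homogeneous components, so only the component of degree [d] survives. *)
Lemma homog_of_eval n d (f : {mpoly k[n]}) :
  (forall c (x : 'rV[k]_n), f.@[(c *: x) 0] = c ^+ d * f.@[x 0]) -> f \is d.-homog.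
Proof.
move=> h; pose mf : measure n := @mdeg n.
have hp := @pihomog_partitionE n _ mf _ f (leqnn _).
set K := mmeasure mf f in hp.
have e0 e : (e < K)%N -> e != d -> pihomog mf e f = 0.
  move=> eK ed; apply: mpoly_ext => x; rewrite meval0.
  have : \poly_(i < K) (pihomog mf i f).@[x 0] = f.@[x 0] *: 'X^d.
    apply: poly_ext => c; rewrite horner_poly !hornerE mulrC -h [in RHS]hp raddf_sum /=.
    apply: eq_bigr => i _; rewrite (homog_eval _ _ (pihomogP mf _ _)); exact: mulrC.
  by move/(congr1 (fun p : {poly k} => p`_e)); rewrite coef_poly eK coefZ coefXn (negPf ed) mulr0.
rewrite hp; apply: rpred_sum => i _.
have [<-|ne] := eqVneq (i : nat) d; first exact: pihomogP.
by rewrite e0 ?rpred0.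
Qed.

Definition dot n (x y : 'rV[k]_n) : k := (x *m y^T) 0 0.

Lemma dotE n (x y : 'rV[k]_n) : dot x y = \sum_i x 0 i * y 0 i.
Proof. by rewrite /dot mxE; apply: eq_bigr => i _; rewrite mxE. Qed.

Lemma dot_eq0 n (x y : 'rV[k]_n) : x *m y^T = 0 <-> dot x y = 0.
Proof.
split=> [h|h]; first by rewrite /dot h mxE.
by apply/matrixP => i j; rewrite !ord1 [RHS]mxE.
Qed.

Lemma dotC n (x y : 'rV[k]_n) : dot x y = dot y x.
Proof. by rewrite !dotE; apply: eq_bigr => i _; rewrite mulrC. Qed.

Lemma dotDr n (x y z : 'rV[k]_n) : dot x (y + z) = dot x y + dot x z.
Proof. by rewrite /dot linearD mulmxDr mxE. Qed.

Lemma dotZr n c (x y : 'rV[k]_n) : dot x (c *: y) = c * dot x y.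
Proof. by rewrite /dot linearZ -scalemxAr mxE. Qed.

Lemma dotZl n c (x y : 'rV[k]_n) : dot (c *: y) x = c * dot y x.
Proof. by rewrite !(dotC _ x) dotZr. Qed.

Lemma dotr0 n (x : 'rV[k]_n) : dot x 0 = 0.
Proof. by rewrite /dot trmx0 mulmx0 mxE. Qed.

Lemma dot_mulmx n m (x : 'rV[k]_n) (y : 'rV[k]_m) (H : 'M_(n, m)) :
  dot (x *m H) y = dot x (y *m H^T).
Proof. by rewrite /dot trmx_mul trmxK mulmxA. Qed.

Lemma dot_ext n (x y : 'rV[k]_n) : (forall z, dot x z = dot y z) -> x = y.
Proof.
move=> h; apply/rowP => i; have := h (delta_mx 0 i); rewrite !dotE.
rewrite (bigD1 i) //= big1 ?addr0 => [|j ji]; last first.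
  by rewrite mxE (negPf ji) andbF mulr0.
rewrite (bigD1 i) //= big1 ?addr0 => [|j ji]; last first.
  by rewrite mxE (negPf ji) andbF mulr0.
by rewrite mxE !eqxx !mulr1.
Qed.

Lemma gradient_curve n (f : {mpoly k[n]}) (c : 'I_n -> {poly k}) t :
  dot (gradient f (\row_i (c i).[t])) (\row_i (c i)^`().[t]) = (curve_eval c f)^`().[t].
Proof.
rewrite curve_eval_deriv horner_sum dotE; apply: eq_bigr => i _.
rewrite hornerM curve_evalE !mxE; congr (_ * _).
by apply: meval_eq => j; rewrite mxE.
Qed.

(** Directional derivatives are read off from a one-variable polynomial [p], given by whatever
    closed formula the values on the line admit. *)
Lemma gradient_line n (f : {mpoly k[n]}) (x d : 'rV[k]_n) (p : {poly k}) :
  (forall t, f.@[(x + t *: d) 0] = p.[t]) -> dot (gradient f x) d = p^`().[0].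
Proof.
move=> h; pose c i := (x 0 i)%:P + d 0 i *: 'X.
have -> : p = curve_eval c f.
  apply: poly_ext => t; rewrite -h curve_evalE; apply: meval_eq => i.
  by rewrite !mxE !hornerE mulrC.
rewrite -gradient_curve; congr dot; last first.
  by apply/rowP => i; rewrite mxE /c derivD derivC derivZ derivX !hornerE.
congr gradient; apply/rowP => i.
by rewrite mxE /c !hornerE.
Qed.

Lemma gradient_const_along_curve n (f : {mpoly k[n]}) (c : 'I_n -> {poly k}) a t :
  (forall s, f.@[fun i => (c i).[s]] = a) ->
  dot (gradient f (\row_i (c i).[t])) (\row_i (c i)^`().[t]) = 0.
Proof.
move=> h; rewrite gradient_curve (_ : curve_eval c f = a%:P) ?derivC ?horner0 //.
by apply: poly_ext => s; rewrite curve_evalE h hornerC.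
Qed.

Definition subst n m (phi : 'I_m -> {mpoly k[n]}) (f : {mpoly k[m]}) : {mpoly k[n]} :=
  f \mPo [tuple phi i | i < m].

Lemma substE n m (phi : 'I_m -> {mpoly k[n]}) f v :
  (subst phi f).@[v] = f.@[fun i => (phi i).@[v]].
Proof.
by rewrite comp_mpoly_meval; apply: meval_eq => i; rewrite tnth_mktuple.
Qed.

Definition linear_form n (w : 'I_n -> k) : {mpoly k[n]} := \sum_j w j *: 'X_j.

Lemma linear_formE n (w : 'I_n -> k) v : (linear_form w).@[v] = \sum_j w j * v j.
Proof. by rewrite raddf_sum; apply: eq_bigr => j _ /=; rewrite mevalZ mevalXU. Qed.

Definition lsubst n m (H : 'M[k]_(n, m)) : {mpoly k[m]} -> {mpoly k[n]} :=
  subst (fun i => linear_form (fun j => H j i)).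

Lemma lsubstE n m (H : 'M[k]_(n, m)) f (x : 'rV[k]_n) :
  (lsubst H f).@[x 0] = f.@[(x *m H) 0].
Proof.
rewrite substE; apply: meval_eq => i; rewrite linear_formE mxE.
by apply: eq_bigr => j _; rewrite mulrC.
Qed.

Lemma lsubst_homog n m (H : 'M[k]_(n, m)) f d :
  f \is d.-homog -> lsubst H f \is d.-homog.
Proof.
move=> hf; apply: homog_of_eval => c x.
by rewrite !lsubstE -scalemxAl (homog_eval _ _ hf).
Qed.

Lemma gradient_lsubst n m (H : 'M[k]_(n, m)) f (x : 'rV[k]_n) :
  gradient (lsubst H f) x = gradient f (x *m H) *m H^T.
Proof.
apply: dot_ext => d; rewrite dot_mulmx trmxK.
pose c i := ((x *m H) 0 i)%:P + (d *m H) 0 i *: 'X.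
have hc t : f.@[(x *m H + t *: (d *m H)) 0] = (curve_eval c f).[t].
  rewrite curve_evalE; apply: meval_eq => i.
  by rewrite mxE [X in _ + X]mxE /c !hornerE mulrC.
rewrite (gradient_line hc) (@gradient_line _ _ _ _ (curve_eval c f)) // => t.
by rewrite lsubstE -hc mulmxDl -scalemxAl.
Qed.

End HomogeneousForms.

(** * Closed sets and linear changes of coordinates *)

Section ProjectiveSets.

Variable k : closedFieldType.
Implicit Types (n m d e : nat).

Lemma pset_ext n (V W : pset k n) : (forall x, V x <-> W x) -> V = W.
Proof.
by move=> h; apply: functional_extensionality => x; apply: propositional_extensionality.
Qed.

Lemma zclosureS n (V W : pset k n) : psub V W -> psub (zclosure V) (zclosure W).
Proof.
by move=> VW x [x0 hx]; split=> // e f hf fW; apply: (hx e f hf) => y /VW; apply: fW.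
Qed.

Lemma sub_zclosure n (V : pset k n) x : x != 0 -> V x -> zclosure V x.
Proof. by move=> x0 Vx; split=> // e f _; apply. Qed.

Lemma zclosure_vanish n (V : pset k n) e (f : {mpoly k[n]}) :
  f \is e.-homog -> vanishes_on f V -> vanishes_on f (zclosure V).
Proof. by move=> hf fV x [_ /(_ e f hf fV)]. Qed.

Lemma zclosedP n (V : pset k n) : zclosed V <-> zclosure V = V.
Proof.
by split=> [h|h x]; [apply: pset_ext => x; rewrite -h | rewrite h].
Qed.

Lemma zclosed_neq0 n (V : pset k n) x : zclosed V -> V x -> x != 0.
Proof. by move=> cV /cV []. Qed.

Lemma zclosed_forms n (I : Type) (F : I -> {mpoly k[n]}) (V : pset k n) :
  (forall i, exists e, F i \is e.-homog) ->
  (forall x, V x <-> x != 0 /\ forall i, (F i).@[x 0] = 0) -> zclosed V.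
Proof.
move=> hF hV x; split=> [Vx|[x0 hx]]; first by apply: sub_zclosure => //; case/hV: Vx.
apply/hV; split=> // i; have [e he] := hF i.
by apply: (hx e _ he) => y /hV [_].
Qed.

Lemma separating_form n (V : pset k n) x :
  zclosed V -> x != 0 -> ~ V x ->
  exists e (f : {mpoly k[n]}), [/\ f \is e.-homog, vanishes_on f V & f.@[x 0] != 0].
Proof.
move=> cV x0 nV; apply: NNPP => h; apply: nV; apply/cV; split=> // e f hf fV.
by apply/eqP/negPn/negP => fx; apply: h; exists e, f.
Qed.

Definition zero_locus n (f : {mpoly k[n]}) : pset k n := fun x => x != 0 /\ f.@[x 0] = 0.

Lemma zclosed_zero_locus n e (f : {mpoly k[n]}) : f \is e.-homog -> zclosed (zero_locus f).
Proof.
move=> hf; apply: (@zclosed_forms _ unit (fun=> f)) => [_|x]; first by exists e.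
by split=> [[? ?]|[? h]]; split=> //; apply: (h tt).
Qed.

Lemma irreducible_mul n (V : pset k n) e1 e2 (f g : {mpoly k[n]}) :
  (forall x, V x -> x != 0) -> zirreducible V ->
  f \is e1.-homog -> g \is e2.-homog -> vanishes_on (f * g) V ->
  vanishes_on f V \/ vanishes_on g V.
Proof.
move=> V0 [_ hV] hf hg fgV.
have [] := hV _ _ (zclosed_zero_locus hf) (zclosed_zero_locus hg).
- move=> x Vx; have /eqP := fgV x Vx; rewrite mevalM mulf_eq0.
  by case/orP => /eqP h; [left|right]; split=> //; apply: V0.
- by move=> h; left=> x /h [].
- by move=> h; right=> x /h [].
Qed.

Lemma irreducible_of_mul n (V : pset k n) :
  (exists x, V x) -> (forall x, V x -> x != 0) ->
  (forall e1 e2 (f g : {mpoly k[n]}), f \is e1.-homog -> g \is e2.-homog ->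
     vanishes_on (f * g) V -> vanishes_on f V \/ vanishes_on g V) ->
  zirreducible V.
Proof.
move=> exV V0 h; split=> // V1 V2 c1 c2 h12; apply: NNPP => /not_or_and [n1 n2].
have sep W : zclosed W -> ~ psub V W ->
    exists e f, [/\ f \is e.-homog, vanishes_on f W & ~ vanishes_on f V].
  move=> cW /not_all_ex_not [x /(imply_to_and (V x)) [Vx nW]].
  have [e [f [hf fW fx]]] := separating_form cW (V0 _ Vx) nW.
  by exists e, f; split=> // /(_ _ Vx) /eqP; rewrite (negPf fx).
have [e1 [f [hf f1 nf]]] := sep _ c1 n1.
have [e2 [g [hg g2 ng]]] := sep _ c2 n2.
have [] := h _ _ _ _ hf hg _ => // x Vx; rewrite mevalM.
by case: (h12 x Vx) => [/f1|/g2] ->; rewrite ?mul0r ?mulr0.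
Qed.

Lemma irreducible_param n m (V : pset k n) (phi : 'I_n -> {mpoly k[m]}) :
  (exists x, V x) ->
  (forall x, V x <-> x != 0 /\ exists v : 'I_m -> k, x = \row_i (phi i).@[v]) ->
  zirreducible V.
Proof.
move=> [x0 Vx0] hV; apply: irreducible_of_mul => [|x /hV []|e1 e2 f g hf hg fgV] //.
  by exists x0.
have [nz0 [v0 ex0]] := (hV x0).1 Vx0.
have [j xj] : exists j, x0 0 j != 0.
  by move/rV0Pn: nz0.
have phij : phi j != 0.
  by apply: contra xj => /eqP e; rewrite ex0 mxE e meval0.
(* The factor [phi j] disposes of the parameters sent to the zero vector, which is not a point of
   [V]. *)
have : phi j * (subst phi f * subst phi g) == 0.
  apply/eqP/mpoly_ext => v; rewrite !mevalM meval0 !substE.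
  have [->|nz] := eqVneq (phi j).@[v 0] 0; first by rewrite mul0r.
  pose x := \row_i (phi i).@[v 0].
  have : V x.
    apply/hV; split; last by exists (v 0).
    by apply: contra nz => /eqP e; have := congr1 (fun z : 'rV_n => z 0 j) e; rewrite !mxE => ->.
  have ev h : h.@[x 0] = h.@[fun i => (phi i).@[v 0]].
    by apply: meval_eq => i; rewrite mxE.
  by move/fgV; rewrite mevalM !ev => ->; rewrite mulr0.
rewrite !mulf_eq0 (negPf phij) /= => /orP[] /eqP e; [left|right] => x /hV [_ [v ->]].
  have := substE phi f v; rewrite e meval0 => ->.
  by apply: meval_eq => i; rewrite mxE.
have := substE phi g v; rewrite e meval0 => ->.
by apply: meval_eq => i; rewrite mxE.
Qed.

Definition row_space n m (A : 'M[k]_(m, n)) : pset k n := fun x => x != 0 /\ (x <= A)%MS.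

Lemma zclosed_row_space n m (A : 'M[k]_(m, n)) : zclosed (row_space A).
Proof.
pose F (j : 'I_n) := linear_form (fun i => cokermx A i j).
have hF j (x : 'rV_n) : (F j).@[x 0] = (x *m cokermx A) 0 j.
  by rewrite linear_formE mxE; apply: eq_bigr => i _; rewrite mulrC.
apply: (@zclosed_forms _ _ F) => [j|x].
  exists 1%N; apply: homog_of_eval => c x.
  by rewrite !hF -scalemxAl mxE expr1.
rewrite /row_space submxE; split=> [[x0 /eqP h]|[x0 h]]; split=> //.
  by move=> j; rewrite hF h mxE.
by apply/eqP/rowP => j; rewrite -hF h mxE.
Qed.

Lemma irreducible_row_space n m (A : 'M[k]_(m, n)) : A != 0 -> zirreducible (row_space A).
Proof.
move=> A0; apply: (irreducible_param (phi := fun i => linear_form (fun j => A j i))).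
  have [i hi] : exists i, row i A != 0.
    apply: NNPP => h; case/negP: A0; apply/eqP/row_matrixP => i; rewrite row0.
    by apply/eqP/negPn/negP => hi; apply: h; exists i.
  by exists (row i A); split=> //; apply: row_sub.
have e (v : 'rV_m) : v *m A = \row_i (linear_form (fun j => A j i)).@[v 0].
  apply/rowP => i; rewrite !mxE linear_formE.
  by apply: eq_bigr => j _; rewrite mulrC.
move=> x; split=> [[x0 /submxP [v hv]]|[x0 [v hv]]]; split=> //.
  by exists (v 0); rewrite -e.
suff -> : x = (\row_i v i) *m A by apply: submxMl.
rewrite hv e; apply/rowP => i; rewrite !mxE.
by apply: meval_eq => j; rewrite mxE.
Qed.

Section Pullback.

Variables (n : nat) (H : 'M[k]_n).
Hypothesis uH : H \in unitmx.

Definition pullback (V : pset k n) : pset k n := fun x => V (x *m H).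

Lemma mulmx_unit_neq0 (x : 'rV[k]_n) : (x *m H != 0) = (x != 0).
Proof. by rewrite -[X in _ == X](mul0mx _ H) (inj_eq (can_inj (mulmxK uH))). Qed.

Lemma lsubstK (f : {mpoly k[n]}) : lsubst H (lsubst (invmx H) f) = f.
Proof. by apply: mpoly_ext => x; rewrite !lsubstE mulmxK. Qed.

Lemma lsubstVK (f : {mpoly k[n]}) : lsubst (invmx H) (lsubst H f) = f.
Proof. by apply: mpoly_ext => x; rewrite !lsubstE mulmxKV. Qed.

Lemma vanishes_on_pullback f V :
  vanishes_on f (pullback V) <-> vanishes_on (lsubst (invmx H) f) V.
Proof.
split=> h x Vx; first by rewrite lsubstE; apply: h; rewrite /pullback mulmxKV.
by have := h _ Vx; rewrite lsubstE mulmxK.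
Qed.

Lemma zclosure_pullback V : zclosure (pullback V) = pullback (zclosure V).
Proof.
apply: pset_ext => x; rewrite /pullback /zclosure mulmx_unit_neq0.
split=> [[x0 hx]|[x0 hx]]; split=> // e f hf fV.
  rewrite -lsubstE; apply: (hx e); first exact: lsubst_homog.
  by apply/vanishes_on_pullback; rewrite lsubstVK.
have := hx e _ (lsubst_homog (invmx H) hf) ((vanishes_on_pullback _ _).1 fV).
by rewrite lsubstE mulmxK.
Qed.

Lemma zclosed_pullback V : zclosed V -> zclosed (pullback V).
Proof. by move/zclosedP => e; apply/zclosedP; rewrite zclosure_pullback e. Qed.

Lemma linear_subspace_pullback d V :
  linear_subspace d V -> linear_subspace d (pullback V).
Proof.
case=> A [rA hA]; exists (A *m invmx H); split=> [|x].
  by rewrite -row_leq_rank mxrankMfree ?row_leq_rank // row_free_unit unitmx_inv.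
rewrite /pullback hA mulmx_unit_neq0; split=> [][x0 h]; split=> //.
  by rewrite -[x](mulmxK uH) submxMr.
by rewrite -[A](mulmxKV uH) submxMr.
Qed.

Lemma tangent_space_pullback V x :
  tangent_space (pullback V) x = pullback (tangent_space V (x *m H)).
Proof.
have aux f (y : 'rV_n) : gradient (lsubst H f) x *m y^T = gradient f (x *m H) *m (y *m H)^T.
  by rewrite gradient_lsubst trmx_mul mulmxA.
apply: pset_ext => y; rewrite /pullback /tangent_space mulmx_unit_neq0.
split=> [][y0 hy]; split=> // e f hf fV.
  rewrite -aux; apply: (hy e); first exact: lsubst_homog.
  by apply/vanishes_on_pullback; rewrite lsubstVK.
have := hy e _ (lsubst_homog (invmx H) hf) ((vanishes_on_pullback _ _).1 fV).
by rewrite -aux lsubstK.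
Qed.

End Pullback.

Lemma pullbackK n (H : 'M[k]_n) V : H \in unitmx -> pullback (invmx H) (pullback H V) = V.
Proof. by move=> uH; apply: pset_ext => x; rewrite /pullback mulmxKV. Qed.

Section Pullback2.

Variables (n : nat) (H : 'M[k]_n).
Hypothesis uH : H \in unitmx.

Lemma irreducible_pullback V : zirreducible V -> zirreducible (pullback H V).
Proof.
have uH' : invmx H \in unitmx by rewrite unitmx_inv.
case=> [[x Vx] hV]; split=> [|V1 V2 c1 c2 h12].
  by exists (x *m invmx H); rewrite /pullback mulmxKV.
have [] := hV _ _ (zclosed_pullback uH' c1) (zclosed_pullback uH' c2).
- by move=> y Vy; apply: h12; rewrite /pullback mulmxKV.
- by move=> h; left=> y /h; rewrite /pullback mulmxK.
- by move=> h; right=> y /h; rewrite /pullback mulmxK.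
Qed.

Lemma has_chain_pullback V d : has_chain V d -> has_chain (pullback H V) d.
Proof.
case=> Z [h1 h2]; exists (fun i => pullback H (Z i)); split=> i hi.
  have [c ir s] := h1 i hi; split; last by move=> x /s.
    exact: zclosed_pullback.
  exact: irreducible_pullback.
have [s ns] := h2 i hi; split; first by move=> x /s.
by move=> s'; apply: ns => x Zx; have := s' (x *m invmx H); rewrite /pullback mulmxKV //; apply.
Qed.

End Pullback2.

Lemma has_dim_pullback n (H : 'M[k]_n) V d :
  H \in unitmx -> has_dim (pullback H V) d <-> has_dim V d.
Proof.
move=> uH; have uH' : invmx H \in unitmx by rewrite unitmx_inv.
have e e' : has_chain (pullback H V) e' <-> has_chain V e'.
  split; last exact: has_chain_pullback.
  by move/(has_chain_pullback uH'); rewrite pullbackK.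
by rewrite /has_dim !e.
Qed.

Lemma smooth_point_pullback n (H : 'M[k]_n) V x :
  H \in unitmx -> smooth_point (pullback H V) x <-> smooth_point V (x *m H).
Proof.
move=> uH; have uH' : invmx H \in unitmx by rewrite unitmx_inv.
rewrite /smooth_point tangent_space_pullback //.
split=> [][Vx [d [dV lV]]]; split=> //; exists d; split.
- exact/(has_dim_pullback V d uH).
- by rewrite -[tangent_space _ _](pullbackK _ uH); apply: linear_subspace_pullback.
- exact/(has_dim_pullback V d uH).
- exact: linear_subspace_pullback.
Qed.

(** Hyperplane coordinates transform by the inverse transpose, which preserves the pairing
    ([aux]). *)
Lemma dual_variety_pullback n (H : 'M[k]_n) V :
  H \in unitmx -> dual_variety (pullback H V) = pullback (invmx H)^T (dual_variety V).
Proof.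
move=> uH; have uH' : (invmx H)^T \in unitmx by rewrite unitmx_tr unitmx_inv.
rewrite /dual_variety -zclosure_pullback //; congr zclosure.
have aux (h y : 'rV_n) : h *m (invmx H)^T *m (y *m H)^T = h *m y^T.
  by rewrite trmx_mul !mulmxA -(mulmxA h) -trmx_mul mulmxV // trmx1 mulmx1.
apply: pset_ext => h; rewrite /pullback mulmx_unit_neq0 //.
split=> [][h0 [x [sx tx]]]; split=> //.
  exists (x *m H); split; first exact/smooth_point_pullback.
  move=> y ty; rewrite -[y](mulmxKV uH) aux; apply: tx.
  by rewrite tangent_space_pullback // /pullback mulmxKV.
exists (x *m invmx H); split; first by apply/smooth_point_pullback => //; rewrite mulmxKV.
move=> y; rewrite tangent_space_pullback // /pullback mulmxKV // => ty.
by rewrite -aux; apply: tx.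
Qed.

Lemma hypersurface_form_pullback n (K : 'M[k]_n) V f :
  K \in unitmx -> hypersurface_form (pullback K V) f <-> hypersurface_form V (lsubst (invmx K) f).
Proof.
have main (H : 'M[k]_n) W g : H \in unitmx -> hypersurface_form W g ->
    hypersurface_form (pullback H W) (lsubst H g).
  move=> uH [[d d0 hd] g0 hW hI]; split.
  - by exists d => //; apply: lsubst_homog.
  - apply: contra g0 => /eqP e; apply/eqP.
    by rewrite -[g](lsubstVK uH) e /lsubst /subst raddf0.
  - by move=> x; rewrite /pullback hW mulmx_unit_neq0 // lsubstE.
  - move=> e q hq /vanishes_on_pullback - /(_ uH) qV.
    have [h eh] := hI e _ (lsubst_homog _ hq) qV.
    by exists (lsubst H h); rewrite -[q](lsubstK uH) eh /lsubst /subst rmorphM.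
move=> uK; split=> [/main|/main -/(_ K uK)]; last by rewrite lsubstK.
by move/(_ (invmx K)); rewrite unitmx_inv pullbackK //; apply.
Qed.

(** The gradient is a covector: a change [K] of the variables acts on the target of the polar map by
    [K^T]. *)
Lemma polar_fibre_pullback n (K : 'M[k]_n) f z :
  K \in unitmx ->
  polar_fibre (lsubst K f) z = pullback K (polar_fibre f (z *m (invmx K)^T)).
Proof.
move=> uK; have uK' : (invmx K)^T \in unitmx by rewrite unitmx_tr unitmx_inv.
apply: pset_ext => x; rewrite /pullback /polar_fibre !mulmx_unit_neq0 //.
rewrite gradient_lsubst.
suff -> : (gradient f (x *m K) *m K^T == z)%MS =
          (gradient f (x *m K) == z *m (invmx K)^T)%MS by [].
have free : row_free (invmx K)^T by rewrite row_free_unit.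
rewrite -(submxMfree _ _ free) -(submxMfree (z) _ free) -mulmxA -trmx_mul mulVmx //.
by rewrite trmx1 mulmx1.
Qed.

Lemma general_point_pullback n (J : 'M[k]_n) V Q :
  J \in unitmx -> general_point V (fun z => Q (z *m invmx J)) -> general_point (pullback J V) Q.
Proof.
move=> uJ [C [cC nC hC]]; exists (pullback J C); split; first exact: zclosed_pullback.
  by move=> s; apply: nC => x Vx; have := s (x *m invmx J); rewrite /pullback mulmxKV //; apply.
by move=> z Vz nz; have := hC _ Vz nz; rewrite mulmxK.
Qed.

End ProjectiveSets.

(** * Chains of irreducible closed sets *)

Section DimensionBound.

Variable k : closedFieldType.
Implicit Types (n m d e : nat).

Definition zero_coord n (i : 'I_n) (x : 'rV[k]_n) : 'rV[k]_n :=
  \row_j if j == i then 0 else x 0 j.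

Lemma mpoly_split_var n (i : 'I_n) (f : {mpoly k[n]}) :
  exists g r : {mpoly k[n]}, f = 'X_i * g + r /\ forall x :
    'rV[k]_n, r.@[x 0] = r.@[(zero_coord i x) 0].
Proof.
elim/mpolyind: f => [|c m f _ _ [g [r [-> hr]]]].
  by exists 0, 0; rewrite mulr0 addr0; split=> // x; rewrite !meval0.
have [mi|mi] := posnP (m i).
  exists g, (c *: 'X_[m] + r); split; first by rewrite addrCA.
  move=> x; rewrite !mevalD hr !mevalZ !mevalX; congr (_ * _ + _).
  apply: eq_bigr => j _; rewrite mxE; case: eqP => [->|//].
  by rewrite mi !expr0.
exists (c *: 'X_[m - U_(i)] + g), r; split=> //.
rewrite mulrDr -scalerAr -mpolyXD addrA; congr (_ *: 'X_[_] + _ + _).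
by rewrite addmC submK // lep1mP -lt0n.
Qed.

Lemma mpoly_div_var n (i : 'I_n) (f : {mpoly k[n]}) :
  (forall x : 'rV[k]_n, x 0 i = 0 -> f.@[x 0] = 0) -> exists g, f = 'X_i * g.
Proof.
move=> h; have [g [r [ef hr]]] := mpoly_split_var i f.
exists g; rewrite {1}ef (_ : r = 0) ?addr0 //; apply: mpoly_ext => x.
rewrite meval0 hr; have := h (zero_coord i x); rewrite mxE eqxx => /(_ erefl).
by rewrite ef mevalD mevalM mevalXU mxE eqxx mul0r add0r.
Qed.

Lemma homog_div_var n (i : 'I_n) e (g : {mpoly k[n]}) :
  'X_i * g \is e.+1.-homog -> g \is e.-homog.
Proof.
move/dhomogP => h; apply/dhomogP => m mg.
have := h (U_(i) + m)%MM; rewrite !mcoeff_msupp mulrC mcoeffMX -mcoeff_msupp.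
by move=> /(_ mg) /=; rewrite mdegD mdeg1 => -[].
Qed.

Lemma exists_nth_root g (y : k) : (0 < g)%N -> exists x, x ^+ g == y.
Proof.
move=> g0; have /closed_rootP [x] : size ('X^g - y%:P : {poly k}) != 1%N.
  by rewrite size_XnsubC // eqSS -lt0n.
by rewrite /root !hornerE subr_eq0; exists x.
Qed.

(* Independent forms on the members of a chain: given forms [F] of equal degree
   that are independent on [Z d] and a form [G] cutting [Z d] out of [Z d.+1],
   a relation between [F] and [G] on [Z d.+1] restricts on [Z d] (where [G = 0])
   to a relation between the [F], so it is divisible by the last variable. *)
Lemma chain_independent_forms n (Z : nat -> pset k n) d :
  (forall i, (i <= d)%N -> zclosed (Z i) /\ zirreducible (Z i)) ->
  (forall i, (i < d)%N -> psub (Z i) (Z i.+1) /\ ~ psub (Z i.+1) (Z i)) ->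
  exists E (F : 'I_d.+1 -> {mpoly k[n]}),
    [/\ (0 < E)%N, forall i, F i \is E.-homog
      & forall e (H : {mpoly k[d.+1]}), H \is e.-homog ->
          vanishes_on (subst F H) (Z d) -> H = 0].
Proof.
elim: d => [|d IH] hZ hS.
  have [c0 [[x Zx] _]] := hZ 0%N (leqnn _).
  have /rV0Pn [j xj] := zclosed_neq0 c0 Zx.
  exists 1%N, (fun=> 'X_j); split=> // [_|e H hH hv].
    by rewrite dhomogX /= mdeg1.
  apply: mpoly_ext => y; have := hv x Zx; rewrite substE meval0.
  have -> : y = (y 0 0 / x 0 j) *: (\row_i x 0 j).
    by apply/rowP => i; rewrite !mxE ord1 divfK.
  rewrite (homog_eval _ _ hH); rewrite (meval_eq (v2 := (\row_(i < 1) x 0 j) 0)).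
    by move=> ->; rewrite mulr0.
  by move=> i; rewrite mevalXU mxE.
have [E [F [E0 hF indF]]] := IH (fun i hi => hZ i (leqW hi)) (fun i hi => hS i (leqW hi)).
have [c1 ir1] := hZ d (leqnSn d).
have [c2 ir2] := hZ d.+1 (leqnn _).
have [sub12 nsub] := hS d (leqnn _).
have [x /(imply_to_and (Z d.+1 x)) [Zx nZx]] := not_all_ex_not _ _ nsub.
have [g [G [hG Gv Gx]]] := separating_form c1 (zclosed_neq0 c2 Zx) nZx.
have g0 : (0 < g)%N.
  rewrite lt0n; apply/eqP => e; have [[y Zy] _] := ir1.
  have h t (z : 'rV[k]_n) : G.@[(t *: z) 0] = G.@[z 0] by rewrite (homog_eval _ _ hG) e expr0 mul1r.
  by have := h 0 x; rewrite scale0r -(scale0r y) h Gv // => /esym /eqP; rewrite (negPf Gx).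
(* The powers bring the old forms and the new one to the common degree [E * g]. *)
exists (E * g)%N, (fun i => if unlift ord_max i is Some j then F j ^+ g else G ^+ E).
split=> [|i|e H]; first by rewrite muln_gt0 E0.
  case: (unliftP ord_max i) => [j _|_]; last by rewrite mulnC dhomogMn.
  exact: dhomogMn.
set F' := fun i => _.
elim: e H => [|e IHe] H hH hv.
  apply: mpoly_ext => y; have hc (z : 'rV[k]_d.+2) : H.@[z 0] = H.@[(0 : 'rV_d.+2) 0].
    by rewrite -(scale0r z) (homog_eval _ _ hH) expr0 mul1r.
  have := hv x Zx; rewrite substE meval0 hc -(hc (\row_i (F' i).@[x 0])) => <-.
  by apply: meval_eq => i; rewrite mxE.
have [H1 eH] : exists H1, H = 'X_ord_max * H1.
  apply: mpoly_div_var => y y0.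
  (* On [Z d] the form [G] is zero, so the relation restricts to one between the powers [F j ^+ g],
     which is [subst phi H] evaluated at the forms [F]. *)
  pose phi (i : 'I_d.+2) : {mpoly k[d.+1]} :=
    if unlift ord_max i is Some j then 'X_j ^+ g else 0.
  have e0 : subst phi H = 0.
    apply: (indF (g * e.+1)%N).
      apply: homog_of_eval => c z; rewrite !substE.
      rewrite exprM -[in RHS](meval_eq (v1 := (\row_i (phi i).@[z 0]) 0)); last first.
        by move=> i; rewrite mxE.
      rewrite -(homog_eval _ _ hH); apply: meval_eq => i; rewrite !mxE /phi.
      case: (unlift _ i) => [j|]; last by rewrite !meval0 mulr0.
      by rewrite !rmorphXn /= !mevalXU mxE exprMn.
    move=> z Zz; have := hv z (sub12 _ Zz); rewrite !substE => hz; rewrite -[RHS]hz.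
    apply: meval_eq => i; rewrite /phi /F'; case: (unlift _ i) => [j|].
      by rewrite !rmorphXn /= mevalXU.
    by rewrite rmorphXn /= Gv // meval0 expr0n -(prednK E0).
  (* Every point with last coordinate zero is a value of [phi], since [k] has [g]-th roots. *)
  pose r (j : 'I_d.+1) := xchoose (exists_nth_root (y 0 (lift ord_max j)) g0).
  have := meval0 (n := d.+1) (R := k) r; rewrite -e0 substE => hr; rewrite -[RHS]hr.
  apply: meval_eq => i; rewrite /phi; case: unliftP => [j ->|->]; last by rewrite y0 meval0.
  rewrite rmorphXn /= mevalXU; apply/esym/eqP; exact: (xchooseP (exists_nth_root _ g0)).
rewrite eH; rewrite eH in hH; have hH1 := homog_div_var hH.
rewrite (IHe H1) ?mulr0 //.
have hs (K : {mpoly k[d.+2]}) q : K \is q.-homog -> subst F' K \is (E * g * q)%N.-homog.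
  move=> hK; apply: homog_of_eval => c z; rewrite !substE.
  rewrite exprM -[in RHS](meval_eq (v1 := (\row_i (F' i).@[z 0]) 0)); last first.
    by move=> i; rewrite mxE.
  rewrite -(homog_eval _ _ hK); apply: meval_eq => i; rewrite !mxE /F'.
  case: (unlift _ i) => [j|]; rewrite !rmorphXn /=.
    by rewrite (homog_eval _ _ (hF j)) exprMn exprM.
  by rewrite (homog_eval _ _ hG) exprMn -exprM mulnC exprM.
(* [G ^+ E] times the quotient vanishes on the irreducible [Z d.+1], where [G] does not; so the
   quotient is again a relation, of lower degree. *)
have [] := irreducible_mul (fun y => zclosed_neq0 c2) ir2 (dhomogMn E hG) (hs _ _ hH1) _.
- move=> y Zy; have := hv y Zy; rewrite eH /subst rmorphM /= comp_mpolyXU.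
  by rewrite -tnth_nth tnth_mktuple /F' unlift_none.
- by move=> /(_ x Zx) /eqP; rewrite rmorphXn expf_eq0 (negPf Gx) andbF.
- by [].
Qed.

(** An upper bound for the Hilbert function of [V]: the forms of degree [D] restricted to [V] span a
    space of dimension at most [h D]. *)
Definition hilbert_bound n (V : pset k n) (h : nat -> nat) : Prop :=
  forall D (I : finType) (G : I -> {mpoly k[n]}),
    (forall i, G i \is D.-homog) -> (h D < #|I|)%N ->
    exists c : I -> k, (exists i, c i != 0) /\ vanishes_on (\sum_i c i *: G i) V.

(** A chain of length 3 gives four independent forms of some degree [E]. Among their monomials of
    degree [3 * N], at least [N ^ 3] remain independent on [V], whereas the bound grows only like
    [N ^ 2]. *)
Lemma no_chain_of_hilbert_bound n (V : pset k n) B :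
  hilbert_bound V (fun D => D.+1 * (D * B).+1)%N -> ~ has_chain V 3.
Proof.
move=> hV [Z [hZ hS]].
have [] := @chain_independent_forms _ Z 3.
- by move=> i /hZ [].
- exact: hS.
(* The bound at degree [E * (3 * N)] is at most [4 * E * N] times [4 * E * N * B.+1], that is
   [N * N * (16 * E * E * B.+1)], which is less than [N ^ 3] for this [N]. *)
move=> E [F [E0 hF ind]]; pose N := (16 * E * E * B.+1).+1.
(* Three exponents range freely below [N]; the first one completes the degree to [3 * N]. *)
pose mon (i : 'I_N * 'I_N * 'I_N) : 'X_{1..4} :=
  [multinom nth 0%N [:: (3 * N - (i.1.1 + i.1.2 + i.2))%N; i.1.1 : nat; i.1.2 : nat; i.2 : nat] j
     | j < 4].
have mdeg_mon i : mdeg (mon i) = (3 * N)%N.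
  rewrite mdegE !big_ord_recl big_ord0 !mnmE /= addn0 addnA addnA -addnA -addnA (addnA i.1.1).
  rewrite subnK //; case: i => [[i1 i2] i3] /=.
  have -> : (3 * N = N + N + N)%N by rewrite !mulSn mul0n addn0 addnA.
  by rewrite !leq_add // ltnW.
have hmon i : ('X_[mon i] : {mpoly k[4]}) \is (3 * N).-homog.
  by rewrite dhomogX /= mdeg_mon.
have hsub e (H : {mpoly k[4]}) : H \is e.-homog -> subst F H \is (E * e).-homog.
  move=> hH; apply: homog_of_eval => c z; rewrite !substE.
  rewrite exprM -[in RHS](meval_eq (v1 := (\row_i (F i).@[z 0]) 0)); last first.
    by move=> i; rewrite mxE.
  rewrite -(homog_eval _ _ hH); apply: meval_eq => i; rewrite !mxE.
  by rewrite (homog_eval _ _ (hF i)).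
have [] := hV _ _ (fun i => subst F 'X_[mon i]) (fun i => hsub _ _ (hmon i)).
  rewrite !card_prod !card_ord.
  have h1 : ((E * (3 * N)).+1 <= 4 * E * N)%N.
    rewrite (_ : 4 * E * N = E * (3 * N) + E * N)%N; last by ring.
    by rewrite -addn1 leq_add2l muln_gt0 E0.
  have h2 : ((E * (3 * N) * B).+1 <= 4 * E * N * B.+1)%N.
    rewrite mulnS; apply: (@leq_trans (4 * E * N * B).+1); last first.
      by rewrite -addn1 addnC leq_add2r !muln_gt0 E0.
    by rewrite ltnS leq_mul2r (leq_trans _ h1) ?orbT.
  apply: (leq_ltn_trans (leq_mul h1 h2)).
  have -> : (4 * E * N * (4 * E * N * B.+1) = N * N * (16 * E * E * B.+1))%N.
    by move: (B.+1) => u; ring.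
  by rewrite ltn_pmul2l // muln_gt0.
move=> c [[i0 ci0] cv].
have hH : \sum_i c i *: 'X_[mon i] \is (3 * N).-homog by apply: rpred_sum => i _; exact/rpredZ/hmon.
have [_ _ s3] := hZ 3%N (leqnn _).
have h : \sum_i c i *: 'X_[mon i] = 0.
  apply: (ind _ _ hH) => x /s3 Vx; rewrite -[RHS](cv x Vx); congr meval.
  by rewrite /subst raddf_sum; apply: eq_bigr => i _; exact: comp_mpolyZ.
move/eqP: ci0; apply; have := congr1 (mcoeff (mon i0)) h.
rewrite mcoeff0 raddf_sum /= => <-.
rewrite (bigD1 i0) //= big1 => [|i ne].
  by rewrite addr0 mcoeffZ mcoeffX eqxx mulr1.
rewrite mcoeffZ mcoeffX; case: eqP => [e|_]; last by rewrite mulr0.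
case/eqP: ne; have g j : mon i j = mon i0 j by rewrite e.
have := (g (inord 1), g (inord 2), g (inord 3)); rewrite !mnmE !inordK //=.
case: i i0 {e g cv h} => [[i1 i2] i3] [[j1 j2] j3] /= [[e1 e2] e3].
by congr (_, _, _); apply: val_inj.
Qed.

Hypothesis char0 : [pchar k] =i pred0.

Lemma natr_inj (i j : nat) : i%:R = j%:R :> k -> i = j.
Proof.
have h := (pcharf0P k).1 char0.
wlog ij : i j / (i <= j)%N.
  by move=> H; case/orP: (leq_total i j) => hij e; [apply: H|apply/esym/H].
move=> e; apply/eqP; rewrite eqn_leq ij /= -subn_eq0 -h natrB // e subrr //.
Qed.

Lemma poly_eq0_of_nat_roots (p : {poly k}) N :
  (size p <= N.+1)%N -> (forall i : 'I_N.+1, p.[i%:R] = 0) -> p = 0.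
Proof.
move=> sp hp; pose s : seq k := [seq i%:R | i <- iota 0 N.+1].
apply: (@roots_geq_poly_eq0 _ p s).
- apply/allP => x /mapP [i]; rewrite mem_iota /= => iN ->.
  by apply/rootP; apply: (hp (Ordinal iN)).
- by rewrite map_inj_uniq ?iota_uniq // => i j; apply: natr_inj.
- by rewrite size_map size_iota.
Qed.

Lemma size_curve_eval n (c : 'I_n -> {poly k}) D B (f : {mpoly k[n]}) :
  f \is D.-homog -> (forall i, (size (c i) <= B.+1)%N) -> (size (curve_eval c f) <= (D * B).+1)%N.
Proof.
move/dhomogP => hf hc; rewrite /curve_eval /mmap big_seq.
apply: (leq_trans (size_sum _ _ _)); apply/bigmax_leqP_seq => m mf _.
rewrite mul_polyC (leq_trans (size_scale_leq _ _)) // /mmap1 -(hf m mf) /= mdegE.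
elim/big_ind2: _ => //= [|p1 n1 p2 n2 h1 h2|i _]; first by rewrite size_poly1.
  apply: (leq_trans (size_polyMleq _ _)); rewrite mulnDl.
  by rewrite -subn1 leq_subLR (leq_trans (leq_add h1 h2)) // addSn addnS add1n.
apply: (leq_trans (size_poly_exp_leq _ _)); rewrite ltnS mulnC leq_mul2l.
by rewrite -subn1 leq_subLR add1n hc orbT.
Qed.

(* A form restricted to [gam] is determined by its values on a finite grid. *)
Lemma hilbert_bound_of_curves n (V : pset k n) B (gam : k -> k -> 'I_n -> k)
    (ct cw : k -> 'I_n -> {poly k}) :
  (forall t w i, gam t w i = (ct w i).[t]) -> (forall t w i, gam t w i = (cw t i).[w]) ->
  (forall w i, (size (ct w i) <= B.+1)%N) -> (forall t i, (size (cw t i) <= 2)%N) ->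
  (forall e (f : {mpoly k[n]}), f \is e.-homog -> (forall t w, f.@[gam t w] = 0) ->
     vanishes_on f V) ->
  hilbert_bound V (fun D => D.+1 * (D * B).+1)%N.
Proof.
move=> het hew st sw hV D I G hG hI.
(* Along [gam] a form of degree [D] has degree at most [D] in [w] and [D * B] in [t], whence the
   size of the grid. With more forms than grid points, some combination vanishes on the grid. *)
pose J : finType := ('I_D.+1 * 'I_(D * B).+1)%type.
pose M : 'M[k]_(#|I|, #|J|) := \matrix_(i, j)
  let p : 'I_D.+1 * 'I_(D * B).+1 := enum_val j in (G (enum_val i)).@[gam p.2%:R p.1%:R].
have [i0 hi0] : exists i, row i (kermx M) != 0.
  apply: NNPP => h; have : kermx M == 0.
    apply/eqP/row_matrixP => i; rewrite row0.
    by apply/eqP/negPn/negP => hi; apply: h; exists i.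
  rewrite kermx_eq0 -row_leq_rank => hr.
  have := leq_trans hr (rank_leq_col M).
  by rewrite card_prod !card_ord leqNgt hI.
set v := row i0 (kermx M) in hi0.
have vM : v *m M = 0 by rewrite -row_mul mulmx_ker row0.
have [j0 hj0] := rV0Pn _ hi0.
exists (fun i => v 0 (enum_rank i)); split.
  by exists (enum_val j0); rewrite enum_valK.
set f := (\sum_i _).
have hf : f \is D.-homog by apply: rpred_sum => i _; exact/rpredZ/hG.
apply: (hV D) => // t w.
have grid (i : 'I_D.+1) (j : 'I_(D * B).+1) : f.@[gam j%:R i%:R] = 0.
  have := congr1 (fun z : 'rV_#|J| => z 0 (enum_rank (i, j))) vM; rewrite !mxE => e.
  rewrite -[RHS]e raddf_sum /= (reindex _ (onW_bij _ (@enum_val_bij I))) /=.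
  by apply: eq_bigr => l _; rewrite mevalZ !mxE enum_valK enum_rankK.
have col (i : 'I_D.+1) s : f.@[gam s i%:R] = 0.
  have e0 : curve_eval (ct i%:R) f = 0.
    apply: (poly_eq0_of_nat_roots (size_curve_eval hf (st _))) => j.
    by rewrite curve_evalE -(grid i j); apply: meval_eq => l; rewrite het.
  have := curve_evalE (ct i%:R) f s; rewrite e0 horner0 => h; rewrite [RHS]h.
  by apply: meval_eq => l; rewrite het.
have e0 : curve_eval (cw t) f = 0.
  apply: (@poly_eq0_of_nat_roots _ D).
    by rewrite -[D in D.+1]muln1; apply: size_curve_eval hf (sw _).
  by move=> i; rewrite curve_evalE -(col i t); apply: meval_eq => l; rewrite hew.
have := curve_evalE (cw t) f w; rewrite e0 horner0 => h; rewrite [RHS]h.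
by apply: meval_eq => l; rewrite hew.
Qed.

Lemma has_chain2_of_line n (V : pset k n) (A : 'M[k]_(2, n)) :
  zclosed V -> zirreducible V -> row_free A -> psub (row_space A) V ->
  ~ psub V (row_space A) -> has_chain V 2.
Proof.
move=> cV iV fA sA nsV.
have A0 i : row i A != 0.
  apply/negP => /eqP e; have := @row_free_inj k 1 2 n A fA (delta_mx 0 i) 0.
  rewrite -rowE e mul0mx => /(_ erefl) /rowP /(_ i) /eqP.
  by rewrite !mxE !eqxx oner_eq0.
have Anz : A != 0 by apply: contra (A0 0) => /eqP ->; rewrite row0.
have s01 : psub (row_space (row 0 A)) (row_space A).
  by move=> x [x0 xA]; split=> //; apply: submx_trans xA (row_sub _ _).
exists (fun i => match i with 0%N => row_space (row 0 A) | 1%N => row_space A | _ => V end).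
split=> [] [|[|[|i]]] // _; split=> //; do ?exact: zclosed_row_space;
  do ?exact: irreducible_row_space.
- by move=> x /s01 /sA.
- move=> h; have [_ /sub_rVP [c hc]] := h _ (conj (A0 1) (row_sub 1 A)).
  have := @row_free_inj k 1 2 n A fA (delta_mx 0 1) (c *: delta_mx 0 0).
  rewrite -scalemxAl -!rowE hc => /(_ erefl) /rowP /(_ 1) /eqP.
  by rewrite !mxE !eqxx /= mulr0 oner_eq0.
Qed.

End DimensionBound.

(** * Resultants of binary forms *)

Section Resultant.

Variables (a b : nat).

Definition shifts (R : nzRingType) m (p : {poly R}) : 'M[R]_(m, a + b) :=
  \matrix_(i, j) ('X^i * p)`_j.

(** Coefficients increase to the right and the shifts of [C] come first; with this order the product
    formula [res_prod_roots] has no sign. *)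
Definition sylvester (R : nzRingType) (A C : {poly R}) : 'M[R]_(a + b) :=
  col_mx (shifts a C) (shifts b A).

(* The resultant of [A] and [C] as forms of degrees [a] and [b]: the actual
   degrees of the polynomials may be smaller. *)
Definition res (R : comNzRingType) (A C : {poly R}) : R := \det (sylvester A C).

Lemma map_res (R S : comNzRingType) (f : {rmorphism R -> S}) A C :
  f (res A C) = res (map_poly f A) (map_poly f C).
Proof.
rewrite -det_map_mx; congr (\det _); rewrite /sylvester map_col_mx.
by congr col_mx; apply/matrixP => i j; rewrite !mxE -coef_map rmorphM /= map_polyXn.
Qed.

Variable k : fieldType.
Implicit Types (A C D : {poly k}).

Lemma res_scale c A C : res (c *: A) C = c ^+ b * res A C.
Proof.
rewrite /res; have -> : sylvester (c *: A) C = block_mx 1%:M 0 0 c%:M *m sylvester A C.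
  rewrite /sylvester mul_block_col mul1mx !mul0mx addr0 add0r mul_scalar_mx.
  by congr col_mx; apply/matrixP => i j; rewrite !mxE -scalerAr coefZ.
by rewrite det_mulmx det_ublock det1 det_scalar mul1r.
Qed.

Lemma res_scaler c A C : res A (c *: C) = c ^+ a * res A C.
Proof.
rewrite /res; have -> : sylvester A (c *: C) = block_mx c%:M 0 0 1%:M *m sylvester A C.
  rewrite /sylvester mul_block_col mul1mx !mul0mx addr0 add0r mul_scalar_mx.
  by congr col_mx; apply/matrixP => i j; rewrite !mxE -scalerAr coefZ.
by rewrite det_mulmx det_ublock det1 det_scalar mulr1.
Qed.

(** Row operations: [U] adds to each shift of [C] a combination of shifts of [A]. The bound says deg
    D <= b - a, so that [X^i D] with i < a has degree below [b], the number of shifts of [A]. *)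
Lemma res_addr A C D : (size D + a <= b.+1)%N -> res A (C + A * D) = res A C.
Proof.
move=> sD; pose U : 'M[k]_(a, b) := \matrix_(i, j) ('X^i * D)`_j.
rewrite /res; have -> : sylvester A (C + A * D) = block_mx 1%:M U 0 1%:M *m sylvester A C.
  rewrite /sylvester mul_block_col !mul1mx mul0mx add0r.
  congr col_mx; apply/matrixP => i j; rewrite !mxE mulrDr coefD; congr (_ + _).
  have eD : 'X^i * D = \sum_(l < b) ('X^i * D)`_l *: 'X^l.
    rewrite -poly_def; apply/polyP => m; rewrite coef_poly; case: ltnP => // bm.
    rewrite coefXnM; case: ltnP => // im; rewrite nth_default //.
    rewrite leq_subRL // (leq_trans _ bm) // -ltnS (leq_trans _ sD) //.
    by rewrite addnC ltn_add2l.
  rewrite mulrA [_ * A]mulrC -mulrA eD mulr_sumr coef_sum; apply: eq_bigr => l _.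
  by rewrite !mxE -scalerAr coefZ (mulrC A).
by rewrite det_mulmx det_ublock !det1 !mul1r.
Qed.

(** The column [v] is killed by all the shifts. It will be the vector of powers of a common root, or
    the last coordinate vector for a common root at infinity. *)
Lemma res_eq0_ker A C (v : 'I_(a + b) -> k) (j0 : 'I_(a + b)) : v j0 != 0 ->
  (forall i : 'I_a, \sum_(j < a + b) ('X^i * C)`_j * v j = 0) ->
  (forall i : 'I_b, \sum_(j < a + b) ('X^i * A)`_j * v j = 0) -> res A C = 0.
Proof.
move=> v0 hC hA; apply/eqP; rewrite /res -det_tr; apply/det0P.
exists (\row_j v j); first by apply/rV0Pn; exists j0; rewrite mxE.
have -> : \row_j v j = (\col_j v j)^T by apply/rowP => j; rewrite !mxE.
rewrite -trmx_mul; have -> : sylvester A C *m (\col_j v j) = 0; last by rewrite trmx0.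
rewrite mul_col_mx -col_mx0; congr col_mx; apply/colP => i; rewrite !mxE.
  by rewrite -[RHS](hC i); apply: eq_bigr => j _; rewrite !mxE.
by rewrite -[RHS](hA i); apply: eq_bigr => j _; rewrite !mxE.
Qed.

Lemma size_shift m d i (p : {poly k}) :
  (size p <= d.+1)%N -> (i < m)%N -> (size ('X^i * p)%R <= m + d)%N.
Proof.
move=> sp im; apply: (leq_trans (size_polyMleq _ _)); rewrite size_polyXn addSn /=.
by apply: (leq_trans (leq_add (leqnn i) sp)); rewrite addnS -addSn leq_add2r.
Qed.

Lemma res_common_root A C t : (0 < a + b)%N ->
  (size A <= a.+1)%N -> (size C <= b.+1)%N -> A.[t] = 0 -> C.[t] = 0 -> res A C = 0.
Proof.
move=> ab sA sC At Ct; pose j0 := Ordinal ab.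
apply: (res_eq0_ker (v := fun j => t ^+ j) (j0 := j0)) => [|i|i].
- by rewrite expr0 oner_eq0.
- by rewrite -horner_coef_wide ?hornerM ?Ct ?mulr0 // size_shift.
- by rewrite -horner_coef_wide ?hornerM ?At ?mulr0 // addnC size_shift.
Qed.

Lemma res_common_infinity A C : (0 < a + b)%N ->
  (size A <= a.+1)%N -> (size C <= b.+1)%N -> A`_a = 0 -> C`_b = 0 -> res A C = 0.
Proof.
move=> ab sA sC Aa Cb; have lt : ((a + b).-1 < a + b)%N by rewrite prednK.
have szP m (p : {poly k}) : (size p <= m.+1)%N -> p`_m = 0 -> (size p <= m)%N.
  by move=> s pm; apply/leq_sizeP => j; rewrite leq_eqVlt => /orP[/eqP <- //|]; apply/leq_sizeP.
pose j0 := Ordinal lt.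
have s0 (p : {poly k}) m d (i : 'I_m) : (a + b = m + d)%N -> (size p <= d)%N ->
    \sum_(j < a + b) ('X^i * p)`_j * (j == j0)%:R = 0.
  move=> e sp; rewrite (bigD1 j0) //= big1 => [|j /negPf ->]; last by rewrite mulr0.
  rewrite addr0 eqxx mulr1 nth_default //.
  apply: (leq_trans (size_polyMleq _ _)); rewrite size_polyXn addSn /=.
  by rewrite -ltnS prednK // e -addSn leq_add.
apply: (res_eq0_ker (v := fun j => (j == j0)%:R) (j0 := j0)) => [|i|i].
- by rewrite eqxx oner_eq0.
- by apply: (s0 _ _ b) => //; apply: szP.
- by apply: (s0 _ _ a); rewrite 1?addnC //; apply: szP.
Qed.

(** Multiply the Sylvester matrix by [T], whose first [a] columns evaluate at the roots. The rows of
    [A] vanish there, those of [C] become a Vandermonde matrix times the values [C.[r]], and the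
    remaining block of [A] is triangular with diagonal [l]. The determinant of [T] is the same
    Vandermonde determinant, which cancels. *)
Lemma res_prod_roots l (rs : seq k) C :
  size rs = a -> uniq rs -> (size C <= b.+1)%N ->
  res (l *: \prod_(r <- rs) ('X - r%:P)) C = l ^+ b * \prod_(r <- rs) C.[r].
Proof.
move=> srs urs sC; set A := _ *: _.
pose r j : k := rs`_j.
have sP : size (\prod_(r <- rs) ('X - r%:P)) = a.+1 by rewrite size_prod_XsubC srs.
have sA : (size A <= a.+1)%N by rewrite (leq_trans (size_scale_leq _ _)) // sP.
have Ar (j : 'I_a) : A.[r j] = 0.
  rewrite hornerZ (rootP _) ?mulr0 // root_prod_XsubC mem_nth ?srs //.
pose V m n : 'M[k]_(m, a) := \matrix_(i, j) r j ^+ (n + i).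
pose T := block_mx (V a 0%N) 0 (V b a) (1%:M : 'M[k]_b).
pose E := \matrix_(i < a + b, j < b) (i == rshift a j)%:R : 'M[k]_(a + b, b).
have eT : T = row_mx (\matrix_(i < a + b, j < a) r j ^+ i) E.
  rewrite /T block_mxEh; congr row_mx; apply/matrixP => i j; rewrite !mxE.
    by case: splitP => q e; rewrite mxE e ?add0n.
  rewrite -(inj_eq val_inj); case: splitP => q e; rewrite mxE /= e ?eqn_add2l //.
  by rewrite ltn_eqF // (leq_trans (ltn_ord q)) ?leq_addr.
have SE m (p : {poly k}) : shifts m p *m E = rsubmx (shifts m p).
  apply/matrixP => i j; rewrite !mxE (bigD1 (rshift a j)) //= big1 => [|q /negPf ne].
    by rewrite !mxE eqxx mulr1 addr0.
  by rewrite [E _ _]mxE ne mulr0.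
have ST : sylvester A C *m T =
   block_mx (V a 0%N *m diag_mx (\row_j C.[r j])) (rsubmx (shifts a C)) 0 (rsubmx (shifts b A)).
  rewrite eT /sylvester mul_col_row block_mxEv !SE; congr col_mx; congr row_mx.
    apply/matrixP => i j; rewrite mul_mx_diag !mxE add0n -hornerXn -hornerM.
    rewrite (@horner_coef_wide _ (a + b)); last exact: size_shift.
    by apply: eq_bigr => q _; rewrite !mxE.
  apply/matrixP => i j; transitivity ('X^i * A).[r j]; last by rewrite hornerM Ar mulr0 mxE.
  rewrite (@horner_coef_wide _ (a + b)) ?mxE; last first.
    by rewrite (leq_trans (size_shift sA (ltn_ord i))) // addnC.
  by apply: eq_bigr => q _; rewrite !mxE.
have dV : \det (V a 0%N) != 0.
  have -> : V a 0%N = Vandermonde a (\row_j r j) by apply/matrixP => i j; rewrite !mxE.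
  rewrite det_Vandermonde; apply/prodf_neq0 => i _; apply/prodf_neq0 => j ij.
  by rewrite !mxE subr_eq0 nth_uniq ?srs // gtn_eqF.
have := congr1 determinant ST; rewrite det_mulmx det_lblock det_ublock det1 mulr1 det_mulmx.
rewrite det_diag -/(res A C) mulrC -mulrA => /(mulfI dV) ->; rewrite mulrC; congr (_ * _).
  have trig : is_trig_mx (rsubmx (shifts b A)).
    apply/is_trig_mxP => i j ij; rewrite !mxE coefXnM ltnNge (leq_trans (ltnW ij)) ?leq_addl //=.
    by rewrite nth_default // (leq_trans sA) // ltn_subRL addnC ltn_add2l.
  rewrite (det_trig trig) -[b in RHS]card_ord -prodr_const; apply: eq_bigr => i _.
  rewrite !mxE coefXnM ltnNge leq_addl /= addnK coefZ.
  have := monicP (monic_prod_XsubC rs xpredT id); rewrite lead_coefE sP /= => ->.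
  by rewrite mulr1.
rewrite (big_nth 0) srs big_mkord; apply: eq_bigr => i _; by rewrite mxE.
Qed.

(** A left kernel vector is a relation [v1 * C + v2 * A = 0] with deg v2 < b, and by coprimality
    [C], of exact degree [b], divides [v2]. The degree of [A] may drop, as it does for the member
    beta of the pencil. *)
Lemma res_neq0 A C : (size A <= a.+1)%N -> size C = b.+1 -> A != 0 -> coprimep A C ->
  res A C != 0.
Proof.
move=> sA sC A0 cAC; apply/det0P => -[v v0 hv].
pose v1 := rVpoly (lsubmx v); pose v2 := rVpoly (rsubmx v).
have ev m (w : 'rV[k]_m) p j : (w *m shifts m p) 0 j = (rVpoly w * p)`_j.
  rewrite mxE /rVpoly poly_def mulr_suml coef_sum; apply: eq_bigr => i _.
  by rewrite valK -scalerAl coefZ mxE.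
have s1 : (size v1 <= a)%N by exact: size_poly.
have s2 : (size v2 <= b)%N by exact: size_poly.
have e0 : v1 * C + v2 * A = 0.
  apply/polyP => j; rewrite coef0; have [ja|ja] := ltnP j (a + b).
    have := congr1 (fun w : 'rV_(a + b) => w 0 (Ordinal ja)) hv.
    by rewrite -{1}[v]hsubmxK mul_row_col mxE !ev [RHS]mxE coefD.
  rewrite coefD !nth_default ?addr0 //; apply: leq_trans ja;
    apply: (leq_trans (size_polyMleq _ _)).
    rewrite addnC -subn1 leq_subLR (leq_trans (leq_add sA s2)) //.
  by rewrite sC addnS /= leq_add2r.
have : C %| v2.
  rewrite -(Gauss_dvdpl _ (_ : coprimep C A)) 1?coprimep_sym //.
  by rewrite -(dvdp_addr _ (dvdp_mulIr v1 C)) e0 dvdp0.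
have [v20 _|nz /(dvdp_leq nz)] := eqVneq v2 0; last by rewrite sC ltnNge s2.
have C0 : C != 0 by rewrite -size_poly_eq0 sC.
have v10 : v1 = 0.
  by move/eqP: e0; rewrite v20 mul0r addr0 mulf_eq0 (negPf C0) orbF => /eqP.
case/negP: v0; rewrite -[v]hsubmxK -[lsubmx v]rVpolyK -[rsubmx v]rVpolyK.
by rewrite -/v1 -/v2 v10 v20 !linear0 row_mx0.
Qed.

End Resultant.

(** * The scroll in adapted coordinates *)

Section Coordinates.

Variables (k : closedFieldType) (b : nat).
Implicit Types (x y : 'rV[k]_b.+3) (C E : {poly k}).

Definition i0 : 'I_b.+3 := ord0.
Definition i1 : 'I_b.+3 := @Ordinal b.+3 1 isT.

(* A triple of two scalars and a polynomial of degree at most [b], as a vector;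
   the constant coefficient comes last, so that [muni] singles it out. *)
Definition mk (h0 h1 : k) (C : {poly k}) : 'rV[k]_b.+3 :=
  \row_i if (i : nat) == 0%N then h0 else if (i : nat) == 1%N then h1 else C`_(b.+2 - i).

Definition pC (y : 'rV[k]_b.+3) : {poly k} := \poly_(i < b.+1) y 0 (inord (b.+2 - i)).

Lemma mk_i0 h0 h1 C : mk h0 h1 C 0 i0 = h0.
Proof. by rewrite mxE. Qed.

Lemma mk_i1 h0 h1 C : mk h0 h1 C 0 i1 = h1.
Proof. by rewrite mxE. Qed.

Lemma size_pC y : (size (pC y) <= b.+1)%N.
Proof. exact: size_poly. Qed.

Lemma coef_pC y i : (i <= b)%N -> (pC y)`_i = y 0 (inord (b.+2 - i)).
Proof. by move=> ib; rewrite coef_poly ltnS ib. Qed.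

Lemma pC_mk h0 h1 (C : {poly k}) : (size C <= b.+1)%N -> pC (mk h0 h1 C) = C.
Proof.
move=> sC; apply/polyP => i; have [ib|ib] := leqP i b; last first.
  rewrite nth_default; last exact: leq_trans (size_pC _) ib.
  by rewrite nth_default // (leq_trans sC ib).
rewrite coef_pC // mxE inordK ?ltnS ?leq_subr //.
by rewrite subSn ?leqW // subSn //= !subSS subKn.
Qed.

Lemma mk_eta y : mk (y 0 i0) (y 0 i1) (pC y) = y.
Proof.
apply/rowP => i; rewrite mxE; case: eqP => [e|n0].
  by congr (y 0 _); apply: val_inj.
case: eqP => [e|n1]; first by congr (y 0 _); apply: val_inj.
have i2 : (1 < i)%N by case: (i : nat) n0 n1 => [|[|]].
have ib : (b.+2 - i <= b)%N by rewrite leq_subLR; apply: (leq_add i2 (leqnn b)).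
rewrite coef_pC // subKn; last by rewrite -ltnS.
by congr (y 0 _); apply: val_inj; rewrite /= inordK.
Qed.

Lemma mkD h0 h1 C h0' h1' C' : mk h0 h1 C + mk h0' h1' C' = mk (h0 + h0') (h1 + h1') (C + C').
Proof. by apply/rowP => i; rewrite !mxE; case: (_ == 0%N) => //; case: (_ == 1%N) => //;
  rewrite coefD. Qed.

Lemma mkZ c h0 h1 C : c *: mk h0 h1 C = mk (c * h0) (c * h1) (c *: C).
Proof. by apply/rowP => i; rewrite !mxE; case: (_ == 0%N) => //; case: (_ == 1%N) => //;
  rewrite coefZ. Qed.

Lemma mk0 : mk 0 0 0 = 0.
Proof. by apply/rowP => i; rewrite !mxE coef0; case: (_ == 0%N) => //; case: (_ == 1%N). Qed.

Lemma pCD x y : pC (x + y) = pC x + pC y.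
Proof. by apply/polyP => i; rewrite coefD !coef_poly mxE; case: ltnP; rewrite ?addr0. Qed.

Lemma pCZ c x : pC (c *: x) = c *: pC x.
Proof. by apply/polyP => i; rewrite coefZ !coef_poly mxE; case: ltnP; rewrite ?mulr0. Qed.

Lemma dot_mk h0 h1 C p q E :
  dot (mk h0 h1 C) (mk p q E) = h0 * p + h1 * q + \sum_(i < b.+1) C`_i * E`_i.
Proof.
rewrite dotE 2!big_ord_recl !mxE /= addrA; congr (_ + _).
rewrite (reindex_inj rev_ord_inj); apply: eq_bigr => i _.
rewrite !mxE /= /bump /= !add1n !subSS.
by rewrite subKn // -ltnS.
Qed.

Lemma dot_coef C y : dot (mk 0 0 C) y = \sum_(i < b.+1) C`_i * (pC y)`_i.
Proof. by rewrite -{1}(mk_eta y) dot_mk !mul0r !add0r. Qed.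

Lemma dot_coefXn i y : (i <= b)%N -> dot (mk 0 0 'X^i) y = (pC y)`_i.
Proof.
move=> ib; rewrite dot_coef; have ib' : (i < b.+1)%N by [].
rewrite (bigD1 (Ordinal ib')) //= big1 ?addr0 => [|j ne].
  by rewrite coefXn eqxx mul1r.
rewrite coefXn; case: eqP => [e|_]; last exact: mul0r.
by case/eqP: ne; apply: val_inj.
Qed.

Lemma eq_pC x y : (forall i, (i <= b)%N -> (pC x)`_i = (pC y)`_i) -> pC x = pC y.
Proof.
move=> h; apply/polyP => i; have [/h //|ib] := leqP i b.
by rewrite (nth_default _ (leq_trans (size_pC x) ib)) (nth_default _ (leq_trans (size_pC y) ib)).
Qed.

Lemma eq_mk x y : x 0 i0 = y 0 i0 -> x 0 i1 = y 0 i1 -> pC x = pC y -> x = y.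
Proof. by move=> e0 e1 eC; rewrite -(mk_eta x) -(mk_eta y) e0 e1 eC. Qed.

End Coordinates.

Arguments i0 {b}.
Arguments i1 {b}.

Section HomogeneousEvaluation.

Variable k : closedFieldType.
Implicit Types (p q : {poly k}).

Definition hev d (p : {poly k}) (s t : k) : k := \sum_(i < d.+1) p`_i * s ^+ (d - i) * t ^+ i.

Lemma hev1 d p t : (size p <= d.+1)%N -> hev d p 1 t = p.[t].
Proof.
move=> sp; rewrite (horner_coef_wide _ sp); apply: eq_bigr => i _.
by rewrite expr1n mulr1.
Qed.

Lemma hev_scale d p s t : s != 0 -> (size p <= d.+1)%N -> hev d p s t = s ^+ d * p.[t / s].
Proof.
move=> s0 sp; rewrite (horner_coef_wide _ sp) mulr_sumr; apply: eq_bigr => i _.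
have id : (i <= d)%N by rewrite -ltnS.
rewrite exprMn exprVn (_ : s ^+ d = s ^+ (d - i) * s ^+ i); last by rewrite -exprD subnK.
have si : s ^+ i != 0 by rewrite expf_neq0.
by field.
Qed.

Lemma hev_0 d p t : hev d p 0 t = p`_d * t ^+ d.
Proof.
rewrite /hev big_ord_recr /= subnn expr0 mulr1 big1 ?add0r // => i _.
by rewrite expr0n subn_eq0 leqNgt ltn_ord mulr0 mul0r.
Qed.

Lemma hev_comb d c c' p q s t : hev d (c *: p + c' *: q) s t = c * hev d p s t + c' * hev d q s t.
Proof.
rewrite /hev !mulr_sumr -big_split; apply: eq_bigr => i _.
by rewrite coefD !coefZ /=; ring.
Qed.

End HomogeneousEvaluation.

(** * The standard scroll of a pencil of binary forms *)

Section StandardScroll.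

Variables (k : closedFieldType) (a b : nat).
Variables (alpha beta : {poly k}).
Hypotheses (a_gt0 : (0 < a)%N) (lt_ab : (a < b)%N).
Hypotheses (malpha : alpha \is monic) (salpha : size alpha = a.+1).
Hypotheses (sbeta : (size beta <= a)%N) (cop : coprimep alpha beta).

Implicit Types (x y z : 'rV[k]_b.+3).

Local Notation mk := (@mk k b).

Let b_gt0 : (0 < b)%N. Proof. exact: ltn_trans lt_ab. Qed.

Let sbeta' : (size beta <= a.+1)%N. Proof. exact: leqW. Qed.

Lemma no_common_root t : alpha.[t] = 0 -> beta.[t] = 0 -> False.
Proof. by move=> /rootP ra /rootP; apply/negP; apply: coprimep_root cop ra. Qed.

Lemma proportional (x y c d : k) : (c != 0) || (d != 0) -> x * d = y * c ->
  exists u, x = u * c /\ y = u * d.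
Proof.
case: (eqVneq c 0) => [->|c0] /=.
  move=> d0; rewrite mulr0 => /eqP; rewrite mulf_eq0 (negPf d0) orbF => /eqP ->.
  by exists (y / d); rewrite mulr0 divfK.
by move=> _ e; exists (x / c); rewrite divfK // mulrAC e mulfK.
Qed.

(* [alpha] and [beta] are the restrictions to E of the two coordinates that
   survive the projection of the span of E. *)
Definition pt (s t u v : k) : 'rV[k]_b.+3 :=
  mk (u * hev a alpha s t) (u * hev a beta s t) (\poly_(i < b.+1) (v * s ^+ (b - i) * t ^+ i)).

Definition std_scroll : pset k b.+3 := fun z =>
  z != 0 /\ exists s t u v : k, (s, t) != (0, 0) /\ z = pt s t u v.

Lemma pt_i0 s t u v : pt s t u v 0 i0 = u * hev a alpha s t.
Proof. exact: mk_i0. Qed.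

Lemma pt_i1 s t u v : pt s t u v 0 i1 = u * hev a beta s t.
Proof. exact: mk_i1. Qed.

Lemma pC_pt s t u v i : (i <= b)%N -> (pC (pt s t u v))`_i = v * s ^+ (b - i) * t ^+ i.
Proof. by move=> ib; rewrite pC_mk ?size_poly // coef_poly ltnS ib. Qed.

Lemma pt_add s t u v u' v' e : pt s t u v + e *: pt s t u' v' = pt s t (u + e * u') (v + e * v').
Proof.
rewrite /pt mkZ mkD; congr mk; try ring.
by apply/polyP => i; rewrite coefD coefZ !coef_poly; case: ltnP => _; ring.
Qed.

Definition pA (y : 'rV[k]_b.+3) : {poly k} := y 0 i0 *: alpha + y 0 i1 *: beta.

Lemma size_pA y : (size (pA y) <= a.+1)%N.
Proof.
rewrite (leq_trans (size_polyD _ _)) // geq_max !(leq_trans (size_scale_leq _ _)) //.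
by rewrite salpha.
Qed.

Lemma coef_pA_a y : (pA y)`_a = y 0 i0.
Proof.
rewrite coefD !coefZ [beta`_a]nth_default // mulr0 addr0.
by have := monicP malpha; rewrite lead_coefE salpha /= => ->; rewrite mulr1.
Qed.

Lemma dot_pt (y : 'rV[k]_b.+3) s t u v :
  dot y (pt s t u v) = u * hev a (pA y) s t + v * hev b (pC y) s t.
Proof.
rewrite -{1}(mk_eta y) dot_mk hev_comb mulrDr; congr (_ + _).
  by ring.
rewrite /hev mulr_sumr; apply: eq_bigr => i _.
by rewrite coef_poly ltn_ord; ring.
Qed.

(** The pencil has no base point on the projective line: coprimality excludes finite ones, and
    [alpha] monic of degree [a] excludes [s = 0]. *)
Lemma hev_coprime s t : (s, t) != (0, 0) -> (hev a alpha s t != 0) || (hev a beta s t != 0).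
Proof.
have [->|s0] := eqVneq s 0 => st.
  rewrite hev_0 (_ : alpha`_a = 1) ?mul1r; last first.
    by have := monicP malpha; rewrite lead_coefE salpha.
  rewrite expf_neq0 //; apply: contra st => /eqP ->; exact: eqxx.
rewrite !hev_scale ?salpha // !mulf_eq0 !expf_eq0 (negPf s0) !andbF /=.
by rewrite -negb_and; apply/negP => /andP[/eqP h /eqP]; apply: no_common_root.
Qed.

Definition scroll_param : 'I_b.+3 -> {mpoly k[4]} := fun i =>
  let X j : {mpoly k[4]} := 'X_(inord j) in
  if (i : nat) == 0%N then X 2%N * \sum_(j < a.+1) alpha`_j *: (X 0%N ^+ (a - j) * X 1%N ^+ j)
  else if (i : nat) == 1%N then X 2%N * \sum_(j < a.+1) beta`_j *: (X 0%N ^+ (a - j) * X 1%N ^+ j)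
  else X 3%N * X 0%N ^+ (b - (b.+2 - i)) * X 1%N ^+ (b.+2 - i).

Lemma scroll_paramE (v : 'I_4 -> k) :
  \row_i (scroll_param i).@[v] = pt (v (inord 0)) (v (inord 1)) (v (inord 2)) (v (inord 3)).
Proof.
have hs (p : {poly k}) : (\sum_(j < a.+1) p`_j *:
  ('X_(inord 0) ^+ (a - j) * 'X_(inord 1) ^+ j)).@[v] =
    hev a p (v (inord 0)) (v (inord 1)).
  rewrite raddf_sum; apply: eq_bigr => j _ /=.
  by rewrite mevalZ rmorphM !rmorphXn /= !mevalXU mulrA.
apply/rowP => i; rewrite !mxE /scroll_param; case: eqP => [_|n0].
  by rewrite mevalM mevalXU hs.
case: eqP => [_|n1]; first by rewrite mevalM mevalXU hs.
rewrite coef_poly (_ : (b.+2 - i < b.+1)%N) ?mevalM ?rmorphXn /= ?mevalXU //.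
have i2 : (1 < i)%N by case: (i : nat) n0 n1 => [|[|]].
by rewrite ltnS leq_subLR; apply: (leq_add i2 (leqnn b)).
Qed.

Lemma pt_scroll_param s t u v : pt s t u v = \row_i (scroll_param i).@[fun j : 'I_4 =>
  nth 0 [:: s; t; u; v] j].
Proof. by rewrite scroll_paramE !inordK. Qed.

Lemma pt_neq0_v s t u v : (s, t) != (0, 0) -> v != 0 -> pt s t u v != 0.
Proof.
move=> st v0; apply/negP => /eqP e.
have h i : (i <= b)%N -> v * s ^+ (b - i) * t ^+ i = 0.
  by move=> ib; rewrite -(pC_pt s t u v ib) e -mk0 pC_mk ?coef0 ?size_poly0.
have /eqP := h 0%N isT; rewrite subn0 expr0 mulr1 mulf_eq0 (negPf v0) expf_eq0 b_gt0 /= => /eqP s0.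
have /eqP := h b (leqnn _);
  rewrite subnn expr0 mulr1 mulf_eq0 (negPf v0) expf_eq0 b_gt0 /= => /eqP t0.
by rewrite s0 t0 eqxx in st.
Qed.

Lemma pt00 u v : pt 0 0 u v = 0.
Proof.
rewrite /pt !hev_0 expr0n -[a == 0%N]negbK -lt0n a_gt0 !mulr0 -mk0; congr mk.
apply/polyP => i; rewrite coef_poly coef0; case: ltnP => // ib.
case: i ib => [|i] ib; rewrite ?expr0n ?mulr0 // subn0.
by rewrite -[b == 0%N]negbK -lt0n b_gt0 mulr0 mul0r.
Qed.

Lemma std_scroll_prm x : std_scroll x <-> x != 0 /\ exists v : 'I_4 ->
  k, x = \row_i (scroll_param i).@[v].
Proof.
split=> [[x0 [s [t [u [v [st e]]]]]]|[x0 [v e]]]; split=> //.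
  by eexists; rewrite e pt_scroll_param.
rewrite scroll_paramE in e; do 4!eexists; split; last exact: e.
apply: contra x0 => /eqP[s0 t0]; by rewrite e s0 t0 pt00.
Qed.

Lemma irreducible_std_scroll : zirreducible std_scroll.
Proof.
apply: irreducible_param std_scroll_prm.
have h : pt 1 0 0 1 != 0.
  by rewrite pt_neq0_v ?oner_eq0 // xpair_eqE negb_and oner_eq0.
exists (pt 1 0 0 1); split=> //; exists 1, 0, 0, 1; split=> //.
by rewrite xpair_eqE negb_and oner_eq0.
Qed.

(** The vector [pt s t u v] may be zero, hence outside the scroll, and [f] is an arbitrary
    polynomial; vanishing spreads from the dense set [s * v != 0]. *)
Lemma vanishes_on_pt (f : {mpoly k[b.+3]}) s t u v :
  vanishes_on f std_scroll -> f.@[(pt s t u v) 0] = 0.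
Proof.
move=> fV; rewrite pt_scroll_param.
set w := (fun j : 'I_4 => _).
rewrite (meval_eq (v2 := fun i => (scroll_param i).@[w])) => [|i]; last by rewrite mxE.
rewrite -substE (_ : subst scroll_param f = 0) ?meval0 //.
pose g : {mpoly k[4]} := 'X_(inord 0) * 'X_(inord 3).
apply: (@mpoly_generic _ _ _ g (const_mx 1)) => [|x].
  by rewrite mevalM !mevalXU !mxE mulr1 oner_eq0.
rewrite mevalM !mevalXU mulf_eq0 negb_or => /andP[x0 x3].
rewrite substE; have := fV (pt (x 0 (inord 0)) (x 0 (inord 1)) (x 0 (inord 2)) (x 0 (inord 3))).
rewrite -scroll_paramE => <-; first by apply: meval_eq => i; rewrite mxE.
have st : (x 0 (inord 0), x 0 (inord 1)) != (0, 0) by rewrite xpair_eqE negb_and x0.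
rewrite scroll_paramE; split; first exact: pt_neq0_v.
by do 4!eexists; split; last reflexivity.
Qed.


(* The quadrics [quadricA i j] (2 x 2 minors of the rational normal curve) and
   [quadricB i] cut out the scroll, also to first order away from E. *)
Definition quadricA (i j : nat) : {mpoly k[b.+3]} :=
  let c i := linear_form (fun l => mk 0 0 'X^i 0 l) in c i * c j.+1 - c i.+1 * c j.

Definition quadricB (i : nat) : {mpoly k[b.+3]} :=
  'X_i0 * linear_form (fun l => mk 0 0 (beta * 'X^i) 0 l) -
  'X_i1 * linear_form (fun l => mk 0 0 (alpha * 'X^i) 0 l).

Lemma linear_form_dot n (w x : 'rV[k]_n) : (linear_form (fun l => w 0 l)).@[x 0] = dot w x.
Proof. by rewrite linear_formE dotE. Qed.

Lemma quadricAE i j z : (i < b)%N -> (j < b)%N ->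
  (quadricA i j).@[z 0] = (pC z)`_i * (pC z)`_j.+1 - (pC z)`_i.+1 * (pC z)`_j.
Proof.
move=> ib jb; rewrite /quadricA mevalB !mevalM !linear_form_dot !dot_coefXn //; exact: ltnW.
Qed.

Lemma quadricBE i z : (quadricB i).@[z 0] =
  z 0 i0 * dot (mk 0 0 (beta * 'X^i)) z - z 0 i1 * dot (mk 0 0 (alpha * 'X^i)) z.
Proof. by rewrite /quadricB mevalB !mevalM !linear_form_dot !mevalXU. Qed.

(** The last block of a point is a multiple of evaluation at [(s, t)], so pairing it with [p * 'X^i]
    evaluates the form [p] times a monomial of degree [b - a]. *)
Lemma dot_pt_shift (p : {poly k}) i s t u v : (i <= b - a)%N -> (size p <= a.+1)%N ->
  dot (mk 0 0 (p * 'X^i)) (pt s t u v) = v * s ^+ (b - a - i) * t ^+ i * hev a p s t.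
Proof.
move=> iba sp; rewrite dot_coef.
have e : (b.+1 = i + a.+1 + (b - a - i))%N.
  by lia.
transitivity (\sum_(0 <= j < b.+1) (p * 'X^i)`_j * (pC (pt s t u v))`_j).
  by rewrite big_mkord.
rewrite (big_cat_nat (n := i)) //=; last by rewrite e -addnA leq_addr.
rewrite big_nat big1 ?add0r => [|j /andP[_ ji]]; last by rewrite coefMXn ji mul0r.
rewrite (big_cat_nat (n := i + a.+1)) ?leq_addr //=; last by rewrite e leq_addr.
rewrite [X in _ + X]big_nat [X in _ + X]big1 ?addr0 => [|j /andP[ij _]]; last first.
  rewrite coefMXn ltnNge (leq_trans (leq_addr _ _) ij) /= nth_default ?mul0r //.
  by rewrite (leq_trans sp) // leq_subRL // (leq_trans (leq_addr _ _) ij).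
rewrite -{1}[i]add0n big_addn addKn big_mkord /hev mulr_sumr; apply: eq_bigr => j _.
have ja : (j <= a)%N by rewrite -ltnS.
have jb : (j + i <= b)%N by lia.
rewrite coefMXn ltnNge leq_addl /= addnK pC_pt //.
have -> : (b - (j + i) = (b - a - i) + (a - j))%N by lia.
by rewrite !exprD; ring.
Qed.

Lemma std_scroll_quadrics z : std_scroll z <-> z != 0 /\
  (forall i j, (i < b)%N -> (j < b)%N -> (quadricA i j).@[z 0] = 0) /\
  (forall i, (i <= b - a)%N -> (quadricB i).@[z 0] = 0).
Proof.
split=> [[z0 [s [t [u [v [st e]]]]]]|[z0 [hA hB]]].
  split=> //; rewrite {}e.
  split=> [i j ib jb|i iba].
    rewrite quadricAE // !pC_pt //; do ?exact: ltnW.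
    rewrite -(subnSK ib) -(subnSK jb) !exprS; ring.
  rewrite quadricBE !dot_pt_shift ?salpha // pt_i0 pt_i1; ring.
split=> //; set c := pC z in hA hB *.
have hA' i j : (i < b)%N -> (j < b)%N -> c`_i * c`_j.+1 = c`_i.+1 * c`_j.
  by move=> ib jb; apply/eqP; rewrite -subr_eq0 -quadricAE // hA.
have eC : \poly_(i < b.+1) c`_i = c.
  apply/polyP => i; rewrite coef_poly; case: ltnP => // bi.
  by rewrite nth_default // (leq_trans (size_pC z)).
(* When the coefficient [c_0] is nonzero, the point lies over the finite parameter
   [t = c_1 / c_0]. *)
have [c0|c0] := eqVneq (c`_0) 0; last first.
  pose t := c`_1 / c`_0.
  have ct i : (i <= b)%N -> c`_i = c`_0 * t ^+ i.
    elim: i => [|i IH] ib; first by rewrite mulr1.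
    apply: (mulfI c0); rewrite hA' // IH ?exprS ?(ltnW ib) // /t; by field.
  have ez u : pC z = pC (pt 1 t u c`_0).
    apply: eq_pC => i ib; by rewrite pC_pt // expr1n mulr1 -ct.
  have := hB 0%N isT; rewrite quadricBE.
  have hd (p : {poly k}) : (size p <= a.+1)%N -> dot (mk 0 0 (p * 'X^0)) z = c`_0 * p.[t].
    move=> sp; rewrite dot_coef (ez 0) -dot_coef dot_pt_shift //.
    by rewrite expr1n expr0 !mulr1 hev1.
  rewrite !hd ?salpha // => /eqP; rewrite subr_eq0 => /eqP e.
  have [||u [u0 u1]] := @proportional (z 0 i0) (z 0 i1) alpha.[t] beta.[t].
  - rewrite -negb_and; apply/negP => /andP[/eqP h /eqP]; exact: no_common_root.
  - by apply: (mulfI c0); rewrite mulrCA e mulrCA.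
  exists 1, t, u, c`_0; rewrite xpair_eqE oner_eq0; split=> //.
  by apply: eq_mk (ez u); rewrite ?pt_i0 ?pt_i1 hev1 ?salpha.
(* With [c_0 = 0], the quadrics for [j = i + 1] give in turn that the square of [c_(i+1)] is
   [c_i c_(i+2) = 0]. Only [c_b] may survive, which is the point at infinity of the base. *)
have cz i : (i < b)%N -> c`_i = 0.
  elim: i => [|i IH] ib //; have := hA' i i.+1 (ltnW ib) ib.
  by rewrite IH ?(ltnW ib) // mul0r => /esym/eqP; rewrite mulf_eq0 orbb => /eqP.
have [cb|cb] := eqVneq (c`_b) 0; last first.
  have := hB (b - a)%N (leqnn _); rewrite quadricBE.
  have ez u : pC z = pC (pt 0 1 u c`_b).
    apply: eq_pC => i ib; rewrite pC_pt // expr1n mulr1 expr0n.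
    have [->|ne] := eqVneq i b; first by rewrite subnn mulr1.
    have lt : (i < b)%N by rewrite ltn_neqAle ne ib.
    by rewrite -/c cz // subn_eq0 leqNgt lt mulr0.
  have hd (p : {poly k}) : (size p <= a.+1)%N -> dot (mk 0 0 (p * 'X^(b - a))) z = c`_b * p`_a.
    move=> sp; rewrite dot_coef (ez 0) -dot_coef dot_pt_shift //.
    by rewrite subnn expr0 expr1n !mulr1 hev_0 expr1n mulr1.
  rewrite !hd ?salpha // [beta`_a]nth_default // (_ : alpha`_a = 1); last first.
    by have := monicP malpha; rewrite lead_coefE salpha.
  rewrite mulr0 mulr0 sub0r mulr1 => /eqP; rewrite oppr_eq0 mulf_eq0 (negPf cb) orbF => /eqP z1.
  exists 0, 1, (z 0 i0), c`_b; rewrite xpair_eqE oner_eq0 andbF; split=> //.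
  apply: eq_mk (ez _); rewrite ?pt_i0 ?pt_i1 hev_0 expr1n.
    by have := monicP malpha; rewrite lead_coefE salpha /= => ->; rewrite !mulr1.
  by rewrite nth_default // mul0r mulr0.
have cnull : c = 0.
  apply/polyP => i; rewrite coef0; have [ib|ib] := ltnP i b; first exact: cz.
  have [->//|ne] := eqVneq i b.
  by rewrite nth_default // (leq_trans (size_pC z)) // ltn_neqAle eq_sym ne.
have ez s t u : pC z = pC (pt s t u 0).
  by apply: eq_pC => i ib; rewrite -/c cnull coef0 pC_pt // !mul0r.
have [z1|z1] := eqVneq (z 0 i1) 0.
  exists 0, 1, (z 0 i0), 0; rewrite xpair_eqE oner_eq0 andbF; split=> //.
  apply: eq_mk (ez _ _ _); rewrite ?pt_i0 ?pt_i1 hev_0 expr1n.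
    by have := monicP malpha; rewrite lead_coefE salpha /= => ->; rewrite !mulr1.
  by rewrite nth_default // mul0r mulr0.
(* The point is on E, which [alpha] and [beta] map onto the line: as [z_1] is nonzero, this
   polynomial has degree [a > 0], hence a root. *)
have /closed_rootP [t] : size (z 0 i0 *: beta - z 0 i1 *: alpha) != 1%N.
  rewrite addrC size_polyDl; first by rewrite size_polyN size_scale // salpha eqSS -lt0n.
  rewrite size_polyN [X in (_ < X)%N]size_scale // salpha ltnS (leq_trans (size_scale_leq _ _)) //.
rewrite /root !hornerE subr_eq0 => /eqP e.
have [||u [u0 u1]] := @proportional (z 0 i0) (z 0 i1) alpha.[t] beta.[t] => //.
  rewrite -negb_and; apply/negP => /andP[/eqP h /eqP]; exact: no_common_root.
exists 1, t, u, 0; rewrite xpair_eqE oner_eq0; split=> //.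
by apply: eq_mk (ez _ _ _); rewrite ?pt_i0 ?pt_i1 hev1 ?salpha.
Qed.

Lemma quadricA_homog i j : quadricA i j \is 2.-homog.
Proof.
apply: homog_of_eval => c x.
by rewrite /quadricA !mevalB !mevalM !linear_form_dot !dotZr; ring.
Qed.

Lemma quadricB_homog i : quadricB i \is 2.-homog.
Proof. by apply: homog_of_eval => c x; rewrite !quadricBE !dotZr !mxE; ring. Qed.

Lemma quadricA_std_scroll i j : (i < b)%N -> (j < b)%N -> vanishes_on (quadricA i j) std_scroll.
Proof. by move=> ib jb z /std_scroll_quadrics [_ [/(_ _ _ ib jb)]]. Qed.

Lemma quadricB_std_scroll i : (i <= b - a)%N -> vanishes_on (quadricB i) std_scroll.
Proof. by move=> iba z /std_scroll_quadrics [_ [_ /(_ _ iba)]]. Qed.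

Lemma zclosed_std_scroll : zclosed std_scroll.
Proof.
pose I := ({p : nat * nat | (p.1 < b)%N && (p.2 < b)%N} + {i : nat | (i <= b - a)%N})%type.
pose F (i : I) : {mpoly k[b.+3]} :=
  match i with inl p => quadricA (val p).1 (val p).2 | inr i => quadricB (val i) end.
apply: (zclosed_forms (F := F)) => [[p|i]|z].
- exists 2%N; exact: quadricA_homog.
- exists 2%N; exact: quadricB_homog.
split=> [/std_scroll_quadrics [z0 [hA hB]]|[z0 h]].
  by split=> // -[[p /= /andP[]]|[i /=]]; [apply: hA | apply: hB].
apply/std_scroll_quadrics; split=> //; split=> [i j ib jb|i iba].
  have ij : ((i, j).1 < b)%N && ((i, j).2 < b)%N by rewrite ib jb.
  exact: (h (inl (exist _ (i, j) ij))).
exact: (h (inr (exist _ i iba))).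
Qed.

Lemma one_neq (t : k) : (1, t) != (0, 0) :> k * k.
Proof. by rewrite xpair_eqE oner_eq0. Qed.

(** Parameters with [s * u != 0] are dense, and their points are multiples of points of the chart
    [s = u = 1]. *)
Lemma vanishes_on_std_scroll_chart e (f : {mpoly k[b.+3]}) :
  f \is e.-homog -> (forall t w, f.@[(pt 1 t 1 w) 0] = 0) -> vanishes_on f std_scroll.
Proof.
move=> hf hv z [z0 [s [t [u [v [st ->]]]]]].
rewrite pt_scroll_param; set q := (fun j : 'I_4 => _).
rewrite (meval_eq (v2 := fun i => (scroll_param i).@[q])) => [|i]; last by rewrite mxE.
rewrite -substE (_ : subst scroll_param f = 0) ?meval0 //.
pose g : {mpoly k[4]} := 'X_(inord 0) * 'X_(inord 2).
apply: (@mpoly_generic _ _ _ g (const_mx 1)) => [|x].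
  by rewrite mevalM !mevalXU !mxE mulr1 oner_eq0.
rewrite mevalM !mevalXU mulf_eq0 negb_or => /andP[x0 x2].
rewrite substE; move: (x 0 (inord 0)) (x 0 (inord 1)) (x 0 (inord 2)) (x 0 (inord 3)) x0 x2
  (scroll_paramE (x 0)) => s' t' u' v' s0 u0 ex.
rewrite (meval_eq (v2 := (pt s' t' u' v') 0)) => [|i]; last by rewrite -ex mxE.
have -> : pt s' t' u' v' = (u' * s' ^+ a) *: pt 1 (t' / s') 1 (v' * s' ^+ b / (u' * s' ^+ a)).
  have sa : u' * s' ^+ a != 0 by rewrite mulf_neq0 ?expf_neq0.
  rewrite /pt mkZ !hev1 ?salpha // !hev_scale ?salpha //; congr mk; try ring.
  apply/polyP => i; rewrite coefZ !coef_poly; case: ltnP => ib; last by rewrite mulr0.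
  rewrite expr1n mulr1 exprMn exprVn (_ : s' ^+ b = s' ^+ (b - i) * s' ^+ i); last first.
    by rewrite -exprD subnK.
  have si : s' ^+ i != 0 by rewrite expf_neq0.
  by field; rewrite si u0 expf_neq0.
by rewrite (homog_eval _ _ hf) hv mulr0.
Qed.

(** * Dimension of the scroll *)

Hypothesis char0 : [pchar k] =i pred0.

(** On the chart [s = u = 1] the coordinates have degree at most [b] in the base parameter and at
    most 1 in the fibre parameter. *)
Lemma hilbert_bound_std_scroll : hilbert_bound std_scroll (fun D => D.+1 * (D * b).+1)%N.
Proof.
pose ct (w : k) (i : 'I_b.+3) : {poly k} :=
  if (i : nat) == 0%N then alpha else if (i : nat) == 1%N then beta
  else if (b.+2 - i < b.+1)%N then w *: 'X^(b.+2 - i) else 0.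
pose cw (t : k) (i : 'I_b.+3) : {poly k} :=
  if (i : nat) == 0%N then alpha.[t]%:P else if (i : nat) == 1%N then beta.[t]%:P
  else if (b.+2 - i < b.+1)%N then t ^+ (b.+2 - i) *: 'X else 0.
apply: (hilbert_bound_of_curves char0 (gam := fun t w => (pt 1 t 1 w) 0) (ct := ct) (cw := cw)).
- move=> t w i; rewrite /pt mxE !hev1 ?salpha // /ct; case: (_ == 0%N); first by rewrite mul1r.
  case: (_ == 1%N); first by rewrite mul1r.
  by rewrite coef_poly; case: ltnP; rewrite ?horner0 // hornerZ hornerXn expr1n mulr1.
- move=> t w i; rewrite /pt mxE !hev1 ?salpha // /cw; case: (_ == 0%N).
    by rewrite mul1r hornerC.
  case: (_ == 1%N); first by rewrite mul1r hornerC.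
  by rewrite coef_poly; case: ltnP; rewrite ?horner0 // hornerZ hornerX expr1n mulr1 mulrC.
- move=> w i; rewrite /ct; case: (_ == 0%N); first by rewrite salpha ltnW.
  case: (_ == 1%N); first by rewrite (leq_trans sbeta) // ltnW // ltnW.
  case: ltnP => ib; last by rewrite size_poly0.
  by rewrite (leq_trans (size_scale_leq _ _)) // size_polyXn.
- move=> t i; rewrite /cw; case: (_ == 0%N); first by rewrite (leq_trans (size_polyC_leq1 _)).
  case: (_ == 1%N); first by rewrite (leq_trans (size_polyC_leq1 _)).
  case: ltnP => ib; last by rewrite size_poly0.
  by rewrite (leq_trans (size_scale_leq _ _)) // size_polyX.
- by move=> e f hf hv; apply: vanishes_on_std_scroll_chart hf _.
Qed.

Lemma pt_comb s t u v : pt s t u v = u *: pt s t 1 0 + v *: pt s t 0 1.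
Proof.
have -> : u *: pt s t 1 0 = pt s t u 0.
  rewrite /pt mkZ; congr mk; try ring.
  by apply/polyP => i; rewrite coefZ !coef_poly; case: ltnP => _; ring.
by rewrite pt_add mulr0 addr0 add0r mulr1.
Qed.

Lemma has_dim_std_scroll : has_dim std_scroll 2.
Proof.
split; last exact: no_chain_of_hilbert_bound hilbert_bound_std_scroll.
(* The chain goes through the ruling over [(1 : 0)], spanned by these two rows. *)
pose A : 'M[k]_(2, b.+3) := \matrix_(i < 2) (if i == 0 then pt 1 0 1 0 else pt 1 0 0 1).
have rowA (x : 'rV[k]_2) : x *m A = pt 1 0 (x 0 0) (x 0 1).
  rewrite mulmx_sum_row big_ord_recl big_ord1 /A !rowK /= [RHS]pt_comb.
  by congr (_ + _ *: _); congr (x 0 _); apply: val_inj.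
apply: (has_chain2_of_line (A := A));
  [exact: zclosed_std_scroll|exact: irreducible_std_scroll| | |].
- rewrite -kermx_eq0; apply/eqP/row_matrixP => i; rewrite row0.
  have : row i (kermx A) *m A = 0 by rewrite -row_mul mulmx_ker row0.
  set x := row i _; rewrite rowA => e; apply/rowP => j; rewrite [RHS]mxE.
  have x1 : x 0 1 = 0.
    have := pC_pt 1 0 (x 0 0) (x 0 1) (leq0n b).
    by rewrite e -mk0 pC_mk ?size_poly0 // coef0 expr1n expr0 !mulr1.
  have x0 : x 0 0 = 0.
    have e0 : x 0 0 * hev a alpha 1 0 = 0 by rewrite -(pt_i0 1 0 _ (x 0 1)) e mxE.
    have e1 : x 0 0 * hev a beta 1 0 = 0 by rewrite -(pt_i1 1 0 _ (x 0 1)) e mxE.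
    case/orP: (hev_coprime (one_neq 0)) => nz.
      by move/eqP: e0; rewrite mulf_eq0 (negPf nz) orbF => /eqP.
    by move/eqP: e1; rewrite mulf_eq0 (negPf nz) orbF => /eqP.
  case: j => -[|[|j]] // lj; [rewrite -[RHS]x0 | rewrite -[RHS]x1]; by congr (x 0 _);
    apply: val_inj.
- move=> z [z0 /submxP [x ex]]; split=> //.
  by exists 1, 0, (x 0 0), (x 0 1); rewrite one_neq -rowA.
- move=> s; have p0 : pt 1 1 0 1 != 0 by rewrite pt_neq0_v ?one_neq ?oner_eq0.
  have [|_ /submxP [x]] := s (pt 1 1 0 1).
    by split=> //; exists 1, 1, 0, 1; rewrite one_neq.
  rewrite rowA => /(congr1 (fun z => (pC z)`_1)); rewrite !pC_pt // !expr1n !mulr1 expr1 mulr0.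
  by move/eqP; rewrite oner_eq0.
Qed.

(** * Tangent planes of the scroll *)

Lemma tangent_contains_ruling s t u v u' v' (f : {mpoly k[b.+3]}) :
  vanishes_on f std_scroll -> dot (gradient f (pt s t u v)) (pt s t u' v') = 0.
Proof.
move=> fV; rewrite (@gradient_line _ _ _ _ _ 0) ?deriv0 ?horner0 // => e.
by rewrite pt_add vanishes_on_pt // horner0.
Qed.

(** The derivative of [pt 1 t u v] in [t], the third generator of the tangent plane besides the two
    of the ruling. *)
Definition pt_dt t u v : 'rV[k]_b.+3 :=
  mk (u * alpha^`().[t]) (u * beta^`().[t]) (\poly_(i < b.+1) (v * (i%:R * t ^+ i.-1))).

Lemma tangent_contains_dt t u v (f : {mpoly k[b.+3]}) :
  vanishes_on f std_scroll -> dot (gradient f (pt 1 t u v)) (pt_dt t u v) = 0.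
Proof.
move=> fV; pose c (i : 'I_b.+3) : {poly k} :=
  if (i : nat) == 0%N then u *: alpha else if (i : nat) == 1%N then u *: beta
  else if (b.+2 - i < b.+1)%N then v *: 'X^(b.+2 - i) else 0.
have hc s i : (c i).[s] = pt 1 s u v 0 i.
  rewrite mxE !hev1 ?salpha // /c; case: (_ == 0%N); first by rewrite hornerZ.
  case: (_ == 1%N); first by rewrite hornerZ.
  by rewrite coef_poly; case: ltnP; rewrite ?horner0 // hornerZ hornerXn expr1n mulr1.
have <- : \row_i (c i).[t] = pt 1 t u v by apply/rowP => i; rewrite mxE hc.
have <- : \row_i (c i)^`().[t] = pt_dt t u v.
  apply/rowP => i; rewrite !mxE /c; case: (_ == 0%N); first by rewrite derivZ hornerZ.
  case: (_ == 1%N); first by rewrite derivZ hornerZ.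
  rewrite coef_poly; case: ltnP => _; last by rewrite deriv0 horner0.
  by rewrite derivZ derivXn hornerZ hornerMn hornerXn mulr_natl.
apply: (@gradient_const_along_curve _ _ _ _ 0) => s.
rewrite -(vanishes_on_pt 1 s u v fV); apply: meval_eq => i; exact: hc.
Qed.

Lemma deriv_mul_lines (A B C D : k) :
  ((A%:P + B *: 'X) * (C%:P + D *: 'X))^`().[0] = A * D + B * C.
Proof. by rewrite derivM !derivD !derivC !derivZ !derivX !hornerE /=; ring. Qed.

Lemma gradient_quadricA i j x y : (i < b)%N -> (j < b)%N ->
  dot (gradient (quadricA i j) x) y =
  (pC x)`_i * (pC y)`_j.+1 + (pC y)`_i * (pC x)`_j.+1 -
  ((pC x)`_i.+1 * (pC y)`_j + (pC y)`_i.+1 * (pC x)`_j).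
Proof.
move=> ib jb; pose L l := ((pC x)`_l)%:P + (pC y)`_l *: 'X.
rewrite (@gradient_line _ _ _ _ _ (L i * L j.+1 - L i.+1 * L j)) => [|t].
  by rewrite derivB hornerD hornerN !deriv_mul_lines.
by rewrite quadricAE // pCD pCZ !coefD !coefZ /L !hornerE; ring.
Qed.

Lemma gradient_quadricB x y :
  dot (gradient (quadricB 0) x) y =
  x 0 i0 * dot (mk 0 0 beta) y + y 0 i0 * dot (mk 0 0 beta) x -
  (x 0 i1 * dot (mk 0 0 alpha) y + y 0 i1 * dot (mk 0 0 alpha) x).
Proof.
pose L i := (x 0 i)%:P + y 0 i *: 'X.
pose M p := (dot (mk 0 0 p) x)%:P + dot (mk 0 0 p) y *: 'X.
rewrite (@gradient_line _ _ _ _ _ (L i0 * M beta - L i1 * M alpha)) => [|t].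
  by rewrite derivB hornerD hornerN !deriv_mul_lines.
by rewrite quadricBE expr0 !mulr1 !dotDr !dotZr /L /M !mxE !hornerE; ring.
Qed.

Lemma pC_pt_dt t u v i : (i <= b)%N -> (pC (pt_dt t u v))`_i = v * (i%:R * t ^+ i.-1).
Proof. by move=> ib; rewrite pC_mk ?size_poly // coef_poly ltnS ib. Qed.

Lemma dot_evaluation (p : {poly k}) t y c : (size p <= b.+1)%N ->
  (forall i, (i <= b)%N -> (pC y)`_i = c * t ^+ i) -> dot (mk 0 0 p) y = c * p.[t].
Proof.
move=> sp h; rewrite dot_coef (horner_coef_wide _ sp) mulr_sumr; apply: eq_bigr => i _.
by have ib : (i <= b)%N := ltn_ord i; rewrite h //; ring.
Qed.

Lemma dot_derivative (p : {poly k}) t y c r : (size p <= b.+1)%N ->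
  (forall i, (i <= b)%N -> (pC y)`_i = c * t ^+ i + r * (i%:R * t ^+ i.-1)) ->
  dot (mk 0 0 p) y = c * p.[t] + r * p^`().[t].
Proof.
move=> sp h; rewrite dot_coef (horner_coef_wide _ sp).
have -> : p^`().[t] = \sum_(i < b.+1) p`_i * (i%:R * t ^+ i.-1).
  rewrite big_ord_recl mul0r mulr0 add0r.
  rewrite (@horner_coef_wide _ b); last by rewrite (leq_trans (size_poly _ _)) // -subn1 leq_subLR.
  by apply: eq_bigr => i _; rewrite coef_deriv /= /bump add1n -mulr_natl; ring.
rewrite !mulr_sumr -big_split; apply: eq_bigr => i _ /=.
by have ib : (i <= b)%N := ltn_ord i; rewrite h //; ring.
Qed.

(** The differentials of [quadricA 0 i] form a recursion with solutions [q t^i + r i t^(i-1)], and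
    that of [quadricB 0] makes the first two coordinates, corrected by the derivative, proportional
    to [(alpha.[t], beta.[t])]. Both steps divide by [v], so they work off E. *)
Lemma tangent_std_scroll_sub t u v y : v != 0 -> tangent_space std_scroll (pt 1 t u v) y ->
  exists p q r, y = p *: pt 1 t 1 0 + q *: pt 1 t 0 1 + r *: pt_dt t u v.
Proof.
move=> v0 [y0 hy]; set x := pt 1 t u v in hy.
have cx i : (i <= b)%N -> (pC x)`_i = v * t ^+ i.
  by move=> ib; rewrite pC_pt // expr1n mulr1.
pose q := (pC y)`_0; pose r := (pC y)`_1 - t * q.
have cy i : (i <= b)%N -> (pC y)`_i = q * t ^+ i + r * (i%:R * t ^+ i.-1).
  elim: i => [|i IH] ib; first by rewrite expr0 !mulr1 mulr0 addr0.
  have /dot_eq0 := hy _ _ (quadricA_homog 0 i) (quadricA_std_scroll b_gt0 ib).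
  rewrite gradient_quadricA // !cx ?(ltnW ib) // -/q => h.
  apply: (mulfI v0); rewrite expr0 mulr1 expr1 in h.
  have -> : v * (pC y)`_i.+1 = v * t * (pC y)`_i + (pC y)`_1 * (v * t ^+ i) - q * (v * t ^+ i.+1).
    by apply/eqP; rewrite -subr_eq0; apply/eqP; rewrite -[RHS]h; ring.
  rewrite (IH (ltnW ib)) /= -natr1 /r exprS.
  case: i {IH h ib} => [|i] /=; first by rewrite expr0 mul0r; ring.
  by rewrite exprS -natr1; ring.
have /dot_eq0 := hy _ _ (quadricB_homog 0) (quadricB_std_scroll (leq0n _)).
have sab : (size alpha <= b.+1)%N by rewrite salpha ltnW.
have sbb : (size beta <= b.+1)%N by rewrite (leq_trans sbeta) // ltnW // ltnW.
rewrite gradient_quadricB (dot_evaluation sab cx) (dot_evaluation sbb cx).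
rewrite (dot_derivative sab cy) (dot_derivative sbb cy).
rewrite pt_i0 pt_i1 !hev1 ?salpha // => h.
have [||p [p0 p1]] := @proportional (y 0 i0 - r / v * (u * alpha^`().[t]))
  (y 0 i1 - r / v * (u * beta^`().[t])) alpha.[t] beta.[t].
- rewrite -negb_and; apply/negP => /andP[/eqP ha /eqP]; exact: no_common_root.
- apply: (mulfI v0); apply/eqP; rewrite -subr_eq0; apply/eqP; rewrite -[RHS]h.
  by field.
exists p, q, (r / v); apply: eq_mk.
- rewrite !mxE /= !hev1 ?salpha // -[LHS](subrK (r / v * (u * alpha^`().[t]))) p0; ring.
- rewrite !mxE /= !hev1 ?salpha // -[LHS](subrK (r / v * (u * beta^`().[t]))) p1; ring.
apply: eq_pC => i ib; rewrite !pCD !pCZ !coefD !coefZ !pC_pt // pC_pt_dt // cy // expr1n.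
by field.
Qed.

Lemma pt10_neq0 t : pt 1 t 1 0 != 0.
Proof.
apply/negP => /eqP e.
case/orP: (hev_coprime (one_neq t)) => /eqP; apply.
  by have := pt_i0 1 t 1 0; rewrite e mxE mul1r.
by have := pt_i1 1 t 1 0; rewrite e mxE mul1r.
Qed.

Lemma smooth_pt t u v : v != 0 -> smooth_point std_scroll (pt 1 t u v).
Proof.
move=> v0; split.
  by split; [rewrite pt_neq0_v ?one_neq | exists 1, t, u, v; rewrite one_neq].
exists 2%N; split; first exact: has_dim_std_scroll.
pose A : 'M[k]_(3, b.+3) := \matrix_(i < 3) nth 0 [:: pt 1 t 1 0; pt 1 t 0 1; pt_dt t u v] i.
have rowA (x : 'rV[k]_3) :
    x *m A = x 0 0 *: pt 1 t 1 0 + x 0 1 *: pt 1 t 0 1 + x 0 (inord 2) *: pt_dt t u v.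
  rewrite mulmx_sum_row !big_ord_recl big_ord0 /A !rowK /= addr0 addrA.
  by congr (_ + _ *: _ + _ *: _); congr (x 0 _); apply: val_inj; rewrite //= inordK.
exists A; split.
  rewrite -kermx_eq0; apply/eqP/row_matrixP => i; rewrite row0.
  have : row i (kermx A) *m A = 0 by rewrite -row_mul mulmx_ker row0.
  set x := row i _; rewrite rowA => e.
  have ec j : (j <= b)%N -> x 0 1 * t ^+ j + x 0 (inord 2) * (v * (j%:R * t ^+ j.-1)) = 0.
    move=> jb; have := congr1 (fun z => (pC z)`_j) e.
    rewrite !pCD !pCZ !coefD !coefZ !pC_pt // pC_pt_dt // !mul0r mulr0 add0r expr1n !mul1r => ->.
    by rewrite -mk0 pC_mk ?size_poly0 // coef0.
  have x1 : x 0 1 = 0 by have := ec 0%N isT; rewrite expr0 !mulr1 !mulr0 addr0.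
  have x2 : x 0 (inord 2) = 0.
    have := ec 1%N b_gt0; rewrite x1 mul0r add0r /= mul1r mulr1 => /eqP.
    by rewrite mulf_eq0 (negPf v0) orbF => /eqP.
  have x0 : x 0 0 = 0.
    move/eqP: e; rewrite x1 x2 !scale0r !addr0 scaler_eq0 (negPf (pt10_neq0 t)) orbF.
    by move/eqP.
  apply/rowP => j; rewrite [RHS]mxE; case: j => -[|[|[|j]]] // lj;
    [rewrite -[RHS]x0 | rewrite -[RHS]x1 | rewrite -[RHS]x2]; congr (x 0 _); apply: val_inj;
    by rewrite //= inordK.
move=> y; split=> [ty|[y0 /submxP [x ex]]].
  split; first by case: ty.
  have [p [q [r ->]]] := tangent_std_scroll_sub v0 ty.
  apply/submxP; exists (\row_(i < 3) nth 0 [:: p; q; r] i).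
  by rewrite rowA !mxE /= inordK.
split=> // e f hf fV; apply/dot_eq0; rewrite ex rowA !dotDr !dotZr.
by rewrite !tangent_contains_ruling // tangent_contains_dt // !mulr0 !addr0.
Qed.

(* Tangency at the point [pt 1 t u 1] with [u = - (pC y)'(t) / (pA y)'(t)]. *)
Definition tangent_hyperplane y : Prop :=
  exists t, [/\ (pA y).[t] = 0, (pC y).[t] = 0 & (pA y)^`().[t] != 0].

Lemma dual_std_scroll_contains y : tangent_hyperplane y -> dual_variety std_scroll y.
Proof.
case=> t [At Ct A't].
have y0 : y != 0.
  apply: contra A't => /eqP ->; rewrite /pA !mxE !scale0r addr0.
  by rewrite deriv0 horner0.
apply: sub_zclosure => //; split=> //.
pose u := - (pC y)^`().[t] / (pA y)^`().[t].
exists (pt 1 t u 1); split; first by apply: smooth_pt; rewrite oner_eq0.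
move=> z /(tangent_std_scroll_sub (oner_neq0 _)) [p [q [r ->]]].
apply/dot_eq0; rewrite !dotDr !dotZr !dot_pt !hev1 ?size_pA ?size_pC // At Ct.
suff dy : dot y (pt_dt t u 1) = 0 by rewrite dy; ring.
rewrite -{1}(mk_eta y) dot_mk.
have -> : \sum_(i < b.+1) (pC y)`_i * (\poly_(i < b.+1) (1 * (i%:R * t ^+ i.-1)))`_i =
    (pC y)^`().[t].
  rewrite big_ord_recl coef_poly mul0r !mulr0 add0r.
  rewrite (@horner_coef_wide _ b); last first.
    by rewrite (leq_trans (size_poly _ _)) // -subn1 leq_subLR size_pC.
  apply: eq_bigr => i _; rewrite coef_poly /= /bump add1n ltnS ltn_ord coef_deriv -mulr_natl.
  by ring.
have -> : y 0 i0 * (u * alpha^`().[t]) + y 0 i1 * (u * beta^`().[t]) = u * (pA y)^`().[t].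
  by rewrite /pA derivD !derivZ hornerD !hornerZ; ring.
by rewrite /u divfK // addNr.
Qed.

(** * The equation of the dual variety *)

Definition Agen : {poly {mpoly k[b.+3]}} :=
  'X_i0 *: map_poly (@mpolyC _ _) alpha + 'X_i1 *: map_poly (@mpolyC _ _) beta.

Definition Cgen : {poly {mpoly k[b.+3]}} := \poly_(i < b.+1) 'X_(inord (b.+2 - i)).

Definition dual_form : {mpoly k[b.+3]} := res a b Agen Cgen.

(** Where [h_0] is nonzero, the resultant is [h_0 ^ b] times the product of A' over the roots of A;
    so [disc] is nonzero exactly where A has [a] distinct finite roots. The derivative is padded to
    degree [b]. *)
Definition disc : {mpoly k[b.+3]} := 'X_i0 * res a b Agen Agen^`().

Lemma eval_Agen y : map_poly (meval (y 0)) Agen = pA y.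
Proof.
have h (p : {poly k}) : map_poly (meval (y 0)) (map_poly (@mpolyC _ _) p) = p.
  by rewrite -map_poly_comp map_poly_id // => c _ /=; rewrite mevalC.
by rewrite rmorphD /= !map_polyZ /= !h !mevalXU.
Qed.

Lemma eval_Cgen y : map_poly (meval (y 0)) Cgen = pC y.
Proof.
by apply/polyP => i; rewrite coef_map !coef_poly; case: ltnP => _; [exact: mevalXU | exact: meval0].
Qed.

Lemma dual_formE y : dual_form.@[y 0] = res a b (pA y) (pC y).
Proof. by rewrite /dual_form map_res eval_Agen eval_Cgen. Qed.

Lemma discE y : disc.@[y 0] = y 0 i0 * res a b (pA y) (pA y)^`().
Proof. by rewrite /disc mevalM mevalXU map_res -deriv_map eval_Agen. Qed.

Lemma pA_scale c y : pA (c *: y) = c *: pA y.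
Proof. by rewrite /pA !mxE scalerDr !scalerA. Qed.

Lemma dual_form_homog : dual_form \is (a + b).-homog.
Proof.
apply: homog_of_eval => c y.
by rewrite !dual_formE pA_scale pCZ res_scale res_scaler exprD; ring.
Qed.

Let ab_gt0 : (0 < a + b)%N. Proof. by rewrite addn_gt0 a_gt0. Qed.

Lemma dual_form_common_root y t : (pA y).[t] = 0 -> (pC y).[t] = 0 -> dual_form.@[y 0] = 0.
Proof. by move=> hA hC;
  rewrite dual_formE (res_common_root ab_gt0 _ _ hA hC) ?size_pA ?size_pC. Qed.

(** A tangent hyperplane contains the ruling through its point of contact, and restricting [y] to
    that ruling shows that A and C vanish at the same [(s : t)], possibly at infinity. This covers
    every smooth point, those on E included. *)
Lemma dual_form_dual y : dual_variety std_scroll y -> dual_form.@[y 0] = 0.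
Proof.
case=> y0 /(_ _ _ dual_form_homog); apply=> {y0}y [y0 [x [[[x0 [s [t [u [v [st ex]]]]]] _] hy]]].
have h u' v' : u' * hev a (pA y) s t + v' * hev b (pC y) s t = 0.
  rewrite -dot_pt; have [->|nz] := eqVneq (pt s t u' v') 0; first exact: dotr0.
  apply/dot_eq0/hy; split=> // e f _ fV; apply/dot_eq0.
  by rewrite ex; apply: tangent_contains_ruling.
have hA := h 1 0; have hC := h 0 1; rewrite mul1r mul0r addr0 in hA.
rewrite mul1r mul0r add0r in hC.
have [s0|s0] := eqVneq s 0.
  have t0 : t != 0 by apply: contra st => /eqP ->; rewrite s0.
  have z d (p : {poly k}) : hev d p s t = 0 -> p`_d = 0.
    by rewrite s0 hev_0 => /eqP; rewrite mulf_eq0 expf_eq0 (negPf t0) andbF orbF => /eqP.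
  by rewrite dual_formE (res_common_infinity ab_gt0) ?size_pA ?size_pC ?(z _ _ hA) ?(z _ _ hC).
have z d (p : {poly k}) : (size p <= d.+1)%N -> hev d p s t = 0 -> p.[t / s] = 0.
  move=> sp; rewrite hev_scale // => /eqP.
  by rewrite mulf_eq0 expf_eq0 (negPf s0) andbF => /eqP.
exact: dual_form_common_root (z _ _ (size_pA y) hA) (z _ _ (size_pC y) hC).
Qed.

Definition good y : Prop := y 0 i0 != 0 /\ separable_poly (pA y).

Lemma good_roots y : good y -> exists rs : seq k,
  [/\ size rs = a, uniq rs & pA y = y 0 i0 *: \prod_(r <- rs) ('X - r%:P)].
Proof.
case=> y0 sep; have [rs e] := closed_field_poly_normal (pA y).
have sA : size (pA y) = a.+1.
  apply/eqP; rewrite eqn_leq size_pA ltnNge; apply/negP => h.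
  by move: y0; rewrite -coef_pA_a nth_default ?eqxx.
have lA : lead_coef (pA y) = y 0 i0 by rewrite lead_coefE sA coef_pA_a.
rewrite lA in e; exists rs; split=> //.
  by move: sA; rewrite e size_scale // size_prod_XsubC => -[].
by rewrite -(separable_prod_XsubC rs) -(eqp_separable (eqp_scale _ y0)) -e.
Qed.

Lemma good_root_derivative y r : good y -> (pA y).[r] = 0 -> (pA y)^`().[r] != 0.
Proof.
by move=> [_]; rewrite unlock => cp /rootP /(coprimep_root cp).
Qed.

Lemma dual_form_good y rs : size rs = a -> uniq rs ->
  pA y = y 0 i0 *: \prod_(r <- rs) ('X - r%:P) ->
  dual_form.@[y 0] = y 0 i0 ^+ b * \prod_(r <- rs) (pC y).[r].
Proof. by move=> srs urs e; rewrite dual_formE e res_prod_roots // size_pC. Qed.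

Lemma disc_good y : disc.@[y 0] != 0 <-> good y.
Proof.
rewrite discE mulf_eq0 negb_or; split=> [/andP[y0 rz]|gy].
  split=> //; rewrite unlock; apply: coprimep_of_roots => t At A't; case/eqP: rz.
  apply: (res_common_root _ _ _ At A't) => //; first exact: size_pA.
  rewrite (leq_trans (size_poly _ _)) // -subn1 leq_subLR.
  by rewrite (leq_trans (size_pA _)) // addnC addn1 ltnS ltnW // ltnW.
have [y0 _] := gy; rewrite y0 /=.
have [rs [srs urs e]] := good_roots gy.
rewrite {1}e res_prod_roots //; last first.
  rewrite (leq_trans (size_poly _ _)) // -subn1 leq_subLR.
  by rewrite (leq_trans (size_pA _)) // addnC addn1 ltnS ltnW // ltnW.
rewrite mulf_neq0 ?expf_neq0 // prodf_seq_neq0; apply/allP => r rr /=.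
apply: good_root_derivative gy _.
by rewrite e hornerZ (rootP _) ?mulr0 // root_prod_XsubC.
Qed.

Lemma pA_mk h0 h1 C : pA (mk h0 h1 C) = h0 *: alpha + h1 *: beta.
Proof. by rewrite /pA mk_i0 mk_i1. Qed.

Lemma pA_add x y : pA (x + y) = pA x + pA y.
Proof. by rewrite /pA !mxE !scalerDl addrACA. Qed.

(* A double root of a member of the pencil is a root of the Wronskian. *)
Lemma exists_separable_member : exists c, separable_poly (alpha + c *: beta).
Proof.
pose W := alpha^`() * beta - alpha * beta^`().
have sd : (size alpha^`() <= a)%N by rewrite (leq_trans (size_poly _ _)) // salpha.
have d0 : alpha^`() != 0.
  apply/negP => /eqP /(congr1 (fun p : {poly k} => p`_a.-1)); rewrite coef_deriv prednK // coef0.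
  have := monicP malpha; rewrite lead_coefE salpha /= => -> /eqP.
  by rewrite ((pcharf0P k).1 char0) -[a]prednK.
have W0 : W != 0.
  apply/negP => /eqP /eqP; rewrite subr_eq0 => /eqP e.
  have : alpha %| alpha^`() * beta by rewrite e dvdp_mulr.
  rewrite Gauss_dvdpl // => /(dvdp_leq d0); rewrite salpha => h.
  by have := leq_trans h sd; rewrite ltnn.
have [rs eW] := closed_field_poly_normal W.
pose Q := \prod_(r <- rs) (alpha.[r]%:P + beta.[r] *: 'X).
have Q0 : Q != 0.
  rewrite prodf_seq_neq0; apply/allP => r _ /=; apply/negP => /eqP e.
  have e1 := congr1 (fun p : {poly k} => p.[0]) e.
  have e2 := congr1 (fun p : {poly k} => p.[1]) e.
  rewrite hornerD hornerC hornerZ hornerX mulr0 addr0 horner0 in e1.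
  rewrite hornerD hornerC hornerZ hornerX mulr1 e1 add0r horner0 in e2.
  exact: no_common_root e1 e2.
have [c hc] := closed_nonrootP _ Q0; exists c.
rewrite unlock; apply: coprimep_of_roots => t.
rewrite derivD derivZ !hornerD !hornerZ => e1 e2.
have : root W t.
  rewrite /root /W hornerD hornerN !hornerM.
  have -> : alpha.[t] = - (c * beta.[t]) by apply/eqP; rewrite -addr_eq0 e1.
  have -> : alpha^`().[t] = - (c * beta^`().[t]) by apply/eqP; rewrite -addr_eq0 e2.
  by apply/eqP; ring.
rewrite eW rootZ ?lead_coef_eq0 // root_prod_XsubC => tr.
move/negP: hc; apply; rewrite /root /Q horner_prod (big_rem t tr) /=.
by rewrite hornerD hornerC hornerZ hornerX [_ * c]mulrC e1 mul0r.
Qed.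

Lemma exists_good : exists c, forall C, good (mk 1 c C).
Proof.
have [c sc] := exists_separable_member; exists c => C; split; first by rewrite mk_i0 oner_neq0.
by rewrite pA_mk scale1r.
Qed.

Implicit Types (bp : 'rV[k]_b.+2) (f g : {mpoly k[b.+3]}).

(** Splits off the last coordinate, the constant coefficient of C. Varying it fixes A and translates
    all the values C(r) together, so over a good A the form [dual_form] splits into [a] linear
    factors in it. *)
Definition ext (bp : 'rV[k]_b.+2) (t : k) : 'rV[k]_b.+3 :=
  \row_i if unlift ord_max i is Some j then bp 0 j else t.

Definition ev (bp : 'rV[k]_b.+2) : {poly {mpoly k[b.+2]}} -> {poly k} :=
  map_poly (meval (bp 0)).

Lemma meval_ext f bp t : f.@[(ext bp t) 0] = (ev bp (muni f)).[t].
Proof.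
rewrite meval_muni mxE unlift_none; congr (_.[_]); apply: eq_map_poly => g.
apply: meval_eq => i /=; rewrite mxE.
have -> : widen_ord (leqnSn b.+2) i = lift ord_max i.
  by apply: val_inj; rewrite /= /bump leqNgt ltn_ord.
by rewrite liftK.
Qed.

Lemma poly_mpoly_ext P Q : (forall bp t, (ev bp P).[t] = (ev bp Q).[t]) -> P = Q.
Proof.
move=> h; apply/polyP => i; apply: mpoly_ext => bp.
have /(congr1 (fun p : {poly k} => p`_i)) : ev bp P = ev bp Q by apply: poly_ext.
by rewrite !coef_map.
Qed.

Lemma muni_surjective (P : {poly {mpoly k[b.+2]}}) : exists f, muni f = P.
Proof.
pose w (p : {mpoly k[b.+2]}) : {mpoly k[b.+3]} := subst (fun i => 'X_(lift ord_max i)) p.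
exists (\sum_(i < size P) w P`_i * 'X_ord_max ^+ i); apply: poly_mpoly_ext => bp t.
rewrite -meval_ext raddf_sum (@horner_coef_wide _ (size P)) ?size_poly //.
apply: eq_bigr => i _; rewrite coef_map /= mevalM rmorphXn /= mevalXU mxE unlift_none substE.
by congr (_ * _); apply: meval_eq => j; rewrite mevalXU mxE liftK.
Qed.

Lemma extE bp t : ext bp t = ext bp 0 + t *: mk 0 0 1.
Proof.
apply/rowP => i; rewrite !mxE coef1.
case: (unliftP ord_max i) => [j ej|ej].
  case: eqP => [_|_]; first by rewrite mulr0 addr0.
  case: eqP => [_|_]; first by rewrite mulr0 addr0.
  case: eqP => [h|_]; last by rewrite mulr0 addr0.
  by move/eqP: h; rewrite ej /= /bump leqNgt ltn_ord add0n subn_eq0 leqNgt ltn_ord.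
by rewrite add0r ej /= subnn eqxx mulr1.
Qed.

Lemma ext_surjective y : exists bp t, y = ext bp t.
Proof.
exists (\row_j y 0 (lift ord_max j)), (y 0 ord_max); apply/rowP => i; rewrite mxE.
by case: (unliftP ord_max i) => [j ->|->]; rewrite ?mxE.
Qed.

Lemma pA_ext bp t : pA (ext bp t) = pA (ext bp 0).
Proof. by rewrite extE pA_add pA_scale pA_mk !scale0r addr0 scaler0 addr0. Qed.

Lemma pC_ext bp t : pC (ext bp t) = pC (ext bp 0) + t%:P.
Proof. by rewrite extE pCD pCZ pC_mk ?size_poly1 // alg_polyC. Qed.

Lemma ext_i0 bp t : ext bp t 0 i0 = bp 0 ord0.
Proof.
rewrite mxE; have -> : i0 = lift ord_max (ord0 : 'I_b.+2) by apply: val_inj.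
by rewrite liftK.
Qed.

Lemma good_ext bp t : good (ext bp t) <-> good (ext bp 0).
Proof. by rewrite /good pA_ext !ext_i0. Qed.

Definition disc' : {mpoly k[b.+2]} :=
  subst (fun i => if unlift ord_max i is Some j then 'X_j else 0) disc.

Lemma disc'E bp : disc'.@[bp 0] = disc.@[(ext bp 0) 0].
Proof.
rewrite substE; apply: meval_eq => i; rewrite mxE.
by case: (unlift _ i) => [j|]; rewrite ?meval0 // mevalXU.
Qed.

Lemma vanish_at_good (p : {mpoly k[b.+2]}) :
  (forall bp : 'rV_b.+2, good (ext bp 0) -> p.@[bp 0] = 0) -> p = 0.
Proof.
have [c hc] := exists_good; have [x0 [t e]] := ext_surjective (mk 1 c 0).
have gx : good (ext x0 0) by apply/(good_ext x0 t); rewrite -e; exact: hc.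
move=> h; apply: (@mpoly_generic _ _ _ disc' x0) => [|bp].
  by rewrite disc'E; apply/disc_good.
by rewrite disc'E => /disc_good; exact: h.
Qed.

Lemma ev_dual_form bp rs : size rs = a -> uniq rs ->
  pA (ext bp 0) = bp 0 ord0 *: \prod_(r <- rs) ('X - r%:P) ->
  ev bp (muni dual_form) =
    bp 0 ord0 ^+ b *: \prod_(r <- rs) ('X - (- (pC (ext bp 0)).[r])%:P).
Proof.
move=> srs urs e; apply: poly_ext => t; rewrite -meval_ext.
rewrite (dual_form_good srs urs) ?pA_ext ?ext_i0 // hornerZ; congr (_ * _).
rewrite horner_prod; apply: eq_bigr => r _.
by rewrite pC_ext !hornerE opprK addrC.
Qed.

(** At a good point [ev_dual_form] is [h_0 ^ b] times a monic product of [a] factors; density of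
    good points turns this into an identity of coefficients. *)
Lemma muni_dual_form_coef j : (a <= j)%N ->
  (muni dual_form)`_j = if j == a then 'X_ord0 ^+ b else 0.
Proof.
move=> aj; apply/eqP; rewrite -subr_eq0; apply/eqP/vanish_at_good => bp gx.
have [rs [srs urs]] := good_roots gx; rewrite ext_i0 => e.
have sP := size_prod_XsubC [seq - (pC (ext bp 0)).[r] | r <- rs] id.
rewrite size_map srs big_map in sP.
rewrite mevalB -coef_map -/(ev bp _) (ev_dual_form srs urs e) coefZ.
have [->|ne] := eqVneq j a.
  rewrite rmorphXn /= mevalXU.
  have := monicP (monic_prod_XsubC [seq - (pC (ext bp 0)).[r] | r <- rs] xpredT id).
  by rewrite lead_coefE big_map sP /= => ->; rewrite mulr1 subrr.
by rewrite meval0 subr0 nth_default ?mulr0 // sP ltn_neqAle eq_sym ne.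
Qed.

Lemma X0_neq0 n : ('X_ord0 : {mpoly k[n.+1]}) != 0.
Proof. by rewrite -msize_poly_eq0 msizeX. Qed.

Lemma size_muni_dual_form : size (muni dual_form) = a.+1.
Proof.
apply/eqP; rewrite eqn_leq; apply/andP; split.
  by apply/leq_sizeP => j aj; rewrite muni_dual_form_coef ?(ltnW aj) // gtn_eqF.
rewrite ltnNge; apply/negP => h; have := muni_dual_form_coef (leqnn a).
by rewrite nth_default // eqxx => /esym/eqP; rewrite expf_eq0 (negPf (X0_neq0 _)) andbF.
Qed.

Lemma lead_coef_muni_dual_form : lead_coef (muni dual_form) = 'X_ord0 ^+ b.
Proof. by rewrite lead_coefE size_muni_dual_form /= muni_dual_form_coef // eqxx. Qed.

Lemma tangent_hyperplane_vanish_good f bp rs :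
  (forall y, tangent_hyperplane y -> f.@[y 0] = 0) -> good (ext bp 0) ->
  size rs = a -> uniq rs -> pA (ext bp 0) = bp 0 ord0 *: \prod_(r <- rs) ('X - r%:P) ->
  forall r, r \in rs -> (ev bp (muni f)).[- (pC (ext bp 0)).[r]] = 0.
Proof.
move=> hf gx srs urs e r rr; rewrite -meval_ext; apply: hf; exists r.
have Ar : (pA (ext bp 0)).[r] = 0.
  by rewrite e hornerZ (rootP _) ?mulr0 // root_prod_XsubC.
by rewrite pA_ext pC_ext hornerD hornerC subrr; split=> //; apply: good_root_derivative gx Ar.
Qed.

(* Where the member of the pencil is good, [dual_form] has [a] roots in the last
   variable, distinct after a generic shift of the coefficient of [X] in [pC];
   so a remainder of degree less than [a] that vanishes at them is zero. *)
Lemma remainder_eq0 (R : {poly {mpoly k[b.+2]}}) :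
  (size R <= a)%N ->
  (forall bp rs, good (ext bp 0) -> size rs = a -> uniq rs ->
     pA (ext bp 0) = bp 0 ord0 *: \prod_(r <- rs) ('X - r%:P) ->
     forall r, r \in rs -> (ev bp R).[- (pC (ext bp 0)).[r]] = 0) ->
  R = 0.
Proof.
move=> sR hR; apply/polyP => i; rewrite coef0; apply: vanish_at_good => bp gx.
have [rs [srs urs]] := good_roots gx; rewrite ext_i0 => e.
(* The direction [d] adds a multiple of [X] to C: it moves the values C(r) apart without changing
   A. *)
have [d [td ed]] := ext_surjective (mk 0 0 'X).
have sX : (size ('X : {poly k}) <= b.+1)%N by rewrite size_polyX ltnS b_gt0.
have td0 : td = 0.
  have := congr1 (fun z : 'rV_b.+3 => z 0 ord_max) ed.
  by rewrite !mxE unlift_none /= subnn coefX.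
have sh s : ext (bp + s *: d) 0 = ext bp 0 + s *: mk 0 0 'X.
  rewrite ed td0; apply/rowP => j; rewrite !mxE.
  by case: (unlift _ j) => [l|]; rewrite ?mxE // mulr0 addr0.
have pAs s : pA (ext (bp + s *: d) 0) = pA (ext bp 0).
  by rewrite sh pA_add pA_scale pA_mk !scale0r addr0 scaler0 addr0.
have pCs s : pC (ext (bp + s *: d) 0) = pC (ext bp 0) + s *: 'X.
  by rewrite sh pCD pCZ pC_mk.
have d00 s : (bp + s *: d) 0 ord0 = bp 0 ord0.
  by rewrite -!(ext_i0 _ 0) sh !mxE /= mulr0 addr0.
pose C := pC (ext bp 0).
(* [D.[s]] vanishes exactly when two of the values C(r) + s r coincide; it is a nonzero polynomial
   in [s] because the roots are distinct. *)
pose D := \prod_(r <- rs) \prod_(r' <- rs | r' != r) ((C.[r] - C.[r'])%:P + (r - r') *: 'X).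
have D0 : D != 0.
  rewrite prodf_seq_neq0; apply/allP => r _ /=; rewrite prodf_seq_neq0.
  apply/allP => r' _; apply/implyP => ne; apply/negP => /eqP.
  move/(congr1 (fun p : {poly k} => p`_1)); rewrite coefD coefC coefZ coefX coef0 /= add0r mulr1.
  by move/eqP; rewrite subr_eq0 eq_sym (negPf ne).
pose cv j := (bp 0 j)%:P + d 0 j *: 'X.
have hcv s : (curve_eval cv R`_i).[s] = (R`_i).@[(bp + s *: d) 0].
  rewrite curve_evalE; apply: meval_eq => j.
  by rewrite !mxE /cv hornerD hornerC hornerZ hornerX mulrC.
suff c0 : curve_eval cv R`_i = 0.
  by have := hcv 0; rewrite c0 horner0 scale0r addr0 => <-.
apply: (poly_ext_generic D0) => s Ds; rewrite horner0 hcv.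
suff R0 : ev (bp + s *: d) R = 0 by rewrite -coef_map -/(ev _ _) R0 coef0.
have gs : good (ext (bp + s *: d) 0).
  by case: gx; rewrite ext_i0 => g1 g2; split; rewrite ?ext_i0 ?d00 ?pAs.
pose vs := [seq - (C.[r] + s * r) | r <- rs].
apply: (@roots_geq_poly_eq0 _ _ vs).
- apply/allP => _ /mapP [r rr ->]; apply/rootP.
  have := hR _ rs gs srs urs _ r rr; rewrite pAs d00 pCs hornerD hornerZ hornerX; exact.
- rewrite map_inj_in_uniq // => r r' rr rr' /oppr_inj h; apply/eqP/negPn/negP => ne.
  have ne' : r' != r by rewrite eq_sym.
  case/negP: Ds; rewrite /D horner_prod (big_rem r rr) /= horner_prod.
  rewrite (big_rem r' rr') /= ne' hornerD hornerC hornerZ hornerX.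
  suff -> : C.[r] - C.[r'] + (r - r') * s = 0 by rewrite !mul0r.
  have -> : C.[r] = C.[r'] + s * r' - s * r by rewrite -h addrK.
  by ring.
- by rewrite size_map srs (leq_trans (size_poly _ _)).
Qed.

Lemma ev_scale bp c P : ev bp (c *: P) = c.@[bp 0] *: ev bp P.
Proof. by rewrite /ev map_polyZ. Qed.

Lemma ev_muladd bp P Q R : ev bp (P * Q + R) = ev bp P * ev bp Q + ev bp R.
Proof. by rewrite /ev rmorphD rmorphM. Qed.

Lemma horner_remainder (p u q v : {poly k}) c (t : k) :
  p * u + q = c *: v -> u.[t] = 0 -> v.[t] = 0 -> q.[t] = 0.
Proof.
move=> e hu hv; have -> : q = c *: v - p * u by rewrite -e addrC addKr.
by rewrite hornerD hornerN hornerZ hornerM hu hv !mulr0 subrr.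
Qed.

Lemma divides_up_to_X0 f g n :
  (forall y, tangent_hyperplane y -> f.@[y 0] = 0) ->
  (forall y, tangent_hyperplane y -> g.@[y 0] = 0) ->
  size (muni g) = a.+1 -> lead_coef (muni g) = 'X_ord0 ^+ n ->
  exists m h, 'X_i0 ^+ m * f = h * g.
Proof.
move=> hf hg sg lg; have [m [H [R [eP sR]]]] : exists m H R,
    'X_ord0 ^+ m *: muni f = H * muni g + R /\ (size R <= a)%N.
  have Q0 : muni g != 0 by rewrite -size_poly_eq0 sg.
  have := Pdiv.Idomain.divp_eq (muni f) (muni g); rewrite lg -exprM => e.
  do 3!eexists; split; first exact: e.
  by have := ltn_modpN0 (muni f) Q0; rewrite sg ltnS.
have R0 : R = 0.
  apply: remainder_eq0 => // bp rs gx srs urs e r rr.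
  have hP := tangent_hyperplane_vanish_good hf gx srs urs e rr.
  have hQ := tangent_hyperplane_vanish_good hg gx srs urs e rr.
  have e2 : ev bp (H * muni g + R) = ('X_ord0 ^+ m).@[bp 0] *: ev bp (muni f).
    by rewrite -ev_scale eP.
  exact: horner_remainder (etrans (esym (ev_muladd bp H (muni g) R)) e2) hQ hP.
have [h hh] := muni_surjective H; exists m, h; apply: muni_inj.
rewrite !muniM hh -[RHS]addr0 -R0 -eP -mul_polyC; congr (_ * _).
apply: poly_mpoly_ext => bp t; rewrite -meval_ext /ev map_polyC hornerC !rmorphXn /= !mevalXU.
by rewrite ext_i0 rmorphXn /= mevalXU.
Qed.

(* Hence [dual_form] is prime to the first coordinate, the only possible
   denominator of the pseudo-division by [dual_form]. *)
Lemma dual_form_nonzero_at_infinity : exists y, y 0 i0 = 0 /\ dual_form.@[y 0] != 0.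
Proof.
have beta0 : beta != 0.
  apply: contraTneq cop => ->; rewrite coprimep0 -size_poly_eq1 salpha eqSS.
  by rewrite -lt0n a_gt0.
have [c hc] := closed_nonrootP _ beta0.
have sC : size (('X - c%:P) ^+ b) = b.+1.
  by rewrite size_exp_XsubC.
exists (mk 0 1 (('X - c%:P) ^+ b)); rewrite mk_i0 dual_formE pA_mk scale0r add0r scale1r.
split=> //; rewrite pC_mk ?sC //; apply: res_neq0 => //.
by apply: coprimep_expr; rewrite coprimep_XsubC hc.
Qed.

Lemma dual_form_neq0 : dual_form != 0.
Proof.
by have [y [_ h]] := dual_form_nonzero_at_infinity; apply: contra h => /eqP ->; rewrite meval0.
Qed.

Lemma dual_form_divides f :
  (forall y, tangent_hyperplane y -> f.@[y 0] = 0) -> exists h, f = h * dual_form.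
Proof.
move=> hf; have [n [h]] := divides_up_to_X0 hf
  (fun y ty => dual_form_dual (dual_std_scroll_contains ty)) size_muni_dual_form
    lead_coef_muni_dual_form.
elim: n h => [|n IH] h e; first by exists h; rewrite -e mul1r.
have [h' eh] : exists h', h = 'X_i0 * h'.
  (* [Z] sets the first coordinate to zero. The left side of [e] then vanishes and [dual_form] does
     not, so [h] does, and one factor of the first coordinate cancels. *)
  pose Z (p : {mpoly k[b.+3]}) : {mpoly k[b.+3]} := subst (fun i => if i == i0 then 0 else 'X_i) p.
  have ZE p y : (Z p).@[y 0] = p.@[(zero_coord i0 y) 0].
    rewrite substE; apply: meval_eq => i; rewrite mxE.
    by case: ifP; rewrite ?meval0 // mevalXU.
  have Zh : Z h = 0.
    have [y [y0 fy]] := dual_form_nonzero_at_infinity.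
    have : Z h * Z dual_form == 0.
      apply/eqP/mpoly_ext => x; rewrite mevalM !ZE -mevalM -e exprS -mulrA mevalM mevalXU.
      by rewrite mxE eqxx mul0r meval0.
    rewrite mulf_eq0 => /orP[/eqP //|/eqP Zf].
    have := ZE dual_form y; rewrite Zf meval0 => /esym/eqP; rewrite (_ : zero_coord i0 y = y).
      by rewrite (negPf fy).
    by apply/rowP => i; rewrite mxE; case: eqP => // ->.
  apply: mpoly_div_var => x x0; have := ZE h x; rewrite Zh meval0 => hx; rewrite [RHS]hx.
  by apply: meval_eq => i; rewrite mxE; case: eqP => // ->; exact: x0.
apply: (IH h'); apply: (@mulfI _ ('X_i0 : {mpoly k[b.+3]})); first exact: X0_neq0.
by rewrite mulrA -exprS e eh mulrA.
Qed.

(** Divisibility gives the ideal and also the point set: at a zero of [dual_form] every form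
    vanishing on the dual variety vanishes, and that variety is a closure. *)
Theorem hypersurface_form_dual_std_scroll : hypersurface_form (dual_variety std_scroll) dual_form.
Proof.
have key e f : f \is e.-homog -> vanishes_on f (dual_variety std_scroll) ->
  exists h, f = h * dual_form.
  by move=> hf fV; apply: dual_form_divides => y /dual_std_scroll_contains; apply: fV.
split=> //; first by exists (a + b)%N => //; exact: dual_form_homog.
- exact: dual_form_neq0.
move=> y; split=> [dy|[y0 fy]]; first by split; [case: dy | apply: dual_form_dual].
split=> // e f hf fV.
have [h ->] := key e f hf (zclosure_vanish hf fV).
by rewrite mevalM fy mulr0.
Qed.

(** * The gradient of the resultant *)

Implicit Types (D E F : {poly k}).

(* [phi (gradient dual_form y)] is the derivative at [y] in the direction of the
   last [b.+1] coordinates; on a regular fibre it determines the pencil member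
   [pA y], which kills it, and the values of [pC y] at the roots of [pA y]. *)
Definition phi z (E : {poly k}) : k := dot z (mk 0 0 E).

Lemma phiD z E F : phi z (E + F) = phi z E + phi z F.
Proof. by rewrite /phi -dotDr mkD !addr0. Qed.

Lemma phiZ z c E : phi z (c *: E) = c * phi z E.
Proof. by rewrite /phi -dotZr mkZ !mulr0. Qed.

Lemma phi_scale c z E : phi (c *: z) E = c * phi z E.
Proof. exact: dotZl. Qed.

Lemma phi_sum z (I : Type) (r : seq I) (G : I -> {poly k}) :
  phi z (\sum_(i <- r) G i) = \sum_(i <- r) phi z (G i).
Proof.
elim: r => [|i r IH]; last by rewrite !big_cons phiD IH.
by rewrite !big_nil /phi mk0 dotr0.
Qed.

Lemma dot_mk_phi z h0 h1 E : dot z (mk h0 h1 E) = z 0 i0 * h0 + z 0 i1 * h1 + phi z E.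
Proof. by rewrite /phi -{1 4}(mk_eta z) !dot_mk; ring. Qed.

Lemma dot_mk0 z h0 h1 : dot z (mk h0 h1 0) = z 0 i0 * h0 + z 0 i1 * h1.
Proof. by rewrite dot_mk_phi /phi mk0 dotr0 addr0. Qed.

Local Notation grad := (gradient dual_form).

Lemma deriv_prod_lines (rs : seq k) (c : k -> k) :
  (\prod_(r <- rs) (1 + c r *: 'X))^`().[0] = \sum_(r <- rs) c r.
Proof.
have h0 s : (\prod_(r <- s) (1 + c r *: 'X)).[0] = 1.
  by rewrite horner_prod big1 // => r _; rewrite hornerD hornerC hornerZ hornerX mulr0 addr0.
elim: rs => [|r rs IH]; first by rewrite !big_nil derivC horner0.
rewrite !big_cons derivM hornerD !hornerM IH h0 derivD derivZ derivX derivC.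
by rewrite add0r hornerD !hornerZ hornerX hornerC mulr0 addr0 !mulr1 mul1r.
Qed.

(** A logarithmic derivative: moving C to C + tE multiplies each factor C(r) of the product formula
    by [1 + t E(r) / C(r)]. *)
Lemma phi_grad_good y rs E : size rs = a -> uniq rs ->
  pA y = y 0 i0 *: \prod_(r <- rs) ('X - r%:P) -> dual_form.@[y 0] != 0 -> (size E <= b.+1)%N ->
  phi (grad y) E = dual_form.@[y 0] * \sum_(r <- rs) E.[r] / (pC y).[r].
Proof.
move=> srs urs e f0y sE.
pose c r := E.[r] / (pC y).[r].
have C0 r : r \in rs -> (pC y).[r] != 0.
  move=> rr; apply: contra f0y => /eqP Cr; apply/eqP/(dual_form_common_root _ Cr).
  by rewrite e hornerZ (rootP _) ?mulr0 // root_prod_XsubC.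
rewrite /phi (@gradient_line _ _ _ _ _ (dual_form.@[y 0] *: \prod_(r <- rs) (1 + c r *: 'X))).
  by rewrite derivZ hornerZ deriv_prod_lines.
move=> t; have e' : pA (y + t *: mk 0 0 E) = (y + t *: mk 0 0 E) 0 i0 *:
  \prod_(r <- rs) ('X - r%:P).
  by rewrite pA_add pA_scale pA_mk !scale0r addr0 scaler0 addr0 e !mxE /= mulr0 addr0.
rewrite (dual_form_good srs urs e') (dual_form_good srs urs e) !mxE /= mulr0 addr0 hornerZ -mulrA.
congr (_ * _); rewrite horner_prod -big_split /=.
rewrite big_seq [RHS]big_seq; apply: eq_bigr => r /C0 Cr.
rewrite pCD pCZ pC_mk // hornerD hornerZ hornerD hornerC hornerZ hornerX /c.
by field.
Qed.

Lemma size_mul_pencil (p D : {poly k}) :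
  (size p <= a.+1)%N -> (size D + a <= b.+1)%N -> (size (p * D)%R <= b.+1)%N.
Proof.
move=> sp sD; apply: (leq_trans (size_polyMleq _ _)); rewrite -subn1 leq_subLR.
by apply: (leq_trans (leq_add sp (leqnn _))); rewrite addSn addnC add1n ltnS.
Qed.

Lemma phi_grad_pA y D : (size D + a <= b.+1)%N -> phi (grad y) (pA y * D) = 0.
Proof.
move=> sD; rewrite /phi (@gradient_line _ _ _ _ _ (dual_form.@[y 0])%:P) ?derivC ?horner0 // => t.
rewrite hornerC !dual_formE pA_add pA_scale pA_mk !scale0r addr0 scaler0 addr0.
rewrite pCD pCZ pC_mk ?size_mul_pencil ?size_pA //.
by rewrite scalerAr res_addr // (leq_trans _ sD) // leq_add2r size_scale_leq.
Qed.

(** Scaling [h] alone multiplies the resultant by the power [b] of the scalar; this ties the h-part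
    of the gradient to the value of the form. *)
Lemma grad_euler y : dot (grad y) (mk (y 0 i0) (y 0 i1) 0) = b%:R * dual_form.@[y 0].
Proof.
rewrite (@gradient_line _ _ _ _ _ (dual_form.@[y 0] *: (1 + 'X) ^+ b)).
  rewrite derivZ hornerZ deriv_exp derivD derivC derivX add0r mul1r.
  rewrite hornerMn horner_exp hornerD hornerC hornerX addr0 expr1n.
  by rewrite mulrC mulr_natl.
move=> t; rewrite hornerZ horner_exp hornerD hornerC hornerX !dual_formE.
have -> : pA (y + t *: mk (y 0 i0) (y 0 i1) 0) = (1 + t) *: pA y.
  by rewrite pA_add pA_scale pA_mk scalerDl scale1r.
rewrite pCD pCZ pC_mk ?size_poly0 // scaler0 addr0 res_scale; exact: mulrC.
Qed.

(** At [h = 0] the form vanishes to order [b > 1], so these points lie outside the domain of the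
    polar map. *)
Lemma grad_degenerate y : y 0 i0 = 0 -> y 0 i1 = 0 -> grad y = 0.
Proof.
move=> y0 y1; apply: dot_ext => d; rewrite [RHS]dotC dotr0.
pose yd := mk (d 0 i0) (d 0 i1) (pC y); pose cd := mk 0 0 (pC d).
pose c i := (yd 0 i)%:P + cd 0 i *: 'X.
rewrite (@gradient_line _ _ _ _ _ ('X^b * curve_eval c dual_form)).
  rewrite derivM derivXn hornerD !hornerM hornerMn !hornerXn !expr0n.
  by rewrite -subn1 subn_eq0 leqNgt (leq_ltn_trans a_gt0 lt_ab) gtn_eqF // mul0rn !mul0r addr0.
move=> t; rewrite hornerM hornerXn curve_evalE.
have -> : dual_form.@[fun i => (c i).[t]] = dual_form.@[(yd + t *: cd) 0].
  apply: meval_eq => i; rewrite /c hornerD hornerC hornerZ hornerX mulrC.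
  by rewrite [RHS]mxE [X in _ = _ + X]mxE.
rewrite !dual_formE.
have -> : pA (y + t *: d) = t *: pA (yd + t *: cd).
  rewrite !pA_add !pA_scale !pA_mk !scale0r addr0 scaler0 addr0.
  by rewrite {1}/pA y0 y1 !scale0r addr0 add0r.
rewrite res_scale; congr (_ * res _ _ _ _); rewrite !pCD !pCZ !pC_mk ?size_pC //.
Qed.

(** Differentiate Res(A, C + A D) = Res(A, C) in [h] with D fixed: A also occurs in the second
    argument, so the direction acquires the C-part [(e0 alpha + e1 beta) D]. *)
Lemma grad_shift y D e0 e1 : (size D + a <= b.+1)%N ->
  dot (grad (y + mk 0 0 (pA y * D))) (mk e0 e1 ((e0 *: alpha + e1 *: beta) * D)) =
  dot (grad y) (mk e0 e1 0).
Proof.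
move=> sD.
pose c i := (y 0 i)%:P + mk e0 e1 0 0 i *: 'X.
have hc t : dual_form.@[(y + t *: mk e0 e1 0) 0] = (curve_eval c dual_form).[t].
  rewrite curve_evalE; apply: meval_eq => i.
  by rewrite /c !mxE hornerD hornerC hornerZ hornerX mulrC.
rewrite (gradient_line hc) (@gradient_line _ _ _ _ _ (curve_eval c dual_form)) // => t.
rewrite -hc !dual_formE.
have sA : (size (e0 *: alpha + e1 *: beta)%R <= a.+1)%N by rewrite -(pA_mk e0 e1 0) size_pA.
set u := mk e0 e1 ((_ + _) * D).
have -> : pA (y + mk 0 0 (pA y * D) + t *: u) = pA (y + t *: mk e0 e1 0).
  by rewrite !pA_add !pA_scale !pA_mk !scale0r !addr0.
rewrite !pCD !pCZ !pC_mk ?size_poly0 ?size_mul_pencil ?size_pA // scaler0 addr0.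
rewrite -addrA scalerAl -mulrDl -(pA_mk e0 e1 0) -pA_scale -pA_add.
by rewrite res_addr.
Qed.

Lemma grad_scale c y : c != 0 -> grad (c *: y) = c ^+ (a + b).-1 *: grad y.
Proof.
move=> c0; apply: dot_ext => d; rewrite dotZl.
pose l i := (y 0 i)%:P + d 0 i *: 'X.
have hl t : dual_form.@[(y + t *: d) 0] = (curve_eval l dual_form).[t].
  by rewrite curve_evalE; apply: meval_eq => i;
    rewrite /l !mxE hornerD hornerC hornerZ hornerX mulrC.
rewrite (gradient_line hl).
rewrite (@gradient_line _ _ _ _ _ (c ^+ (a + b) *: (curve_eval l dual_form \Po (c^-1 *: 'X)))).
  rewrite derivZ hornerZ deriv_comp hornerM horner_comp hornerZ hornerX mulr0.
  rewrite derivZ derivX hornerZ hornerC mulr1 -[in LHS](prednK ab_gt0) exprS.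
  by field.
move=> t; rewrite hornerZ horner_comp hornerZ hornerX -hl -(homog_eval _ _ dual_form_homog).
by congr (_.@[_ 0]); rewrite scalerDr scalerA mulrA divff // mul1r.
Qed.

(** * Fibres of the polar map *)

Definition cofactor_poly (rs : seq k) (r : k) : {poly k} := \prod_(r' <- rem r rs) ('X - r'%:P).

Local Notation M := cofactor_poly.

Lemma cofactor_polyE rs r : r \in rs -> \prod_(r' <- rs) ('X - r'%:P) = ('X - r%:P) * M rs r.
Proof. by move=> rr; rewrite (big_rem r rr). Qed.

Lemma size_cofactor_poly rs r : r \in rs -> size (M rs r) = size rs.
Proof.
by move=> rr; rewrite size_prod_XsubC size_rem // prednK //; case: rs rr.
Qed.

Lemma cofactor_poly_eq0 rs r r' : uniq rs -> r' \in rs -> ((M rs r).[r'] == 0) = (r' != r).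
Proof. by move=> urs rr; rewrite -/(root _ _) root_prod_XsubC mem_rem_uniq // !inE rr andbT. Qed.

Lemma lagrange rs E : uniq rs -> (size E <= size rs)%N ->
  E = \sum_(r <- rs) (E.[r] / (M rs r).[r]) *: M rs r.
Proof.
move=> urs sE; apply/eqP; rewrite -subr_eq0; apply/eqP.
apply: (@roots_geq_poly_eq0 _ _ rs) => //.
  apply/allP => r rr; apply/rootP; rewrite hornerD hornerN horner_sum.
  rewrite (big_rem r rr) /= hornerZ divfK ?cofactor_poly_eq0 ?eqxx //.
  rewrite big_seq big1 ?addr0 ?subrr // => r'; rewrite mem_rem_uniq // !inE => /andP[ne rr'].
  rewrite hornerZ; have /eqP -> : (M rs r').[r] == 0 by rewrite cofactor_poly_eq0 // eq_sym.
  by rewrite mulr0.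
apply: (leq_trans (size_polyD _ _)); rewrite geq_max sE size_polyN /=.
apply: (leq_trans (size_sum _ _ _)); rewrite big_seq.
elim/big_ind: _ => // [m n hm hn|r rr]; first by rewrite geq_max hm.
by rewrite (leq_trans (size_scale_leq _ _)) // size_cofactor_poly.
Qed.

(* If [z] is a gradient at [y] then [phi z] kills [pA y], so [y] has, up to a
   scalar, the first two coordinates of [pencil_coords z]. *)
Definition pencil_coords z : 'rV[k]_b.+3 := mk (phi z beta) (- phi z alpha) 0.

Lemma pencil_coords_scale c z : pencil_coords (c *: z) = c *: pencil_coords z.
Proof. by rewrite /pencil_coords mkZ scaler0 !phi_scale mulrN. Qed.

(* The value of [phi z], acting on polynomials in [Y], at (A(Y) - A(X)) / (Y - X),
   where [A = pA (pencil_coords z)]. *)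
Definition numerator z : {poly k} := \poly_(l < a)
  \sum_(i < a.+1) if (l < i)%N then (pA (pencil_coords z))`_i * phi z 'X^(i.-1 - l) else 0.

(** At a root [r] the difference quotient of A is [c] times the cofactor of [r]. One polynomial,
    quadratic in [z], thus records [phi z] on all the cofactors without naming the roots. *)
Lemma numerator_root z c rs r : uniq rs -> r \in rs ->
  pA (pencil_coords z) = c *: \prod_(r' <- rs) ('X - r'%:P) ->
    (numerator z).[r] = c * phi z (M rs r).
Proof.
move=> urs rr e; set A := pA (pencil_coords z) in e.
pose q := \sum_(i < a.+1) A`_i *: \sum_(l < i) r ^+ l *: 'X^(i.-1 - l).
have eq1 : ('X - r%:P) * q = A.
  rewrite mulr_sumr; transitivity (\sum_(i < a.+1) (A`_i *: 'X^i - (A`_i * r ^+ i)%:P)).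
    apply: eq_bigr => i _; rewrite -scalerAr.
    have -> : \sum_(l < i) r ^+ l *: 'X^(i.-1 - l) = \sum_(l < i) 'X^(i.-1 - l) * r%:P ^+ l.
      by apply: eq_bigr => l _; rewrite -rmorphXn /= mulrC mul_polyC.
    by rewrite -subrXX scalerBr -rmorphXn /= -!mul_polyC polyCM.
  rewrite big_split /= -poly_def sumrN -raddf_sum /= -(horner_coef_wide _ (size_pA _)) -/A.
  rewrite e hornerZ (rootP _) ?mulr0 ?subr0; last by rewrite root_prod_XsubC.
  rewrite -e; apply/polyP => i; rewrite coef_poly; case: ltnP => // ai.
  by rewrite nth_default // (leq_trans (size_pA _)).
have eq2 : q = c *: M rs r.
  apply: (@mulfI _ ('X - r%:P)); first by rewrite polyXsubC_eq0.
  by rewrite eq1 e (cofactor_polyE rr) scalerAr.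
rewrite -phiZ -eq2 phi_sum horner_poly.
under eq_bigr => l _ do rewrite mulr_suml.
rewrite exchange_big; apply: eq_bigr => i _ /=.
have ia : (i <= a)%N by rewrite -ltnS.
rewrite phiZ phi_sum (big_ord_widen a (fun l => phi z (r ^+ l *: 'X^(i.-1 - l))) ia).
rewrite mulr_sumr [RHS]big_mkcond; apply: eq_bigr => l _ /=.
by case: (l < i)%N; rewrite ?mul0r // phiZ /A; ring.
Qed.

(** The Euler pairing of [z] with the recovered [h]: by [grad_euler] it is, up to the scalar of the
    gradient, [b] times the value of the form at a preimage with these pencil coordinates. *)
Definition pencil_pairing z : k := z 0 i0 * phi z beta - z 0 i1 * phi z alpha.

(** The extra factor [phi z beta] makes all entries quadratic in [z], like [numerator], so that
    substitution into [dual_form] gives a form. *)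
Definition numerator_point z : 'rV[k]_b.+3 :=
  mk (phi z beta * phi z beta) (phi z beta * - phi z alpha) (numerator z).

(** The factors ask for a nonzero Euler pairing, for a pencil member with [a] distinct finite roots,
    and, through a resultant, for [phi z] nonzero on the cofactor of every root. *)
Definition bad_locus_value z : k :=
  pencil_pairing z * disc.@[(pencil_coords z) 0] * dual_form.@[(numerator_point z) 0].

Definition phiM (E : {poly k}) : {mpoly k[b.+3]} := linear_form (fun i => mk 0 0 E 0 i).

Lemma phiME E z : (phiM E).@[z 0] = phi z E.
Proof. by rewrite linear_form_dot dotC. Qed.

Definition bad_locus_form : {mpoly k[b.+3]} :=
  ('X_i0 * phiM beta - 'X_i1 * phiM alpha)
  * subst (fun i : 'I_b.+3 => if (i : nat) == 0%N then phiM beta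
       else if (i : nat) == 1%N then - phiM alpha else 0) disc
  * subst (fun i : 'I_b.+3 => if (i : nat) == 0%N then phiM beta * phiM beta
       else if (i : nat) == 1%N then phiM beta * - phiM alpha
       else if (b.+2 - i < a)%N then
         \sum_(j < a.+1) if (b.+2 - i < j)%N then
           (alpha`_j *: phiM beta - beta`_j *: phiM alpha) * phiM 'X^(j.-1 - (b.+2 - i)) else 0
       else 0) dual_form.

Lemma bad_locus_formE z : bad_locus_form.@[z 0] = bad_locus_value z.
Proof.
rewrite /bad_locus_form !mevalM mevalB !mevalM !mevalXU !phiME !substE /bad_locus_value.
congr (_ * _ * _); apply: meval_eq => i; rewrite !mxE.
  case: (_ == 0%N); first by rewrite phiME.
  by case: (_ == 1%N); rewrite ?mevalN ?phiME // meval0 coef0.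
case: (_ == 0%N); first by rewrite mevalM phiME.
case: (_ == 1%N); first by rewrite mevalM mevalN !phiME.
rewrite coef_poly; case: ifP => _; last by rewrite meval0.
rewrite raddf_sum; apply: eq_bigr => j _ /=; case: ifP => _; last by rewrite meval0.
rewrite mevalM mevalB !mevalZ !phiME; congr (_ * _).
by rewrite /pencil_coords pA_mk coefD !coefZ; ring.
Qed.

Lemma disc_scale c y : disc.@[(c *: y) 0] = c ^+ (a + b).+1 * disc.@[y 0].
Proof.
rewrite !discE pA_scale derivZ res_scale res_scaler mxE exprS exprD; ring.
Qed.

Lemma numerator_scale c z : numerator (c *: z) = c ^+ 2 *: numerator z.
Proof.
apply/polyP => l; rewrite coefZ !coef_poly; case: ifP => _; last by rewrite mulr0.
rewrite mulr_sumr; apply: eq_bigr => i _; case: ifP => _; last by rewrite mulr0.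
by rewrite pencil_coords_scale pA_scale coefZ phi_scale; ring.
Qed.

Lemma bad_locus_form_homog : exists d, bad_locus_form \is d.-homog.
Proof.
(* [pencil_pairing] is quadratic; [disc] has degree [a + b + 1] in coordinates linear in [z], and
   [dual_form] degree [a + b] in quadratic ones. *)
exists (2 + (a + b).+1 + 2 * (a + b))%N; apply: homog_of_eval => c z.
rewrite !bad_locus_formE /bad_locus_value pencil_coords_scale disc_scale.
have -> : numerator_point (c *: z) = c ^+ 2 *: numerator_point z.
  by rewrite /numerator_point mkZ numerator_scale !phi_scale; congr mk; ring.
rewrite (homog_eval _ _ dual_form_homog) -exprM 2!exprD.
have -> : pencil_pairing (c *:
  z) = c ^+ 2 * pencil_pairing z by rewrite /pencil_pairing !phi_scale !mxE; ring.
move: (pencil_pairing z) (disc.@[_]) (dual_form.@[_]) (c ^+ _) (c ^+ _) (c ^+ _) => u v w p q r.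
by ring.
Qed.

(** The first condition is closed and holds on the polar image; the second is open. *)
Definition regular z : Prop :=
  (forall D, (size D + a <= b.+1)%N ->
    phi z (pA (pencil_coords z) * D) = 0) /\ bad_locus_value z != 0.

Lemma regularP z : regular z ->
  [/\ phi z beta != 0, pencil_pairing z != 0, good (pencil_coords z) & forall r, (pA
    (pencil_coords z)).[r] = 0 -> (numerator z).[r] != 0].
Proof.
case=> _; rewrite /bad_locus_value !mulf_eq0 !negb_or -andbA => /and3P[h2 hd hf].
have gz : good (pencil_coords z) by apply/disc_good.
have z0 : phi z beta != 0 by case: gz; rewrite mk_i0.
split=> // r Ar; apply: contra hf => /eqP Br; apply/eqP.
have sB : (size (numerator z) <= b.+1)%N.
  by rewrite (leq_trans (size_poly _ _)) // ltnW // ltnW.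
apply: (@dual_form_common_root _ r); last by rewrite pC_mk.
have -> : pA (numerator_point z) = phi z beta *: pA (pencil_coords z).
  by rewrite /numerator_point /pencil_coords !pA_mk scalerDr !scalerA.
by rewrite hornerZ Ar mulr0.
Qed.

(** [phi z] factors through the quotient by A, where the cofactors of the roots form the Lagrange
    basis. *)
Lemma phi_lagrange z rs E :
  (forall D, (size D + a <= b.+1)%N -> phi z (pA (pencil_coords z) * D) = 0) ->
  size rs = a -> uniq rs -> phi z beta != 0 ->
  pA (pencil_coords z) = phi z beta *: \prod_(r <- rs) ('X - r%:P) -> (size E <= b.+1)%N ->
  phi z E = \sum_(r <- rs) E.[r] / (M rs r).[r] * phi z (M rs r).
Proof.
move=> hk srs urs z0 e sE; set A := pA (pencil_coords z) in hk e.
have sA : size A = a.+1 by rewrite e size_scale // size_prod_XsubC srs.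
have A0 : A != 0 by rewrite -size_poly_eq0 sA.
have Ar r : r \in rs -> A.[r] = 0.
  by move=> rr; rewrite e hornerZ (rootP _) ?mulr0 // root_prod_XsubC.
have eE := divp_eq E A; set D := (E %/ A)%R in eE; set R := (E %% A)%R in eE.
have sR : (size R <= a)%N by rewrite -ltnS -sA ltn_modp.
have sD : (size D + a <= b.+1)%N.
  rewrite size_divp // sA /=; move: (size E) sE (ltnW lt_ab) => n h1 h2.
  by rewrite addnC -maxnE geq_max h1 leqW.
have ER r : r \in rs -> E.[r] = R.[r].
  by move=> rr; rewrite eE hornerD hornerM Ar // mulr0 add0r.
rewrite {1}eE phiD mulrC hk // add0r {1}[R](lagrange urs) ?srs //.
rewrite phi_sum big_seq [RHS]big_seq; apply: eq_bigr => r rr.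
by rewrite phiZ ER.
Qed.

Lemma interpolation rs (v : k -> k) : uniq rs ->
  exists C : {poly k}, (size C <= size rs)%N /\ forall r, r \in rs -> C.[r] = v r.
Proof.
move=> urs; exists (\sum_(r <- rs) (v r / (M rs r).[r]) *: M rs r); split.
  apply: (leq_trans (size_sum _ _ _)); rewrite big_seq.
  elim/big_ind: _ => // [m n hm hn|r rr]; first by rewrite geq_max hm.
  by rewrite (leq_trans (size_scale_leq _ _)) // size_cofactor_poly.
move=> r rr; rewrite horner_sum (big_rem r rr) /= hornerZ divfK ?cofactor_poly_eq0 ?eqxx //.
rewrite big_seq big1 ?addr0 // => r'; rewrite mem_rem_uniq // !inE => /andP[ne rr'].
rewrite hornerZ; have /eqP -> : (M rs r').[r] == 0 by rewrite cofactor_poly_eq0 // eq_sym.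
by rewrite mulr0.
Qed.

Lemma dual_form_shift y D : (size D + a <= b.+1)%N ->
  dual_form.@[(y + mk 0 0 (pA y * D)) 0] = dual_form.@[y 0].
Proof.
move=> sD; rewrite !dual_formE pA_add pA_mk !scale0r !addr0 pCD pC_mk ?size_mul_pencil ?size_pA //.
by rewrite res_addr.
Qed.

(** The C-part of the gradient depends only on A, the value of the form and the C(r), which the
    shift preserves; the h-part moves by [phi] of alpha D and beta D. This is the source of the
    linear condition on D. *)
Lemma grad_shift_good y D e0 e1 E :
  good y -> dual_form.@[y 0] != 0 -> (size D + a <= b.+1)%N -> (size E <= b.+1)%N ->
  dot (grad (y + mk 0 0 (pA y * D))) (mk e0 e1 E) =
  dot (grad y) (mk e0 e1 E) - phi (grad y) ((e0 *: alpha + e1 *: beta) * D).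
Proof.
move=> gy fy sD sE; set y' := y + _.
have [rs [srs urs e]] := good_roots gy.
have eA : pA y' = pA y by rewrite pA_add pA_mk !scale0r !addr0.
have ei : y' 0 i0 = y 0 i0 by rewrite !mxE addr0.
have sAE : (size ((e0 *: alpha + e1 *: beta) * D)%R <= b.+1)%N.
  by rewrite size_mul_pencil // -(pA_mk e0 e1 0) size_pA.
have ephi F : (size F <= b.+1)%N -> phi (grad y') F = phi (grad y) F.
  move=> sF; have fy' : dual_form.@[y' 0] = dual_form.@[y 0] by apply: dual_form_shift.
  rewrite (phi_grad_good srs urs e fy sF) (phi_grad_good srs urs _ _ sF) ?fy' ?eA ?ei //.
  congr (_ * _); rewrite big_seq [RHS]big_seq; apply: eq_bigr => r rr.
  rewrite pCD pC_mk ?size_mul_pencil ?size_pA // hornerD hornerM (_ :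
    (pA y).[r] = 0) ?mul0r ?addr0 //.
  by rewrite e hornerZ (rootP _) ?mulr0 // root_prod_XsubC.
have -> : mk e0 e1 E = mk e0 e1 ((e0 *: alpha + e1 *: beta) * D)
    + mk 0 0 (E - (e0 *: alpha + e1 *: beta) * D) by rewrite mkD !addr0 addrC subrK.
have sub F : - F = (-1) *: F by rewrite scaleN1r.
rewrite dotDr grad_shift // -/(phi _ _) ephi; last first.
  by rewrite (leq_trans (size_polyD _ _)) // geq_max sE size_polyN.
by rewrite dotDr sub -/(phi _ _) !dot_mk_phi !phiD !phiZ /phi mk0 dotr0; ring.
Qed.

Lemma exists_fibre_point z : regular z -> exists (C : {poly k}) mu,
  [/\ (size C <= b.+1)%N, mu != 0, dual_form.@[(mk (phi z beta) (- phi z alpha) C) 0] != 0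
    & grad (mk (phi z beta) (- phi z alpha) C) = mu *: z].
Proof.
move=> rz; have [z0 g20 gz Bz0] := regularP rz; have [hk _] := rz.
have [rs [srs urs]] := good_roots gz; rewrite mk_i0 => e.
have Mr0 r : r \in rs -> (M rs r).[r] != 0 by move=> rr; rewrite cofactor_poly_eq0 ?eqxx.
have Ar r : r \in rs -> (pA (pencil_coords z)).[r] = 0.
  by move=> rr; rewrite e hornerZ (rootP _) ?mulr0 // root_prod_XsubC.
have pM0 r : r \in rs -> phi z (M rs r) != 0.
  by move=> rr; have := Bz0 r (Ar r rr);
    rewrite (numerator_root urs rr e) mulf_eq0 negb_or => /andP[].
have b0 : b%:R != 0 :> k by rewrite ((pcharf0P k).1 char0) -lt0n b_gt0.
(* The Euler relation forces [nu] to be the value of the form divided by [mu]; comparing [phi] on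
   the cofactors then prescribes C at each root. *)
pose nu := pencil_pairing z / b%:R; have nu0 : nu != 0 by rewrite mulf_neq0 ?invr_neq0.
have [C0 [sC0 hC0]] := interpolation (fun r => nu * (M rs r).[r] / phi z (M rs r)) urs.
have C00 r : r \in rs -> C0.[r] != 0.
  by move=> rr; rewrite hC0 // !mulf_neq0 ?invr_neq0 ?Mr0 ?pM0.
have sC0b : (size C0 <= b.+1)%N by rewrite (leq_trans sC0) // srs ltnW // ltnW.
pose x0 := mk (phi z beta) (- phi z alpha) C0.
have eA : pA x0 = pA (pencil_coords z) by rewrite !pA_mk.
have e0 : pA x0 = x0 0 i0 *: \prod_(r <- rs) ('X - r%:P) by rewrite eA e mk_i0.
have gx : good x0 by split; rewrite ?mk_i0 // eA; case: gz.
have fx : dual_form.@[x0 0] != 0.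
  rewrite (dual_form_good srs urs e0) mk_i0 mulf_neq0 ?expf_neq0 // prodf_seq_neq0.
  by apply/allP => r rr /=; rewrite pC_mk // C00.
pose mu := dual_form.@[x0 0] / nu; have mu0 : mu != 0 by rewrite mulf_neq0 ?invr_neq0.
have ephi E : (size E <= b.+1)%N -> phi (grad x0) E = mu * phi z E.
  move=> sE; rewrite (phi_grad_good srs urs e0 fx sE) (phi_lagrange hk srs urs z0 e sE).
  rewrite /mu -mulrA; congr (_ * _); rewrite mulr_sumr big_seq [RHS]big_seq.
  apply: eq_bigr => r rr; rewrite pC_mk // hC0 //.
  by have m0 := Mr0 r rr; have p0 := pM0 r rr; field; rewrite nu0 m0 p0.
have eul : (grad x0 0 i0 - mu * z 0 i0) * phi z beta = (grad x0 0 i1 - mu * z 0 i1) * phi z alpha.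
  have := grad_euler x0; rewrite dot_mk0 mk_i0 mk_i1 => h.
  have h2 : mu * pencil_pairing z = b%:R * dual_form.@[x0 0].
    by rewrite /mu /nu; field; rewrite g20 b0.
  apply/eqP; rewrite -subr_eq0; apply/eqP.
  transitivity (b%:R * dual_form.@[x0 0] - mu * pencil_pairing z); last by rewrite h2 subrr.
  by rewrite -h /pencil_pairing; ring.
(* By [eul] the remaining error in the h-part is proportional to [(phi z alpha, phi z beta)], which
   is what a shift by a constant D changes; [d] cancels it. *)
pose d := (grad x0 0 i1 - mu * z 0 i1) / phi z beta / mu.
have sd : (size d%:P + a <= b.+1)%N.
  by rewrite (leq_trans (leq_add (size_polyC_leq1 _) (leqnn a))) // add1n ltnS ltnW.
exists (C0 + pA x0 * d%:P), mu.
have -> : mk (phi z beta) (- phi z alpha) (C0 + pA x0 * d%:P) = x0 + mk 0 0 (pA x0 * d%:P).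
  by rewrite mkD !addr0.
have ssum : (size (C0 + pA x0 * d%:P)%R <= b.+1)%N.
  by rewrite (leq_trans (size_polyD _ _)) // geq_max sC0b size_mul_pencil // size_pA.
split=> //; first by rewrite dual_form_shift.
apply: dot_ext => v; rewrite -{1 2}(mk_eta v) grad_shift_good ?size_pC //.
rewrite dotZl !dot_mk_phi !ephi ?size_pC //; last first.
  by rewrite size_mul_pencil // -(pA_mk (v 0 i0) (v 0 i1) 0) size_pA.
rewrite -[_ * d%:P]mulrC mul_polyC phiZ phiD !phiZ.
have -> : grad x0 0 i0 = mu * z 0 i0 + mu * d * phi z alpha.
  apply: (mulIf z0); rewrite mulrDl -(mulrA (mu * d)) -[X in X = _](subrK (mu * z 0 i0 * phi z
    beta)).
  rewrite -mulrBl eul addrC; congr (_ + _); rewrite /d.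
  by field; rewrite mu0 z0.
have -> : grad x0 0 i1 = mu * z 0 i1 + mu * d * phi z beta.
  by rewrite /d; field; rewrite mu0 z0.
by ring.
Qed.

Lemma eqmx_row_scale n (u z : 'rV[k]_n) : z != 0 ->
  (u == z)%MS <-> exists mu, mu != 0 /\ u = mu *: z.
Proof.
move=> z0; split=> [/andP[/sub_rVP [mu eu] zu]|[mu [mu0 ->]]].
  exists mu; split=> //; apply/negP => /eqP m0.
  have e0 : u = 0 by rewrite eu m0 scale0r.
  by move: zu; rewrite e0 => /submx0null zz; rewrite zz eqxx in z0.
by apply/andP; split; [exact: scalemx_sub | rewrite (eqmx_scale _ mu0)].
Qed.

Lemma mem_polar_fibre z x : polar_fibre dual_form z x <->
  [/\ x != 0, z != 0 & exists mu, mu != 0 /\ grad x = mu *: z].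
Proof.
by split=> -[x0 z0 h]; split=> //; apply/(eqmx_row_scale (grad x) z0).
Qed.

Lemma polar_fibre_scale z x c : c != 0 -> polar_fibre dual_form z x ->
  polar_fibre dual_form z (c *: x).
Proof.
move=> c0 /mem_polar_fibre [x0 z0 [mu [mu0 e]]]; apply/mem_polar_fibre; split=> //.
  by rewrite scaler_eq0 negb_or c0.
exists (c ^+ (a + b).-1 * mu); rewrite mulf_neq0 ?expf_neq0 //.
by rewrite grad_scale // e scalerA.
Qed.

(** [phi] kills A itself, a linear relation that determines [(h_0 : h_1)]; and [h = 0] is excluded
    because the gradient vanishes there. *)
Lemma polar_fibre_proportional z x : phi z beta != 0 -> polar_fibre dual_form z x ->
  exists c, [/\ c != 0, x 0 i0 = c * phi z beta & x 0 i1 = c * - phi z alpha].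
Proof.
move=> pz /mem_polar_fibre [x0 z0 [mu [mu0 e]]].
have : phi (grad x) (pA x * 1) = 0 by rewrite phi_grad_pA // size_poly1 add1n ltnS ltnW.
rewrite mulr1 e phi_scale /pA phiD !phiZ => /eqP; rewrite mulf_eq0 (negPf mu0) /= => /eqP h.
have h0 : x 0 i0 = x 0 i0 / phi z beta * phi z beta by rewrite divfK.
have h1 : x 0 i1 = x 0 i0 / phi z beta * - phi z alpha.
  apply: (mulIf pz); apply/eqP; rewrite -subr_eq0; apply/eqP; rewrite -[RHS]h.
  by field.
exists (x 0 i0 / phi z beta); split=> //.
apply: contra z0 => /eqP c0; rewrite c0 mul0r in h0; rewrite c0 mul0r in h1.
have : grad x = 0 by exact: grad_degenerate.
by rewrite e => /eqP; rewrite scaler_eq0 (negPf mu0).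
Qed.

Lemma leq_size_quotient D : (size D + a <= b.+1)%N -> (size D <= (b - a).+1)%N.
Proof. by move: (size D) lt_ab => n; clear; lia. Qed.

Lemma phi_grad_cofactor y rs r : size rs = a -> uniq rs ->
  pA y = y 0 i0 *: \prod_(r <- rs) ('X - r%:P) -> dual_form.@[y 0] != 0 -> r \in rs ->
  phi (grad y) (M rs r) = dual_form.@[y 0] * ((M rs r).[r] / (pC y).[r]).
Proof.
move=> srs urs e fy rr; have sM : (size (M rs r) <= b.+1)%N.
  by rewrite size_cofactor_poly // srs ltnW // ltnW.
rewrite (phi_grad_good srs urs e fy sM) (big_rem r rr) /=.
rewrite big_seq big1 ?addr0 // => r'; rewrite mem_rem_uniq // !inE => /andP[ne rr'].
by have /eqP -> : (M rs r).[r'] == 0; rewrite ?mul0r // cofactor_poly_eq0.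
Qed.

(** * The fibre over a regular point *)

Section Fibre.

Variables (z : 'rV[k]_b.+3) (C : {poly k}) (mu : k).
Hypotheses (rz : regular z) (sC : (size C <= b.+1)%N) (mu0 : mu != 0).

Local Notation xs := (mk (phi z beta) (- phi z alpha) C).

Hypotheses (fx : dual_form.@[xs 0] != 0) (ex : grad xs = mu *: z).

Lemma regular_neq0 : z != 0.
Proof.
have [pz _ _ _] := regularP rz; apply: contra pz => /eqP ->.
by rewrite /phi dotC dotr0.
Qed.

Lemma good_xs : good xs.
Proof.
have [pz _ gz _] := regularP rz; split; first by rewrite mk_i0.
by case: gz; rewrite /pencil_coords !pA_mk.
Qed.

Lemma pencil_xs : pA xs = pA (pencil_coords z). Proof. by rewrite !pA_mk. Qed.

Lemma fibre_sup D c : c != 0 -> (size D + a <= b.+1)%N -> phi z (beta * D) = 0 ->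
  polar_fibre dual_form z (c *: (xs + mk 0 0 (pA xs * D))).
Proof.
move=> c0 sD hD; have [pz _ _ _] := regularP rz; apply: polar_fibre_scale => //.
(* [phi z] kills A D, and the coefficient [phi z beta] of alpha in A is nonzero, so the condition on
   beta D implies the one on alpha D. *)
have hD' : phi z (alpha * D) = 0.
  have [hk _] := rz; have := hk D sD; rewrite pA_mk mulrDl -!scalerAl phiD !phiZ hD mulr0 addr0.
  by move/eqP; rewrite mulf_eq0 (negPf pz) => /eqP.
apply/mem_polar_fibre; split; last first.
- exists mu; split=> //; apply: dot_ext => v; rewrite -(mk_eta v) grad_shift_good ?size_pC //.
    by rewrite ex phi_scale mulrDl -!scalerAl phiD !phiZ hD hD' !mulr0 addr0 mulr0 subr0.
  exact: good_xs.
- exact: regular_neq0.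
- apply/negP => /eqP /(congr1 (fun v : 'rV_b.+3 => v 0 i0)).
  by rewrite !mxE /= addr0 => /eqP; rewrite (negPf pz).
Qed.

Lemma fibre_sub x : polar_fibre dual_form z x -> exists c D,
  [/\ c != 0, (size D + a <= b.+1)%N, phi z (beta * D) = 0 & x = c *: (xs + mk 0 0 (pA xs * D))].
Proof.
move=> hx; have [pz g20 gz Bz0] := regularP rz.
have [c [c0 x0 x1]] := polar_fibre_proportional pz hx.
pose y := c^-1 *: x; have hy : polar_fibre dual_form z y by apply: polar_fibre_scale;
  rewrite ?invr_eq0.
have xy : x = c *: y by rewrite /y scalerA divff // scale1r.
suff [D [sD hD ey]] : exists D, [/\ (size D + a <= b.+1)%N, phi z (beta * D) = 0
    & y = xs + mk 0 0 (pA xs * D)].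
  by exists c, D; split=> //; rewrite xy ey.
have y0 : y 0 i0 = phi z beta by rewrite mxE x0 mulKf.
have y1 : y 0 i1 = - phi z alpha by rewrite mxE x1 mulKf.
move: hy => /mem_polar_fibre [ny nz [nu [nu0 ey]]] {hx x0 x1 xy}.
have b0 : b%:R != 0 :> k by rewrite ((pcharf0P k).1 char0) -lt0n b_gt0.
(* Both points have the same [h], so Euler's relation gives the same ratio of gradient scalar to
   value of the form; hence C takes equal values at the roots. *)
have eu : mu * pencil_pairing z = b%:R * dual_form.@[xs 0].
  by rewrite -grad_euler ex dotZl dot_mk0 mk_i0 mk_i1 /pencil_pairing; ring.
have euy : nu * pencil_pairing z = b%:R * dual_form.@[y 0].
  by rewrite -grad_euler ey dotZl dot_mk0 y0 y1 /pencil_pairing; ring.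
have fy : dual_form.@[y 0] != 0.
  apply/negP => /eqP e; move/eqP: euy; rewrite e mulr0 mulf_eq0.
  by rewrite (negPf nu0) (negPf g20).
have [rs [srs urs e]] := good_roots gz; rewrite mk_i0 in e.
have eAx : pA xs = xs 0 i0 *: \prod_(r <- rs) ('X - r%:P) by rewrite pencil_xs mk_i0 e.
have eAyx : pA y = pA xs by rewrite /pA y0 y1 mk_i0 mk_i1.
have eAy : pA y = y 0 i0 *: \prod_(r <- rs) ('X - r%:P) by rewrite eAyx eAx mk_i0 y0.
have root_nz (v : 'rV[k]_b.+3) r : dual_form.@[v 0] != 0 ->
  pA v = v 0 i0 *: \prod_(r <- rs) ('X - r%:P) ->
    r \in rs -> (pC v).[r] != 0.
  move=> fv ev rr; apply: contra fv => /eqP Cr; apply/eqP; apply: dual_form_common_root Cr.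
  by rewrite ev hornerZ (rootP _) ?mulr0 // root_prod_XsubC.
have eC r : r \in rs -> (pC y).[r] = C.[r].
  move=> rr; have hx := phi_grad_cofactor srs urs eAx fx rr;
    have hy := phi_grad_cofactor srs urs eAy fy rr.
  have Cy := root_nz y r fy eAy rr; have Cx := root_nz xs r fx eAx rr.
  rewrite ex phi_scale pC_mk // in hx Cx; rewrite ey phi_scale in hy.
  have Mr : (M rs r).[r] != 0 by rewrite cofactor_poly_eq0 ?eqxx.
  have pM : phi z (M rs r) = pencil_pairing z / b%:R * ((M rs r).[r] / C.[r]).
    apply: (mulfI mu0); rewrite hx [RHS]mulrA; congr (_ * _); apply: (mulfI b0).
    by rewrite -eu; field.
  have pM' : phi z (M rs r) = pencil_pairing z / b%:R * ((M rs r).[r] / (pC y).[r]).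
    apply: (mulfI nu0); rewrite hy [RHS]mulrA; congr (_ * _); apply: (mulfI b0).
    by rewrite -euy; field.
  have gb : pencil_pairing z / b%:R != 0 by rewrite mulf_neq0 ?invr_neq0.
  by move: pM'; rewrite pM => /(mulfI gb) /(mulfI Mr) /invr_inj ->.
have nAx : pA xs != 0.
  by have [nz' _] := good_xs; apply: contra nz' => /eqP h; rewrite -coef_pA_a h coef0.
have sAx : size (pA xs) = a.+1.
  by rewrite eAx size_scale ?mk_i0 // size_prod_XsubC srs.
have dvd : pA xs %| pC y - C.
  rewrite eAx dvdpZl ?mk_i0 //; apply: uniq_roots_dvdp; last by rewrite uniq_rootsE.
  by apply/allP => r rr; rewrite /root hornerD hornerN eC // subrr.
pose D := ((pC y - C) %/ pA xs)%R.
have eD : pC y - C = pA xs * D by rewrite mulrC divpK.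
have sD : (size D + a <= b.+1)%N.
  have s1 : (size (pC y - C)%R <= b.+1)%N.
    by rewrite (leq_trans (size_polyD _ _)) // geq_max size_pC size_polyN.
  rewrite size_divp // sAx /=; move: (size _) s1 (ltnW lt_ab) => n h1 h2.
  by rewrite addnC -maxnE geq_max h1 leqW.
have ys : y = xs + mk 0 0 (pA xs * D).
  by rewrite mkD !addr0 -eD addrCA subrr addr0 -y0 -y1 mk_eta.
exists D; split=> //.
have fyx : dual_form.@[y 0] = dual_form.@[xs 0] by rewrite ys dual_form_shift.
have numu : nu = mu by apply: (mulIf g20); rewrite euy fyx eu.
(* Both gradients are now [mu *: z], so the direction [(0, 1)] isolates [phi z (beta * D)]. *)
have := grad_shift xs 0 1 sD; rewrite -ys ey ex numu !dotZl scale0r add0r scale1r.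
move/(mulfI mu0); rewrite !dot_mk_phi [phi z 0]/phi mk0 dotr0 addr0 => h.
by apply: (addrI (z 0 i0 * 0 + z 0 i1 * 1)); rewrite h addr0.
Qed.

Let theta i := phi z (beta * 'X^i).

(** For i = 1, ..., b - a these form a basis of the admissible D: the constant term is solved from
    [phi z (beta * D) = 0], as [phi z beta] is nonzero. *)
Let Dbase i : {poly k} := 'X^i - (theta i / phi z beta)%:P.

Let W : 'M[k]_((b - a).+1, b.+3) :=
  \matrix_(i < (b - a).+1) if (i : nat) == 0%N then xs else mk 0 0 (pA xs * Dbase i).

Let Dcomb (v : 'rV[k]_(b - a).+1) : {poly k} :=
  \sum_(i < b - a) v 0 (lift ord0 i) *: Dbase i.+1.

Let mul_W v : v *m W = v 0 ord0 *: xs + mk 0 0 (pA xs * Dcomb v).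
Proof.
rewrite mulmx_sum_row big_ord_recl rowK /=; congr (_ + _).
have -> : mk 0 0 (pA xs * Dcomb v) =
    \sum_(i < b - a) v 0 (lift ord0 i) *: mk 0 0 (pA xs * Dbase i.+1).
  rewrite mulr_sumr; elim/big_ind2: _ => [|p1 u1 p2 u2 h1 h2|i _]; first exact: mk0.
    by rewrite -h1 -h2 mkD !addr0.
  by rewrite mkZ !mulr0 scalerAr.
by apply: eq_bigr => i _; rewrite rowK.
Qed.

Let size_Dcomb v : (size (Dcomb v) + a <= b.+1)%N.
Proof.
rewrite addnC -leq_subRL; last by rewrite ltnW // ltnW.
rewrite subSn; last exact: ltnW.
apply: (leq_trans (size_sum _ _ _)); apply/bigmax_leqP => i _.
apply: (leq_trans (size_scale_leq _ _)); apply: (leq_trans (size_polyD _ _)).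
rewrite geq_max size_polyXn size_polyN (leq_trans (size_polyC_leq1 _)) //.
by rewrite ltnS ltn_ord.
Qed.

Let theta_Dcomb v : phi z (beta * Dcomb v) = 0.
Proof.
have [pz _ _ _] := regularP rz.
rewrite mulr_sumr phi_sum big1 // => i _; rewrite -scalerAr phiZ mulrBr phiD.
rewrite -[beta * _%:P]mulrC mul_polyC -scaleN1r !phiZ /theta divfK //.
by rewrite mulN1r subrr mulr0.
Qed.

Let Dcomb_surj D : (size D + a <= b.+1)%N -> phi z (beta * D) = 0 ->
  exists2 v : 'rV_(b - a).+1, v 0 ord0 = 1 & D = Dcomb v.
Proof.
have [pz _ _ _] := regularP rz; move=> sD hD.
have sD' := leq_size_quotient sD.
pose v : 'rV_(b - a).+1 := \row_i if i == ord0 then 1 else D`_i.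
exists v; first by rewrite mxE eqxx.
have eD : D = \sum_(i < (b - a).+1) D`_i *: 'X^i.
  by rewrite -poly_def; apply/polyP => i; rewrite coef_poly; case: ltnP => // h;
    rewrite nth_default // (leq_trans sD').
have e1 : D`_0 * phi z beta + \sum_(i < b - a) D`_i.+1 * theta i.+1 = 0.
  have h2 := hD; rewrite eD mulr_sumr phi_sum big_ord_recl in h2.
  rewrite -[RHS]h2; congr (_ + _).
    by rewrite -scalerAr phiZ expr0 mulr1.
  by apply: eq_bigr => i _; rewrite -scalerAr phiZ.
have vS (i : 'I_(b - a)) : v 0 (lift ord0 i) = D`_i.+1 by rewrite mxE.
rewrite {1}eD big_ord_recl /Dcomb.
under [RHS]eq_bigr => i _ do rewrite vS scalerBr.
rewrite big_split /= addrC; congr (_ + _).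
transitivity ((- (\sum_(i < b - a) D`_i.+1 * theta i.+1) / phi z beta)%:P); last first.
  rewrite mulNr mulr_suml polyCN raddf_sum -sumrN; apply: eq_bigr => i _ /=.
  by rewrite -mul_polyC -polyCM mulrA.
rewrite expr0 alg_polyC; congr (_%:P); apply: (mulIf pz); rewrite divfK //.
by apply/eqP; rewrite -addr_eq0 e1.
Qed.

(** The coordinate [v 0 ord0] is the scaling factor, so the fibre is a linear space minus a
    hyperplane, and a closure must be taken. *)
Lemma fibreP x : polar_fibre dual_form z x <->
  exists v : 'rV_(b - a).+1, v 0 ord0 != 0 /\ x = v *m W.
Proof.
split=> [/fibre_sub [c [D [c0 sD hD ->]]]|[v [v0 ->]]].
  have [v v1 eD] := Dcomb_surj sD hD; exists (c *: v).
  by rewrite mxE v1 mulr1 c0 -scalemxAl mul_W v1 scale1r -eD.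
pose w := (v 0 ord0)^-1 *: v.
have -> : v = v 0 ord0 *: w by rewrite scalerA divff // scale1r.
have w1 : w 0 ord0 = 1 by rewrite mxE mulVf.
rewrite -scalemxAl mul_W w1 scale1r; exact: fibre_sup.
Qed.

Lemma row_free_W : row_free W.
Proof.
have [pz _ _ _] := regularP rz.
have nAx : pA xs != 0.
  by have [nz' _] := good_xs; apply: contra nz' => /eqP h; rewrite -coef_pA_a h coef0.
rewrite -kermx_eq0; apply/eqP/row_matrixP => i; rewrite row0.
have : row i (kermx W) *m W = 0 by rewrite -row_mul mulmx_ker row0.
set v := row i _; rewrite mul_W => e.
have v0 : v 0 ord0 = 0.
  have := congr1 (fun u : 'rV_b.+3 => u 0 i0) e; rewrite !mxE /= addr0 => /eqP.
  by rewrite mulf_eq0 (negPf pz) orbF => /eqP.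
have D0 : Dcomb v = 0.
  move: e; rewrite v0 scale0r add0r => /(congr1 (@pC k b)).
  rewrite pC_mk ?size_mul_pencil ?size_pA ?size_Dcomb // -mk0 pC_mk ?size_poly0 //.
  by move/eqP; rewrite mulf_eq0 (negPf nAx) => /eqP.
apply/rowP => j; rewrite [RHS]mxE; case: (unliftP ord0 j) => [l ->|->] //.
have := congr1 (fun p : {poly k} => p`_l.+1) D0; rewrite coef0 coef_sum => h; rewrite -[RHS]h.
rewrite (bigD1 l) //= big1 ?addr0 => [|m ne].
  by rewrite coefZ coefB coefXn coefC eqxx subr0 mulr1.
rewrite coefZ coefB coefXn coefC eqSS; case: eqP => [lm|_]; last by rewrite subr0 mulr0.
by case/eqP: ne; apply: val_inj.
Qed.

Lemma linear_fibre : linear_subspace (b - a) (zclosure (polar_fibre dual_form z)).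
Proof.
exists W; split=> [|x]; first exact: row_free_W.
split=> [hx|[x0 /submxP [v ev]]].
  have : zclosure (row_space W) x.
    apply: zclosureS hx => y /fibreP [v [v0 ey]]; split; last by rewrite ey submxMl.
    rewrite ey -[X in _ != X](mul0mx _ W) (inj_eq (row_free_inj row_free_W)).
    by apply: contra v0 => /eqP ->; rewrite mxE.
  by move/zclosed_row_space.
split=> // e f hf fV.
(* The line through [x] in the direction [xs] meets the removed hyperplane for a single value of the
   parameter. *)
pose l i := (x 0 i)%:P + xs 0 i *: 'X.
have hl t : (curve_eval l f).[t] = f.@[((v + t *: delta_mx 0 ord0) *m W) 0].
  rewrite curve_evalE; apply: meval_eq => i.
  rewrite /l hornerD hornerC hornerZ hornerX mulmxDl -ev -scalemxAl -rowE rowK /=.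
  by rewrite [RHS]mxE; congr (_ + _); rewrite [RHS]mxE mulrC.
have l0 : curve_eval l f = 0.
  apply: (@poly_ext_generic _ _ _ ((v 0 ord0)%:P + 'X)).
    by rewrite addrC -size_poly_eq0 size_XaddC.
  move=> t; rewrite hornerD hornerC hornerX => nz; rewrite horner0 hl; apply: fV.
  by apply/fibreP; eexists; split; last reflexivity; rewrite !mxE eqxx mulr1.
by have := hl 0; rewrite l0 horner0 scale0r addr0 -ev.
Qed.

End Fibre.

(** With A expressed by [z] itself, the vanishing of [phi z] on A X^i is a quadratic equation in
    [z], so it passes from the image to its closure. *)
Lemma regular_of_closure z : zclosure (polar_image dual_form) z -> bad_locus_value z != 0 ->
  regular z.
Proof.
case=> _ hz gz; split=> // D sD.
have sD' := leq_size_quotient sD.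
have -> : D = \sum_(i < (b - a).+1) D`_i *: 'X^i.
  rewrite -poly_def; apply/polyP => i; rewrite coef_poly; case: ltnP => // h.
  by rewrite nth_default // (leq_trans sD').
rewrite mulr_sumr phi_sum big1 // => i _; rewrite -scalerAr phiZ.
pose F := phiM beta * phiM (alpha * 'X^i) - phiM alpha * phiM (beta * 'X^i).
have FE (u : 'rV[k]_b.+3) : F.@[u 0] = phi u (pA (pencil_coords u) * 'X^i).
  by rewrite mevalB !mevalM !phiME pA_mk mulrDl -!scalerAl phiD !phiZ; ring.
have hF : F \is 2.-homog.
  by apply: homog_of_eval => c u;
    rewrite !FE pencil_coords_scale pA_scale phi_scale -scalerAl phiZ; ring.
rewrite -FE (hz _ _ hF) ?mulr0 // => u [x /mem_polar_fibre [x0 u0 [mu [mu0 e]]]].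
have rel (E : {poly k}) : (size E + a <= b.+1)%N ->
  x 0 i0 * phi u (alpha * E) + x 0 i1 * phi u (beta * E) = 0.
  move=> sE; apply: (mulfI mu0); rewrite mulr0 -(phi_grad_pA x sE) e phi_scale /pA.
  by rewrite mulrDl -!scalerAl phiD !phiZ.
have r0 := rel 1; have ri := rel 'X^i.
rewrite !mulr1 size_poly1 add1n ltnS ltnW // in r0; have {}r0 := r0 isT.
have si : (size ('X^i : {poly k}) + a <= b.+1)%N.
  by rewrite size_polyXn addSn ltnS addnC -leq_subRL ?(ltnW lt_ab) // -ltnS.
have {}ri := ri si.
(* On the image, [(x_0, x_1)] is a nonzero solution of the linear relations [r0] and [ri], whose
   determinant is [F] up to sign. *)
have xn : (x 0 i0 != 0) || (x 0 i1 != 0).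
  rewrite -negb_and; apply/negP => /andP[/eqP h0 /eqP h1].
  have := grad_degenerate h0 h1; rewrite e => /eqP.
  by rewrite scaler_eq0 (negPf mu0) (negPf u0).
rewrite mevalB !mevalM !phiME.
move: (phi u alpha) (phi u beta) (phi u (alpha * 'X^i)) (phi u (beta * 'X^i)) r0 ri =>
  p q r s r0 ri.
case/orP: xn => nx; apply: (mulfI nx); rewrite mulr0.
  transitivity (q * (x 0 i0 * r + x 0 i1 * s) - s * (x 0 i0 * p + x 0 i1 * q)); first by ring.
  by rewrite r0 ri !mulr0 subrr.
transitivity (r * (x 0 i0 * p + x 0 i1 * q) - p * (x 0 i0 * r + x 0 i1 * s)); first by ring.
by rewrite r0 ri !mulr0 subrr.
Qed.

(* At [x = (1, c, beta)] the roots [r] of the pencil member satisfy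
   [alpha r = - c * beta r], so [phi] takes the value [a * dual_form x] at [beta]. *)
Lemma exists_regular_image : exists z, polar_image dual_form z /\ bad_locus_value z != 0.
Proof.
have [c hc] := exists_good; pose x := mk 1 c beta; exists (grad x).
have gx : good x := hc beta.
have [rs [srs urs e]] := good_roots gx; set z := grad x.
have sb : (size beta <= b.+1)%N by rewrite (leq_trans sbeta) // ltnW // ltnW.
have sal : (size alpha <= b.+1)%N by rewrite salpha ltnW.
have Cx : pC x = beta by rewrite pC_mk.
have eA : pA x = alpha + c *: beta by rewrite pA_mk scale1r.
have al r : r \in rs -> alpha.[r] = - c * beta.[r].
  move=> rr; have : (pA x).[r] = 0 by rewrite e hornerZ (rootP _) ?mulr0 // root_prod_XsubC.
  by rewrite eA hornerD hornerZ => /eqP; rewrite addr_eq0 mulNr => /eqP.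
have be r : r \in rs -> beta.[r] != 0.
  move=> rr; apply/negP => /eqP h; apply: (@no_common_root r) => //.
  by rewrite al // h mulr0.
have fx : dual_form.@[x 0] != 0.
  rewrite (dual_form_good srs urs e) mk_i0 expr1n mul1r Cx prodf_seq_neq0.
  by apply/allP => r /be.
have nata (n : nat) : (0 < n)%N -> n%:R != 0 :> k.
  by move=> n0; rewrite ((pcharf0P k).1 char0) -lt0n.
have sum1 : \sum_(r <- rs) (1 : k) = a%:R.
  by rewrite big_const_seq count_predT srs iter_addr_0.
pose w := dual_form.@[x 0] * a%:R; have w0 : w != 0 by rewrite mulf_neq0 ?nata.
have pb : phi z beta = w.
  rewrite (phi_grad_good srs urs e fx sb) Cx /w -sum1; congr (_ * _).
  by rewrite big_seq [RHS]big_seq; apply: eq_bigr => r /be br; rewrite divff.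
have pa : phi z alpha = - c * w.
  rewrite (phi_grad_good srs urs e fx sal) Cx /w -sum1 mulrCA; congr (_ * _).
  rewrite mulr_sumr big_seq [RHS]big_seq; apply: eq_bigr => r rr.
  by rewrite al // mulfK ?be // mulr1.
have eh : pA (pencil_coords z) = w *: pA x.
  by rewrite /pencil_coords !pA_mk pa pb scalerDr scale1r scalerA mulNr opprK mulrC.
have ehr : pA (pencil_coords z) = w *: \prod_(r <- rs) ('X - r%:P) by rewrite eh e mk_i0 scale1r.
split.
  exists x; apply/mem_polar_fibre; split.
  - by apply/negP => /eqP /(congr1 (fun v : 'rV_b.+3 => v 0 i0)) /eqP; rewrite !mxE oner_eq0.
  - by apply: contra w0 => /eqP h; rewrite -pb h /phi dotC dotr0.
  - by exists 1; rewrite oner_eq0 scale1r.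
rewrite /bad_locus_value !mulf_neq0 //.
- have := grad_euler x; rewrite dot_mk0 mk_i0 mk_i1 -/z => h.
  have -> : pencil_pairing z = w * (b%:R * dual_form.@[x 0]) by rewrite -h /pencil_pairing pa
    pb; ring.
  by rewrite !mulf_neq0 // nata.
- apply/disc_good; split; first by rewrite mk_i0 pb.
  by rewrite eh (eqp_separable (eqp_scale _ w0)); case: gx.
have eg : pA (numerator_point z) = (numerator_point z) 0 i0 *: \prod_(r <- rs) ('X - r%:P).
  by rewrite /numerator_point pA_mk mk_i0 -!scalerA -scalerDr -(pA_mk _ _ 0) ehr pb scalerA.
rewrite (dual_form_good srs urs eg) mk_i0 pb; apply: mulf_neq0.
  by rewrite expf_neq0 // mulf_neq0.
rewrite prodf_seq_neq0; apply/allP => r rr /=.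
rewrite pC_mk; last by rewrite (leq_trans (size_poly _ _)) // ltnW // ltnW.
rewrite (numerator_root urs rr ehr) mulf_neq0 // (phi_grad_cofactor srs urs e fx rr) Cx.
by rewrite !mulf_neq0 ?invr_neq0 ?be // cofactor_poly_eq0 // eqxx.
Qed.

Lemma polar_fibre_form_scale c z : c != 0 ->
  polar_fibre (c *: dual_form) z = polar_fibre dual_form z.
Proof.
move=> c0; apply: pset_ext => x; rewrite /polar_fibre.
have -> : gradient (c *: dual_form) x = c *: grad x.
  by apply/rowP => i; rewrite !mxE mderivZ mevalZ.
by split=> -[x0 z0 /eqmxP h]; split=> //; apply/eqmxP => //;
  [apply: eqmx_trans h; apply: eqmx_sym | apply: eqmx_trans h]; apply: eqmx_scale.
Qed.

Lemma hypersurface_form_unique f : hypersurface_form (dual_variety std_scroll) f ->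
  exists c, c != 0 /\ f = c *: dual_form.
Proof.
have [[d d0 hd] n0 V0 I0] := hypersurface_form_dual_std_scroll.
move=> [[d' d'0 hd'] n1 V1 I1].
have [h eh] : exists h, f = h * dual_form by apply: I0 hd' _ => x /V1 [].
have [h' eh'] : exists h', dual_form = h' * f by apply: I1 hd _ => x /V0 [].
have hh : h' * h = 1.
  by apply: (mulIf n0); rewrite mul1r -mulrA -eh -eh'.
have /andP[/eqP ehc] := mpoly_intro_unit hh.
rewrite unitfE => c0; exists (h@_0); split=> //.
by rewrite eh {1}ehc mul_mpolyC.
Qed.

Theorem general_fibre_std_scroll f : hypersurface_form (dual_variety std_scroll) f ->
  general_point (zclosure (polar_image f))
    (fun z => linear_subspace (b - a) (zclosure (polar_fibre f z))).
Proof.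
case/hypersurface_form_unique => c [c0 ->].
have -> : polar_image (c *: dual_form) = polar_image dual_form.
  by apply: pset_ext => z; rewrite /polar_image polar_fibre_form_scale.
have [d hG] := bad_locus_form_homog.
exists (zero_locus bad_locus_form); split; first exact: zclosed_zero_locus hG.
  have [z [iz gz]] := exists_regular_image; move=> h.
  have [_] : zero_locus bad_locus_form z.
    by apply: h; apply: sub_zclosure => //; case: iz => x [].
  by rewrite bad_locus_formE => /eqP; rewrite (negPf gz).
move=> z hz nz; rewrite polar_fibre_form_scale //.
have gz : bad_locus_value z != 0.
  apply/negP => /eqP e; apply: nz; split; first by case: hz.
  by rewrite bad_locus_formE.
have rz := regular_of_closure hz gz.
have [C [mu [sC mu0 fx ex]]] := exists_fibre_point rz.
exact: linear_fibre rz sC mu0 fx ex.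
Qed.

End StandardScroll.

(** * The projected scroll *)

(** The conclusion for one surface, isolated because it is invariant under linear changes of
    coordinates. *)
Definition polar_fibres_linear (k : closedFieldType) n d (X : pset k n) : Prop :=
  (exists f : {mpoly k[n]}, hypersurface_form (dual_variety X) f) /\
  (forall f : {mpoly k[n]}, hypersurface_form (dual_variety X) f ->
     general_point (zclosure (polar_image f)) (fun z =>
       linear_subspace d (zclosure (polar_fibre f z)))).

Lemma polar_fibres_linear_pullback (k : closedFieldType) n d (X : pset k n) (H : 'M[k]_n) :
  H \in unitmx -> polar_fibres_linear d X -> polar_fibres_linear d (pullback H X).
Proof.
move=> uH [[f0 hf0] hX]; rewrite /polar_fibres_linear dual_variety_pullback //.
set K := (invmx H)^T; have uK : K \in unitmx by rewrite unitmx_tr unitmx_inv.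
split; first by exists (lsubst K f0); apply/hypersurface_form_pullback => //; rewrite lsubstVK.
move=> f /(hypersurface_form_pullback _ _ uK); set g := lsubst (invmx K) f => hg.
have ef : f = lsubst K g by rewrite lsubstK.
pose J := (invmx K)^T; have uJ : J \in unitmx by rewrite unitmx_tr unitmx_inv.
have -> : polar_image f = pullback J (polar_image g).
  apply: pset_ext => z; rewrite ef /polar_image /pullback; split=> [[x]|[x hx]].
    by rewrite polar_fibre_pullback // => hx; exists (x *m K).
  by exists (x *m invmx K); rewrite polar_fibre_pullback // /pullback mulmxKV.
rewrite zclosure_pullback //; apply: general_point_pullback => //.
have [C [cC nC hC]] := hX g hg; exists C; split=> // z hz nz.
rewrite ef polar_fibre_pullback // mulmxKV // zclosure_pullback //.
by apply: linear_subspace_pullback => //; apply: hC.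
Qed.

(** * Equations of a general centre *)

Section CentreEquations.

Variables (a' : nat).
Local Notation a := a'.+1.

(** Columns 1 to a - 1 of the first block, square because the centre has a - 1 rows; columns 0 and a
    serve as right-hand sides. *)
Definition mid_block (R : comNzRingType) m (L : 'M[R]_(a', a.+1 + m)) : 'M[R]_a' :=
  \matrix_(i, j) L i (lshift m (lift ord0 (widen_ord (leqnSn a') j))).

Definition end_column (R : comNzRingType) m (j : 'I_a.+1) (L : 'M[R]_(a', a.+1 + m)) : 'cV[R]_a' :=
  \col_i L i (lshift m j).

(* By Cramer's rule, two independent polynomials of degree at most [a] whose
   coefficient vectors are orthogonal to the rows of the first block of [L]. *)
Definition centre_alpha (R : comNzRingType) m (L : 'M[R]_(a', a.+1 + m)) : {poly R} :=
  \det (mid_block L) *: 'X^a - rVpoly (\adj (mid_block L) *m end_column ord_max L)^T * 'X.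

Definition centre_beta (R : comNzRingType) m (L : 'M[R]_(a', a.+1 + m)) : {poly R} :=
  (\det (mid_block L))%:P - rVpoly (\adj (mid_block L) *m end_column ord0 L)^T * 'X.

(** Its nonvanishing makes alpha and beta coprime. Beta comes first because [res_neq0] asks for
    exact degree in the second argument. *)
Definition centre_res (R : comNzRingType) m (L : 'M[R]_(a', a.+1 + m)) : R :=
  res a a (centre_beta L) (centre_alpha L).

Section Map.

Variables (R S : comNzRingType) (f : {rmorphism R -> S}) (m : nat) (L : 'M[R]_(a', a.+1 + m)).

Lemma map_mid_block : map_mx f (mid_block L) = mid_block (map_mx f L).
Proof. by apply/matrixP => i j; rewrite !mxE. Qed.

Lemma map_end_column j : map_mx f (end_column j L) = end_column j (map_mx f L).
Proof. by apply/matrixP => i l; rewrite !mxE. Qed.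

Lemma map_centre_res : f (centre_res L) = centre_res (map_mx f L).
Proof.
rewrite /centre_res map_res; congr res; rewrite /centre_alpha /centre_beta rmorphB rmorphM /=.
  rewrite map_polyX map_polyC /= -det_map_mx map_mid_block map_rVpoly -map_trmx map_mxM.
  by rewrite map_mx_adj map_mid_block map_end_column.
rewrite map_polyX map_polyZ map_polyXn -det_map_mx map_mid_block map_rVpoly -map_trmx map_mxM.
by rewrite map_mx_adj map_mid_block map_end_column.
Qed.

End Map.

Variables (k : closedFieldType) (m : nat) (L : 'M[k]_(a', a.+1 + m)).

Let d := \det (mid_block L).

Lemma centre_alpha0 : (centre_alpha L)`_0 = 0.
Proof. by rewrite coefB coefZ coefXn coefMX mulr0 subr0. Qed.

Lemma centre_alphaS (j : 'I_a') :
  (centre_alpha L)`_j.+1 = - (\adj (mid_block L) *m end_column ord_max L) j 0.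
Proof.
rewrite coefB coefZ coefXn coefMX /= coef_rVpoly_ord mxE eqSS ltn_eqF ?ltn_ord //.
by rewrite mulr0 sub0r.
Qed.

Lemma size_rVpolyX (v : 'rV[k]_a') : (size (rVpoly v * 'X)%R <= a)%N.
Proof.
by rewrite (leq_trans (size_polyMleq _ _)) // size_polyX addn2 ltnS size_poly.
Qed.

Lemma centre_alpha_max : (centre_alpha L)`_a = d.
Proof.
rewrite coefB coefZ coefXn eqxx mulr1 [X in _ - X]nth_default ?subr0 //.
exact: size_rVpolyX.
Qed.

Lemma centre_beta0 : (centre_beta L)`_0 = d.
Proof. by rewrite coefB coefC coefMX subr0. Qed.

Lemma centre_betaS (j : 'I_a') :
  (centre_beta L)`_j.+1 = - (\adj (mid_block L) *m end_column ord0 L) j 0.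
Proof. by rewrite coefB coefC coefMX /= coef_rVpoly_ord mxE sub0r. Qed.

Lemma size_centre_beta : (size (centre_beta L) <= a)%N.
Proof.
rewrite (leq_trans (size_polyD _ _)) // geq_max size_polyN size_rVpolyX andbT.
by rewrite (leq_trans (size_polyC_leq1 _)).
Qed.

Lemma size_centre_alpha : (size (centre_alpha L) <= a.+1)%N.
Proof.
rewrite (leq_trans (size_polyD _ _)) // geq_max size_polyN (leqW (size_rVpolyX _)) andbT.
by rewrite (leq_trans (size_scale_leq _ _)) // size_polyXn.
Qed.

Lemma sum_centre (p : {poly k}) i :
  \sum_(j < a.+1) L i (lshift m j) * p`_j =
  L i (lshift m ord0) * p`_0 + \sum_(j < a') mid_block L i j * p`_j.+1
    + L i (lshift m ord_max) * p`_a.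
Proof.
rewrite big_ord_recl big_ord_recr addrA /=; congr (_ + _ + L i (lshift m _) * _).
  apply: eq_bigr => j _; rewrite mxE; congr (_ * _).
by apply: val_inj.
Qed.

Lemma mid_block_adj (c : 'cV[k]_a') i :
  \sum_(j < a') mid_block L i j * - (\adj (mid_block L) *m c) j 0 = - (d * c i 0).
Proof.
rewrite -mulNr; have := congr1 (fun A : 'cV_a' =>
  A i 0) (mulmxA (mid_block L) (\adj (mid_block L)) c).
rewrite mul_mx_adj mul_scalar_mx [X in _ = X]mxE mxE mulNr => <-.
by rewrite -sumrN; apply: eq_bigr => j _; rewrite mulrN.
Qed.

Lemma centre_alpha_orthogonal i : \sum_(j < a.+1) L i (lshift m j) * (centre_alpha L)`_j = 0.
Proof.
rewrite sum_centre centre_alpha0 centre_alpha_max mulr0 add0r.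
under eq_bigr => j _ do rewrite centre_alphaS.
by rewrite mid_block_adj mxE mulrC addNr.
Qed.

Lemma centre_beta_orthogonal i : \sum_(j < a.+1) L i (lshift m j) * (centre_beta L)`_j = 0.
Proof.
rewrite sum_centre centre_beta0 [(centre_beta L)`_a]nth_default ?size_centre_beta //.
under eq_bigr => j _ do rewrite centre_betaS.
by rewrite mid_block_adj mxE mulr0 addr0 mulrC subrr.
Qed.

Lemma coprime_centre : centre_res L != 0 -> coprimep (centre_alpha L) (centre_beta L).
Proof.
move=> r0; apply: coprimep_of_roots => t ha hb; case/eqP: r0.
by apply: (res_common_root _ _ _ hb ha); rewrite ?size_centre_alpha // leqW ?size_centre_beta.
Qed.

End CentreEquations.

(** * Coordinates on the target of the projection *)

Section Projection.

Variables (k : closedFieldType) (a b : nat) (alpha beta : {poly k}).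
Hypotheses (malpha : alpha \is monic) (salpha : size alpha = a.+1).
Hypotheses (sbeta : (size beta <= a)%N) (beta0 : beta != 0).

Local Notation mk := (@mk k b).

(** When alpha and beta are orthogonal to a centre of rank a - 1 in the span of E, the rows form a
    basis of the hyperplanes through it. *)
Definition hyperplane_mx : 'M[k]_(b.+3, a.+1 + b.+1) :=
  \matrix_(i, l) match split l with
    | inl j => mk alpha`_j beta`_j 0 0 i
    | inr j => mk 0 0 'X^j 0 i
    end.

Lemma mul_hyperplane_mx_tr (x : 'rV[k]_(a.+1 + b.+1)) : x *m hyperplane_mx^T =
  mk (\sum_(j < a.+1) x 0 (lshift _ j) * alpha`_j) (\sum_(j < a.+1) x 0 (lshift _ j) * beta`_j)
     (\sum_(j < b.+1) x 0 (rshift _ j) *: 'X^j).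
Proof.
transitivity (\sum_(j < a.+1) x 0 (lshift _ j) *: mk alpha`_j beta`_j 0
    + \sum_(j < b.+1) x 0 (rshift _ j) *: mk 0 0 'X^j).
  apply/rowP => i; rewrite mxE big_split_ord mxE !summxE /=.
  congr (_ + _); apply: eq_bigr => j _; rewrite [hyperplane_mx^T _ _]mxE [hyperplane_mx _ _]mxE.
    by rewrite (unsplitK (inl j)) [RHS]mxE.
  by rewrite (unsplitK (inr j)) [RHS]mxE.
rewrite -[RHS](_ : mk (\sum_(j < a.+1) x 0 (lshift _ j) * alpha`_j)
    (\sum_(j < a.+1) x 0 (lshift _ j) * beta`_j) 0
  + mk 0 0 (\sum_(j < b.+1) x 0 (rshift _ j) *: 'X^j) = _); last by rewrite mkD !addr0 add0r.
congr (_ + _).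
  elim/big_ind3: _ => [|p1 u1 q1 p2 u2 q2 h1 h2|j _]; first by rewrite mk0.
    by rewrite h1 h2 mkD addr0.
  by rewrite mkZ scaler0.
elim/big_ind2: _ => [|p1 u1 p2 u2 h1 h2|j _]; first by rewrite mk0.
  by rewrite h1 h2 mkD !addr0.
by rewrite mkZ !mulr0.
Qed.

Lemma scroll_point_hyperplane_mx s t u v :
  scroll_point a b s t u v *m hyperplane_mx^T = pt a b alpha beta s t u v.
Proof.
rewrite mul_hyperplane_mx_tr /pt /scroll_point; congr mk.
- by rewrite /hev mulr_sumr; apply: eq_bigr => j _; rewrite row_mxEl mxE; ring.
- by rewrite /hev mulr_sumr; apply: eq_bigr => j _; rewrite row_mxEl mxE; ring.
by rewrite poly_def; apply: eq_bigr => j _; rewrite row_mxEr mxE.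
Qed.

Lemma row_free_hyperplane_mx : row_free hyperplane_mx.
Proof.
rewrite -kermx_eq0; apply/eqP/row_matrixP => i; rewrite row0.
have : row i (kermx hyperplane_mx) *m hyperplane_mx = 0 by rewrite -row_mul mulmx_ker row0.
set y := row i _ => e.
have entry l (w : 'rV[k]_b.+3) : (forall i, hyperplane_mx i l = w 0 i) -> dot y w = 0.
  move=> h; have := congr1 (fun v : 'rV_(a.+1 + b.+1) => v 0 l) e; rewrite [RHS]mxE mxE => <-.
  by rewrite dotE; apply: eq_bigr => j _; rewrite h.
have eA : y 0 i0 *: alpha + y 0 i1 *: beta = 0.
  apply/polyP => j; rewrite coef0; have [ja|ja] := ltnP j a.+1; last first.
    rewrite coefD !coefZ !nth_default ?mulr0 ?addr0 //.
      by rewrite (leq_trans sbeta) // (leq_trans _ ja).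
    by rewrite salpha.
  rewrite -[RHS](entry (lshift _ (Ordinal ja)) (mk alpha`_j beta`_j 0)) => [|l].
    by rewrite dot_mk0 coefD !coefZ; ring.
  by rewrite mxE (unsplitK (inl _)).
have y0 : y 0 i0 = 0.
  have := congr1 (fun p : {poly k} => p`_a) eA; rewrite coefD !coefZ [beta`_a]nth_default //.
  by have := monicP malpha; rewrite lead_coefE salpha /= => ->; rewrite mulr1 mulr0 addr0 coef0.
have y1 : y 0 i1 = 0.
  move/eqP: eA; rewrite y0 scale0r add0r scaler_eq0 (negPf beta0) orbF.
  by move/eqP.
have yC : pC y = 0.
  rewrite -[RHS](@pC_mk k b 0 0 0) ?size_poly0 //; apply: eq_pC => j jb.
  rewrite pC_mk ?size_poly0 // coef0 -dot_coefXn // dotC.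
  have jb' : (j < b.+1)%N by [].
  by apply: (entry (rshift _ (Ordinal jb'))) => l; rewrite mxE (unsplitK (inr _)).
by rewrite -(mk_eta y) y0 y1 yC mk0.
Qed.

(* The hyperplanes of the target of the projection are those of the source that
   contain the centre. *)
Lemma projected_scroll (r : nat) (L : 'M[k]_(r, a.+1 + b.+1)) (P : 'M[k]_(a.+1 + b.+1, b.+3)) :
  (r + 2 = a.+1)%N -> row_free L -> (kermx P == L)%MS -> L *m hyperplane_mx^T = 0 ->
  exists2 H : 'M[k]_b.+3, H \in unitmx &
    projected P (scroll k a b) = pullback H (@std_scroll k a b alpha beta).
Proof.
move=> ra fL /eqmxP kL LN; set N := hyperplane_mx.
have rL : \rank L = r by apply/eqP.
have sP : (P^T <= kermx L^T)%MS.
  by apply/sub_kermxP; rewrite -trmx_mul; apply/trmx_inj; rewrite trmxK trmx0; apply/sub_kermxP;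
    rewrite kL.
have rP : \rank P^T = b.+3.
  have h := mxrank_ker P; rewrite kL rL in h.
  by rewrite mxrank_tr; move: (\rank P) h (rank_leq_row P) ra => q; clear; lia.
have sN : (N <= kermx L^T)%MS.
  apply/sub_kermxP; rewrite -[N]trmxK -trmx_mul; apply/trmx_inj; rewrite trmxK trmx0; exact: LN.
(* Dimension count: [a + b + 2 - r = b + 3] as [r = a - 1]. So [P^T] and [N] have the same row
   space, the hyperplanes through the centre. *)
have rk : \rank (kermx L^T) = b.+3.
  by rewrite mxrank_ker mxrank_tr rL; move: ra; clear; lia.
have /submxP [M eM] : (N <= P^T)%MS.
  apply: submx_trans sN _; have := mxrank_leqif_sup sP; rewrite rP rk.
  by case=> _ /esym; rewrite eqxx.
have uM : M \in unitmx.
  rewrite -row_free_unit -row_leq_rank -[X in (X <= _)%N](eqP row_free_hyperplane_mx).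
  by rewrite -/N eM mxrankM_maxl.
exists M^T; first by rewrite unitmx_tr.
have key x : x *m P *m M^T = x *m N^T by rewrite eM trmx_mul trmxK mulmxA.
apply: pset_ext => z; rewrite /projected /pullback /std_scroll mulmx_unit_neq0 ?unitmx_tr //.
split=> [[z0 [x [[x0 [s [t [u [v [st ex]]]]]] ez]]]|[z0 [s [t [u [v [st ez]]]]]]]; split=> //.
  exists s, t, u, v; split=> //.
  by rewrite ez key ex scroll_point_hyperplane_mx.
exists (scroll_point a b s t u v).
have ez' : z = scroll_point a b s t u v *m P.
  apply: (can_inj (mulmxK (_ : M^T \in unitmx))); first by rewrite unitmx_tr.
  by rewrite ez key scroll_point_hyperplane_mx.
split=> //; split; last by exists s, t, u, v.
by apply: contra z0 => /eqP e0; rewrite ez' e0 mul0mx.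
Qed.

End Projection.

Lemma in_span_scroll_section (k : closedFieldType) a b (x : 'rV[k]_(a.+1 + b.+1)) :
  in_span (scroll_section k a b) x -> rsubmx x = 0.
Proof.
move=> hx; have /submxP [c ->] : (x <= row_mx (1%:M : 'M[k]_a.+1) (0 : 'M_(a.+1, b.+1)))%MS.
  apply: hx => y [_ [s [t [u [_ ->]]]]].
  rewrite /scroll_point (_ : \row_(j < b.+1) (0 * s ^+ (b - j) * t ^+ j) = 0).
    by apply/submxP; eexists; rewrite mul_mx_row mulmx1 mulmx0.
  by apply/rowP => j; rewrite !mxE !mul0r.
by rewrite mul_mx_row mulmx0 row_mxKr.
Qed.

(** A linear form vanishing on the rational normal curve is a polynomial in the parameter [t] with
    all values zero, so its coefficients on this block vanish. *)
Lemma scroll_section_spans (k : closedFieldType) a b (x : 'rV[k]_a.+1) :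
  in_span (scroll_section k a b) (row_mx x 0).
Proof.
move=> m B hB; rewrite submxE; apply/eqP/rowP => l; rewrite [RHS]mxE.
pose c := cokermx B.
have p0 : \poly_(j < a.+1) c (lshift _ (inord j)) l = 0.
  apply: poly_ext => t; rewrite horner0.
  pose y := scroll_point a b 1 t 1 0.
  have yl j : y 0 (lshift _ j) = t ^+ j by rewrite row_mxEl mxE expr1n !mul1r.
  have yr j : y 0 (rshift _ j) = 0 by rewrite row_mxEr mxE !mul0r.
  have : (y <= B)%MS.
    apply: hB; split; last by exists 1, t, 1; rewrite xpair_eqE oner_eq0.
    by apply/rV0Pn; exists (lshift _ ord0); rewrite yl expr0 oner_eq0.
  rewrite submxE => /eqP /rowP /(_ l); rewrite [RHS]mxE => e; rewrite -[RHS]e.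
  rewrite mxE big_split_ord /= [X in _ = _ + X]big1 ?addr0 => [|j _]; last first.
    by rewrite yr mul0r.
  by rewrite horner_poly; apply: eq_bigr => j _; rewrite yl inord_val mulrC.
rewrite mxE big_split_ord /= [X in _ + X]big1 ?addr0 => [|j _]; last first.
  by rewrite row_mxEr mxE mul0r.
apply: big1 => j _; have := congr1 (fun p : {poly k} => p`_j) p0.
by rewrite coef_poly ltn_ord inord_val coef0 => ->; rewrite mulr0.
Qed.

Lemma polar_fibres_linear_std_scroll (k : closedFieldType) (char0 : [pchar k] =i pred0) a b
    (alpha beta : {poly k}) :
  (0 < a)%N -> (a < b)%N -> alpha \is monic -> size alpha = a.+1 -> (size beta <= a)%N ->
  coprimep alpha beta ->
  polar_fibres_linear (b - a) (@std_scroll k a b alpha beta).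
Proof.
move=> a0 ab ma sa sb cab; split.
  by eexists; apply: (hypersurface_form_dual_std_scroll a0 ab ma sa sb cab char0).
exact: (general_fibre_std_scroll a0 ab ma sa sb cab char0).
Qed.

(* A centre where the two end coordinates are free: [centre_alpha] and
   [centre_beta] are [X ^ a] and [1]. *)
Lemma exists_general_centre (k : closedFieldType) a' b :
  exists L : 'M[k]_(a', a'.+2 + b.+1),
    (forall i, in_span (scroll_section k a'.+1 b) (row i L)) /\
    \det (mid_block L) * centre_res L != 0.
Proof.
pose L1 : 'M[k]_(a', a'.+2) := \matrix_(i, j) ((j : nat) == i.+1)%:R.
exists (row_mx L1 0); split.
  by move=> i; rewrite row_row_mx row0; apply: scroll_section_spans.
have mid : mid_block (row_mx L1 (0 : 'M_(a', b.+1))) = 1%:M.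
  by apply/matrixP => i j; rewrite mxE row_mxEl !mxE /= /bump add1n eqSS eq_sym.
have end0 (j : 'I_a'.+2) : (forall i : 'I_a', (j : nat) != i.+1) ->
    end_column j (row_mx L1 (0 : 'M_(a', b.+1))) = 0.
  by move=> h; apply/colP => i; rewrite mxE row_mxEl !mxE (negPf (h i)).
rewrite /centre_res /centre_alpha /centre_beta mid det1 mul1r !end0 => [| i | i] //; last first.
  by rewrite eqSS gtn_eqF.
rewrite mulmx0 trmx0 linear0 mul0r !subr0 scale1r.
by apply: res_neq0; rewrite ?size_polyC ?oner_neq0 ?size_polyXn // coprime1p.
Qed.

Theorem theorem3p12 (k : closedFieldType) (char0 : [pchar k] =i pred0)
    (a b : nat) (a_gt0 : (1 <= a)%N) (lt_ab : (a < b)%N) :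
  for_scroll_surface_X k a b (fun X : pset k b.+3 =>
    (exists f : {mpoly k[b.+3]}, hypersurface_form (dual_variety X) f) /\
    (forall f : {mpoly k[b.+3]}, hypersurface_form (dual_variety X) f ->
       general_point (zclosure (polar_image f)) (fun z =>
         linear_subspace (b - a) (zclosure (polar_fibre f z))))).
Proof.
case: a a_gt0 lt_ab => [//|a'] a_gt0 lt_ab.
(* The generic centre. For [a = 1] it has no rows, and the formulas give alpha = X and beta = 1. *)
pose Lgen : 'M[{mpoly k[a' * (a'.+2 + b.+1)]}]_(a', a'.+2 + b.+1) :=
  \matrix_(i, j) 'X_(mxvec_index i j).
(* The first factor allows alpha to be normalized as monic of degree [a]; the second makes alpha and
   beta coprime. *)
pose F := \det (mid_block Lgen) * centre_res Lgen.
have FE (L : 'M[k]_(a', a'.+2 + b.+1)) :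
    F.@[mxvec L 0] = \det (mid_block L) * centre_res L.
  have eL : map_mx (meval (mxvec L 0)) Lgen = L.
    by apply/matrixP => i j; rewrite !mxE mevalXU mxvecE.
  by rewrite mevalM map_centre_res -det_map_mx map_mid_block eL.
exists F; split.
  by have [L [sL nL]] := exists_general_centre k a' b; exists L; rewrite FE.
move=> L sL fL; rewrite FE mulf_eq0 negb_or => /andP[d0 r0] P kL.
set d := \det _ in d0.
have r2 i : rsubmx (row i L) = 0 by apply: in_span_scroll_section (sL i).
have ma : d^-1 *: centre_alpha L \is monic.
  have nA : (centre_alpha L)`_a'.+1 != 0 by rewrite centre_alpha_max.
  have sA : size (centre_alpha L) = a'.+2.
    apply/eqP; rewrite eqn_leq size_centre_alpha ltnNge.
    by apply: contra nA => h; rewrite nth_default.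
  by rewrite monicE lead_coefZ lead_coefE sA /= centre_alpha_max mulVf.
have sa : size (d^-1 *: centre_alpha L) = a'.+2.
  have nA : (centre_alpha L)`_a'.+1 != 0 by rewrite centre_alpha_max.
  rewrite size_scale ?invr_eq0 //; apply/eqP; rewrite eqn_leq size_centre_alpha ltnNge.
  by apply: contra nA => h; rewrite nth_default.
have sb := size_centre_beta L.
have cop : coprimep (d^-1 *: centre_alpha L) (centre_beta L).
  by rewrite coprimepZl ?invr_eq0 // coprime_centre.
have b0 : centre_beta L != 0.
  by apply: contra d0 => /eqP h; rewrite /d -centre_beta0 h coef0.
have LN : L *m (hyperplane_mx a'.+1 b (d^-1 *: centre_alpha L) (centre_beta L))^T = 0.
  apply/row_matrixP => i; rewrite row_mul row0 mul_hyperplane_mx_tr -mk0; congr mk.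
  - transitivity (d^-1 * \sum_(j < a'.+2) L i (lshift _ j) * (centre_alpha L)`_j).
      by rewrite mulr_sumr; apply: eq_bigr => j _; rewrite coefZ mxE; ring.
    by rewrite centre_alpha_orthogonal mulr0.
  - rewrite -[RHS](centre_beta_orthogonal L i); apply: eq_bigr => j _; by rewrite mxE.
  - apply: big1 => j _; have := congr1 (fun v : 'rV_b.+1 => v 0 j) (r2 i).
    by rewrite !mxE => ->; rewrite scale0r.
have [|H uH ->] := projected_scroll ma sa sb b0 _ fL kL LN; first by rewrite addn2.
apply: polar_fibres_linear_pullback => //.
exact: polar_fibres_linear_std_scroll.
Qed.
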